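(* Let $1\le k\le n-1$ and $f\in L^2\Lambda^k(\Omega)$. Let (c) $(\omega^{c}_h,\zeta^{c}_h,\sigma^{c}_h,\vartheta^{c}_h)\in\mathcal{P}_0\Lambda^k(\mathcal{G}_h)\times\mathbf{W}^*_{h0}\Lambda^{k+1}\times\mathbf{W}^{\rm nc}_h\Lambda^{k-1}\times\mathfrak{H}^{\rm nc}_h\Lambda^k$ be the solution of: for all $(\mu_h,\eta_h,\tau_h,\varsigma_h)$ in the same product space, $\langle\omega^c_h,\varsigma_h\rangle=0$, $\ \langle\mathbf{P}^{k+1}_h\zeta^c_h,\mathbf{P}^{k+1}_h\eta_h\rangle-\langle\omega^c_h,\delta_{k+1}\eta_h\rangle=0$, $\ \langle\mathbf{P}^{k-1}_h\sigma^c_h,\mathbf{P}^{k-1}_h\tau_h\rangle-\langle\omega^c_h,d^{k-1}_h\tau_h\rangle=0$, $\ \langle\vartheta^c_h,\mu_h\rangle+\langle\delta_{k+1}\zeta^c_h,\mu_h\rangle+\langle d^{k-1}_h\sigma^c_h,\mu_h\rangle=\langle f,\mu_h\rangle$; (p) $(\omega^{p}_h,\sigma^{p}_h,\vartheta^{p}_h)\in\mathbf{W}^{\rm nc}_h\Lambda^k\times\mathbf{W}^{\rm nc}_h\Lambda^{k-1}\times\mathfrak{H}^{\rm nc}_h\Lambda^k$ be the solution of: for all $(\mu_h,\tau_h,\varsigma_h)$ in the same product space, $\langle\omega^p_h,\varsigma_h\rangle=0$, $\ \langle\mathbf{P}^{k-1}_h\sigma^p_h,\mathbf{P}^{k-1}_h\tau_h\rangle-\langle\omega^p_h,d^{k-1}_h\tau_h\rangle=0$,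 $\ \langle\vartheta^p_h,\mu_h\rangle+\langle d^{k-1}_h\sigma^p_h,\mu_h\rangle+\langle d^k_h\omega^p_h,d^k_h\mu_h\rangle=\langle f,\mathbf{P}^k_h\mu_h\rangle$; (d) $(\omega^{d}_h,\zeta^{d}_h,\vartheta^{d}_h)\in\mathbf{W}^*_{h0}\Lambda^k\times\mathbf{W}^*_{h0}\Lambda^{k+1}\times\mathfrak{H}^*_{h0}\Lambda^k$ be the solution of: for all $(\mu_h,\eta_h,\varsigma_h)$ in the same product space, $\langle\omega^d_h,\varsigma_h\rangle=0$, $\ \langle\mathbf{P}^{k+1}_h\zeta^d_h,\mathbf{P}^{k+1}_h\eta_h\rangle-\langle\omega^d_h,\delta_{k+1}\eta_h\rangle=0$, $\ \langle\vartheta^d_h,\mu_h\rangle+\langle\delta_{k+1}\zeta^d_h,\mu_h\rangle+\langle\delta_k\omega^d_h,\delta_k\mu_h\rangle=\langle f,\mathbf{P}^k_h\mu_h\rangle$. Then $$\vartheta^d_h=\vartheta^c_h,\quad\zeta^d_h=\zeta^c_h,\quad\mathbf{P}^k_h\omega^d_h=\omega^c_h,\quad\delta_k\omega^d_h=\mathbf{P}^{k-1}_h\sigma^c_h,\quad\delta_{k+1}\zeta^d_h=\mathbf{P}^k_hf-d^{k-1}_h\sigma^c_h-\vartheta^c_h,$$ $$\vartheta^p_h=\vartheta^c_h,\quad\sigma^p_h=\sigma^c_h,\quad\mathbf{P}^k_h\omega^p_h=\omega^c_h,\quad d^k_h\omega^p_h=\mathbf{P}^{k+1}_h\zeta^c_h,\quad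 d^{k-1}_h\sigma^p_h=\mathbf{P}^k_hf-\delta_{k+1}\zeta^c_h-\vartheta^c_h,$$ $$\vartheta^d_h=\vartheta^p_h,\quad\mathbf{P}^{k+1}_h\zeta^d_h=d^k_h\omega^p_h,\quad\mathbf{P}^k_h\omega^d_h=\mathbf{P}^k_h\omega^p_h,\quad\delta_k\omega^d_h=\mathbf{P}^{k-1}_h\sigma^p_h,\quad\delta_{k+1}\zeta^d_h+d^{k-1}_h\sigma^p_h=\mathbf{P}^k_hf-\vartheta^c_h.$$
   Context: Let $n\ge 2$, let $\Omega\subset\mathbb{R}^n$ be a bounded polyhedral domain and $\mathcal{G}_h$ a simplicial subdivision of $\Omega$. All inner products $\langle\cdot,\cdot\rangle$ are $L^2(\Omega)$ inner products of forms of the appropriate degree. Forms. $d^k$ is the exterior derivative on $k$-forms, $\star$ the Hodge star, and $\delta_k$ the codifferential on $k$-forms, i.e. the formal adjoint of $d^{k-1}$: $\langle d^{k-1}\mu,\eta\rangle=\langle\mu,\delta_k\eta\rangle$ whenever one of the smooth forms $\mu,\eta$ has compact support (thus $\delta_k=\pm\star d^{n-k}\star$). $H^*\Lambda^k(\Omega)=\{\mu\in L^2\Lambda^k(\Omega):\delta_k\mu\in L^2\Lambda^{k-1}(\Omega)\}$ with the graph norm, and $H^*_0\Lambda^k(\Omega)$ is the closure in it of smooth compactly supported forms. Whitney forms. $\mathcal{P}_0\Lambda^k$ denotes constant-coefficient $k$-forms. The Koszul operator is $\kappa(dx^{\alpha_1}\wedge\dots\wedge dx^{\alpha_k})=\sum_{j=1}^k(-1)^{j+1}x^{\alpha_j}dx^{\alpha_1}\wedge\dots\wedge\widehat{dx^{\alpha_j}}\wedge\dots\wedge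 dx^{\alpha_k}$; $\mathcal{P}_1^-\Lambda^k=\mathcal{P}_0\Lambda^k+\kappa(\mathcal{P}_0\Lambda^{k+1})$, $\mathcal{P}_1^{*,-}\Lambda^k=\star(\mathcal{P}_1^-\Lambda^{n-k})$. $\mathcal{P}_0\Lambda^k(\mathcal{G}_h)$, $\mathcal{P}_1^-\Lambda^k(\mathcal{G}_h)$, $\mathcal{P}_1^{*,-}\Lambda^k(\mathcal{G}_h)$ are the corresponding piecewise spaces (no inter-element continuity). $d^k_h$ is $d^k$ applied cell by cell. $\mathbf{P}^k_h$ is the $L^2\Lambda^k(\Omega)$ projection onto $\mathcal{P}_0\Lambda^k(\mathcal{G}_h)$. Spaces. $\mathbf{W}^*_{h0}\Lambda^k=\mathcal{P}_1^{*,-}\Lambda^k(\mathcal{G}_h)\cap H^*_0\Lambda^k(\Omega)$; for $0\le k\le n-1$, $\mathbf{W}^{\rm nc}_h\Lambda^k=\{\omega_h\in\mathcal{P}_1^-\Lambda^k(\mathcal{G}_h):\langle\omega_h,\delta_{k+1}\eta_h\rangle-\langle d^k_h\omega_h,\eta_h\rangle=0\ \forall\,\eta_h\in\mathbf{W}^*_{h0}\Lambda^{k+1}\}$. $\mathfrak{H}^{\rm nc}_h\Lambda^k$ is the $L^2$-orthogonal complement of $d^{k-1}_h(\mathbf{W}^{\rm nc}_h\Lambda^{k-1})$ in $\{\omega_h\in\mathbf{W}^{\rm nc}_h\Lambda^k:d^k_h\omega_h=0\}$, and $\mathfrak{H}^*_{h0}\Lambda^k$ is the $L^2$-orthogonal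 complement of $\delta_{k+1}(\mathbf{W}^*_{h0}\Lambda^{k+1})$ in $\{\mu_h\in\mathbf{W}^*_{h0}\Lambda^k:\delta_k\mu_h=0\}$. Each of the three problems has a unique solution. *)

(* Defs.v *)
From HB Require Import structures.
From mathcomp Require Import all_boot all_order all_algebra.
From mathcomp Require Import all_classical all_reals all_analysis.
Set Implicit Arguments.
Unset Strict Implicit.
Unset Printing Implicit Defensive.
Import Order.TTheory GRing.Theory Num.Theory.
Import numFieldNormedType.Exports.
Local Open Scope classical_set_scope.
Local Open Scope ring_scope.

(** * Lebesgue measure on R^n *)

(* The sigma-algebra on row vectors is the product (hence Borel) one, generated
   by the coordinates, exactly as the library does for tuples. *)

Fact rV_display : measure_display. Proof. exact: default_measure_display. Qed.

Section measurable_rV.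
Variables (R : realType) (n : nat).

Let coors : 'I_n -> 'rV[R]_n -> R := fun i x => x ord0 i.

Let rV_set0 : g_sigma_preimage coors set0.
Proof. exact: sigma_algebra0. Qed.

Let rV_setC A : g_sigma_preimage coors A -> g_sigma_preimage coors (~` A).
Proof. exact: sigma_algebraC. Qed.

Let rV_bigcup (F : _^nat) : (forall i, g_sigma_preimage coors (F i)) ->
  g_sigma_preimage coors (\bigcup_i (F i)).
Proof. exact: sigma_algebra_bigcup. Qed.

HB.instance Definition _ := @isMeasurable.Build rV_display
  'rV[R]_n (g_sigma_preimage coors) rV_set0 rV_setC rV_bigcup.

End measurable_rV.

Lemma measurable_rV_coord (R : realType) (n : nat) (i : 'I_n) :
  measurable_fun [set: 'rV[R]_n] (fun x : 'rV[R]_n => x ord0 i).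
Proof.
move=> _ Y mY; rewrite setTI; apply: sub_sigma_algebra => /=.
rewrite -bigcup_seq/=; exists i => /=; first by rewrite mem_index_enum.
by exists Y => //; rewrite setTI.
Qed.

Lemma measurable_fun_rVP d (T : measurableType d) (R : realType) (n : nat)
    (f : T -> 'rV[R]_n) :
  (forall i, measurable_fun [set: T] (fun x => f x ord0 i)) ->
  measurable_fun [set: T] f.
Proof.
move=> mf _ Y mY; rewrite setTI; move: Y mY.
apply: smallest_sub.
  split=> [|A mA|F mF].
  - by rewrite /= preimage_set0.
  - by rewrite /= setTD -preimage_setC; exact: measurableC.
  - by rewrite /= preimage_bigcup; exact: bigcup_measurable.
move=> A; rewrite -bigcup_seq => -[i _] [B mB <-] /=.
by rewrite setTI -[X in measurable X]setTI; exact: (mf i).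
Qed.

Section lebesgue_rV.
Variable R : realType.

Definition rV_cons n (p : 'rV[R]_n * R) : 'rV[R]_n.+1 :=
  row_mx (const_mx p.2 : 'rV_1) p.1.

Lemma measurable_rV_cons n : measurable_fun setT (@rV_cons n).
Proof.
apply: measurable_fun_rVP => i.
case: (@split_ordP 1 n i) => j ->.
  have -> : (fun p : 'rV[R]_n * R => rV_cons p ord0 (lshift n j)) = snd.
    apply/funext => p.
    by rewrite (row_mxEl (const_mx p.2 : 'rV_1) p.1 ord0 j : rV_cons p _ _ = _) mxE.
  exact: measurable_snd.
rewrite (_ : (fun p => rV_cons p ord0 _) = (fun v : 'rV[R]_n => v ord0 j) \o fst).
  by apply: measurableT_comp; [exact: measurable_rV_coord|exact: measurable_fst].
by apply/funext => p; exact: (row_mxEr (const_mx p.2 : 'rV_1) p.1 ord0 j).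
Qed.

Fixpoint lebesgue_rV (n : nat) : set 'rV[R]_n -> \bar R :=
  match n with
  | 0 => \d_(0 : 'rV[R]_0)
  | n'.+1 => pushforward
      (product_measure1 (@lebesgue_rV n') (@lebesgue_measure R)) (@rV_cons n')
  end.

Lemma lebesgue_rV_measureP n :
  {m : {measure set 'rV[R]_n -> \bar R} | m = @lebesgue_rV n :> (_ -> _)}.
Proof.
elim: n => [|n [m em]] /=; first by exists (\d_(0 : 'rV[R]_0)).
rewrite -em.
pose p : {measure set _ -> \bar R} := product_measure1 m (@lebesgue_measure R).
pose q := measure_function_pushforward__canonical__measure_function_Measure
  p (@measurable_rV_cons n).
by exists q.
Qed.

Section instance.
Variable n : nat.

Let leb0 : @lebesgue_rV n set0 = 0%E.
Proof. by have [m <-] := lebesgue_rV_measureP n; exact: measure0. Qed.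

Let leb_ge0 A : (0 <= @lebesgue_rV n A)%E.
Proof. by have [m <-] := lebesgue_rV_measureP n; exact: measure_ge0. Qed.

Let leb_sigma_additive : semi_sigma_additive (@lebesgue_rV n).
Proof.
by have [m <-] := lebesgue_rV_measureP n; exact: measure_semi_sigma_additive.
Qed.

HB.instance Definition _ := isMeasure.Build _ _ _ (@lebesgue_rV n)
  leb0 leb_ge0 leb_sigma_additive.

End instance.
End lebesgue_rV.

(** * Differential forms *)

(* A value w : {ffun {set 'I_n} -> R} of the exterior algebra stands for
   \sum_A w A *: dx^A with dx^A := dx^{a_1} /\ ... /\ dx^{a_k} for
   A = {a_1 < ... < a_k}; the dx^A are orthonormal. Forms of all degrees share
   the type below, and [homog k] singles out the k-forms. *)
Definition dform (R : realType) (n : nat) := 'rV[R]_n -> {ffun {set 'I_n} -> R}.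

Section forms.
Variables (R : realType) (n : nat).
Implicit Types (w f g phi mu eta : dform R n) (A B : {set 'I_n}) (k : nat).

Definition homog k w := forall x A, #|A| != k -> w x A = 0.

(* dx^i /\ dx^A = isign i A *: dx^(i |: A) when i \notin A *)
Definition isign (i : 'I_n) A : R := (-1) ^+ #|[set j in A | (j < i)%N]|.

(* dx^A /\ dx^(~: A) = ssign A *: dx^1 /\ ... /\ dx^n *)
Definition ssign A : R :=
  (-1) ^+ #|[set p : 'I_n * 'I_n | [&& p.1 \in A, p.2 \notin A & (p.2 < p.1)%N]]|.

Definition basis_vec (i : 'I_n) : 'rV[R]_n := delta_mx ord0 i.

Definition ext_d w : dform R n := fun x => [ffun B : {set 'I_n} =>
  \sum_(i in B) isign i B * 'D_(basis_vec i) (fun y => w y (B :\ i)) x].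

Definition hodge w : dform R n := fun x => [ffun B : {set 'I_n} => ssign (~: B) * w x (~: B)].

(* [isign i B = isign i (i |: B)] is the sign (-1)^(j+1) of the j-th factor *)
Definition koszul w : dform R n := fun x => [ffun B : {set 'I_n} =>
  \sum_(i | i \notin B) isign i B * x ord0 i * w x (i |: B)].

Definition P0 k : set (dform R n) :=
  [set w | homog k w /\ forall x y, w x = w y].

Definition P1m k : set (dform R n) :=
  [set w | exists a b, [/\ P0 k a, P0 k.+1 b & w = fun x => a x + koszul b x]].

(* used for k <= n only *)
Definition P1sm k : set (dform R n) := hodge @` P1m (n - k).

(** ** Smooth forms *)

(* all partial derivatives of order <= m exist and are continuous *)
Fixpoint Cm (m : nat) (u : 'rV[R]_n -> R) : Prop :=
  continuous u /\
  match m with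
  | 0 => True
  | m'.+1 => forall i, (forall x, derivable u x (basis_vec i)) /\
                       Cm m' ('D_(basis_vec i) u)
  end.

Definition smooth_form w := forall A m, Cm m (fun x => w x A).

End forms.

(** * L^2 forms on a domain *)

(* Elements of L^2 are represented by functions on R^n of which only the values
   on Omega matter; they are identified by [feq], equality a.e. on Omega. *)

Section L2.
Variables (R : realType) (n : nat) (Omega : set 'rV[R]_n).
Implicit Types (w f g phi psi mu eta : dform R n) (k : nat).

Definition feq f g : Prop := f = g %[ae (@lebesgue_rV R n) in Omega].

Definition L2form k : set (dform R n) := [set w | homog k w /\
  forall A, measurable_fun Omega (fun x => w x A) /\
    (@lebesgue_rV R n).-integrable Omega (fun x => ((w x A) ^+ 2)%:E)].

Definition ip w g : R :=
  \sum_(A : {set 'I_n}) \int[@lebesgue_rV R n]_(x in Omega) (w x A * g x A).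

Definition test_form k : set (dform R n) :=
  [set phi | [/\ homog k phi, smooth_form phi &
    exists K, [/\ compact K, K `<=` Omega & forall x, ~ K x -> phi x = 0]]].

(* g is the weak codifferential of the k-form mu, 0 < k *)
Definition is_codiff k mu g : Prop := L2form k.-1 g /\
  forall phi, test_form k.-1 phi -> ip (ext_d phi) mu = ip phi g.

(* a.e. uniquely determined when it exists *)
Definition codiff k mu : dform R n := xget (fun=> 0) [set g | is_codiff k mu g].

Definition Hstar k : set (dform R n) :=
  [set mu | L2form k mu /\ exists g, is_codiff k mu g].

Definition graph_normsq k mu : R :=
  ip mu mu + ip (codiff k mu) (codiff k mu).

Definition Hstar0 k : set (dform R n) := [set mu | Hstar k mu /\
  forall e : R, 0 < e -> exists phi, test_form k phi /\
    Num.sqrt (graph_normsq k (fun x => mu x - phi x)) < e].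

(* L^2-orthogonal projection onto the space V *)
Definition L2proj (V : set (dform R n)) w : dform R n :=
  xget (fun=> 0) [set g | V g /\ forall v, V v -> ip (fun x => w x - g x) v = 0].

End L2.

(** * Polyhedral domains and simplicial subdivisions *)

Section geometry.
Variables (R : realType) (n : nat).

Definition polyhedral_domain (Omega : set 'rV[R]_n) : Prop :=
  [/\ Omega !=set0, open Omega, connected Omega, bounded_set Omega &
    exists (M : nat) (a : 'I_M -> 'rV[R]_n) (b : 'I_M -> R),
      (forall i, a i != 0) /\
      closure Omega `\` Omega `<=`
        \bigcup_(i in [set: 'I_M]) [set x | \sum_j a i ord0 j * x ord0 j = b i]].

(* convex hull of the vertices v i, i \in F *)
Definition hull (m : nat) (v : 'I_m -> 'rV[R]_n) (F : {set 'I_m}) :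
    set 'rV[R]_n :=
  [set x | exists c : 'I_m -> R, [/\ forall i, 0 <= c i,
     forall i, i \notin F -> c i = 0, \sum_i c i = 1 & x = \sum_i c i *: v i]].

Definition affinely_independent (m : nat) (v : 'I_m -> 'rV[R]_n) : Prop :=
  forall c : 'I_m -> R,
    \sum_i c i = 0 -> \sum_i c i *: v i = 0 -> forall i, c i = 0.

Definition cell (v : 'I_n.+1 -> 'rV[R]_n) : set 'rV[R]_n := hull v [set: 'I_n.+1]%SET.

(* G lists the vertices of the closed simplices; two of them meet in a common
   (possibly empty) face *)
Definition simplicial_subdivision (Omega : set 'rV[R]_n) (N : nat)
    (G : 'I_N -> 'I_n.+1 -> 'rV[R]_n) : Prop :=
  [/\ forall T, affinely_independent (G T),
      closure Omega = \bigcup_(T in [set: 'I_N]) cell (G T),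
      forall T, (cell (G T))° `<=` Omega,
      forall S T, S != T -> (cell (G S))° `&` (cell (G T))° = set0 &
      forall S T, exists F F' : {set 'I_n.+1},
        cell (G S) `&` cell (G T) = hull (G S) F /\
        cell (G S) `&` cell (G T) = hull (G T) F'].

End geometry.

(** * Finite element spaces *)

Section spaces.
Variables (R : realType) (n : nat) (Omega : set 'rV[R]_n).
Variables (N : nat) (G : 'I_N -> 'I_n.+1 -> 'rV[R]_n).
Implicit Types (w f g mu eta tau zeta sigma theta vs : dform R n) (k : nat).

(* Piecewise forms are given by their polynomial on each open cell; their values
   on the interfaces, a null set, are irrelevant. *)
Definition piecewise k (V : set (dform R n)) : set (dform R n) :=
  [set w | L2form Omega k w /\ forall T, exists2 p, V p &
    forall x, (cell (G T))° x -> w x = p x].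

Definition P0h k := piecewise k (P0 (n := n) k).
Definition P1mh k := piecewise k (P1m (n := n) k).
Definition P1smh k := piecewise k (P1sm (n := n) k).

Definition dh w : dform R n := fun x =>
  if `[< exists T, (cell (G T))° x >] then ext_d w x else 0.

Definition Ph k w : dform R n := L2proj Omega (P0h k) w.

Definition Wstar0 k : set (dform R n) := P1smh k `&` Hstar0 Omega k.

Definition Wnc k : set (dform R n) := [set w | P1mh k w /\
  forall eta, Wstar0 k.+1 eta ->
    ip Omega w (codiff Omega k.+1 eta) - ip Omega (dh w) eta = 0].

(* the two spaces below are meant for 0 < k *)
Definition Hnc k : set (dform R n) :=
  [set w | [/\ Wnc k w, feq Omega (dh w) (fun=> 0) &
    forall tau, Wnc k.-1 tau -> ip Omega w (dh tau) = 0]].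

Definition Hs0 k : set (dform R n) :=
  [set mu | [/\ Wstar0 k mu, feq Omega (codiff Omega k mu) (fun=> 0) &
    forall eta, Wstar0 k.+1 eta -> ip Omega mu (codiff Omega k.+1 eta) = 0]].

Local Notation "<< u , v >>" := (ip Omega u v).
Local Notation delta := (codiff Omega).

Definition solves_c k f w zeta sigma theta : Prop :=
  [/\ P0h k w, Wstar0 k.+1 zeta, Wnc k.-1 sigma, Hnc k theta &
   forall mu eta tau vs,
     P0h k mu -> Wstar0 k.+1 eta -> Wnc k.-1 tau -> Hnc k vs ->
     [/\ << w, vs >> = 0,
         << Ph k.+1 zeta, Ph k.+1 eta >> - << w, delta k.+1 eta >> = 0,
         << Ph k.-1 sigma, Ph k.-1 tau >> - << w, dh tau >> = 0 &
         << theta, mu >> + << delta k.+1 zeta, mu >> + << dh sigma, mu >>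
           = << f, mu >> ]].

Definition solves_p k f w sigma theta : Prop :=
  [/\ Wnc k w, Wnc k.-1 sigma, Hnc k theta &
   forall mu tau vs, Wnc k mu -> Wnc k.-1 tau -> Hnc k vs ->
     [/\ << w, vs >> = 0,
         << Ph k.-1 sigma, Ph k.-1 tau >> - << w, dh tau >> = 0 &
         << theta, mu >> + << dh sigma, mu >> + << dh w, dh mu >>
           = << f, Ph k mu >> ]].

Definition solves_d k f w zeta theta : Prop :=
  [/\ Wstar0 k w, Wstar0 k.+1 zeta, Hs0 k theta &
   forall mu eta vs, Wstar0 k mu -> Wstar0 k.+1 eta -> Hs0 k vs ->
     [/\ << w, vs >> = 0,
         << Ph k.+1 zeta, Ph k.+1 eta >> - << w, delta k.+1 eta >> = 0 &
         << theta, mu >> + << delta k.+1 zeta, mu >> + << delta k w, delta k mu >>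
           = << f, Ph k mu >> ]].

End spaces.

(* Main.v *)
(* The codifferential maps the conforming space [Wstar0] into the piecewise
   constants, and a form of [Wstar0] with zero codifferential is itself
   piecewise constant. As [Wnc] is by definition the annihilator of [Wstar0]
   for a pairing between finite-dimensional spaces that is nondegenerate on the
   dual side, the double annihilator theorem identifies the kernel of the
   codifferential in [Wstar0] with the orthogonal complement of [dh Wnc] in the
   piecewise constants. This gives the complex property of [dh] on [Wnc], the
   equality of the two spaces of harmonic forms, and the strong form of the
   last equation of (c); the differences between the solutions then vanish by
   testing the equations with them. The weak codifferential is compared with
   the cellwise one by testing against bump functions built from exp(-1/t). *)
Require Import Defs.
From HB Require Import structures.
From mathcomp Require Import all_boot all_order all_algebra.
From mathcomp Require Import all_classical all_reals all_analysis.
From mathcomp Require Import measurable_realfun ring lra zify.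
Import Order.TTheory GRing.Theory Num.Theory.
Import numFieldNormedType.Exports.
Local Open Scope classical_set_scope.
Local Open Scope ring_scope.
Set Implicit Arguments.
Unset Strict Implicit.
Unset Printing Implicit Defensive.

(** * Lebesgue measure and integration by parts on row vectors *)

(** The obstacle is conformity: a piecewise constant [mu] need not belong to [Hstar0]. If [mu] is
    orthogonal to [dh Wnc], the functional w -> -<dh w, mu> on [P1mh] vanishes on [Wnc], so the
    double annihilator theorem provides a conforming [eta] with <w, delta eta> - <dh w, eta> = -<dh
    w, mu> for all w in [P1mh]. The difference [eta - mu] is not known to be conforming, but it is
    cellwise in [P1smh] with cellwise codifferential [delta eta], and nondegeneracy against the
    whole of [P1mh] forces [eta = mu] a.e. Two kinds of w are enough for that: piecewise constants,
    where [dh] vanishes, detect the codifferential, and Koszul images, where [dh] gives (k+1) times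
    the coefficient, detect the constant that is left. No dimension is counted. Forms are functions,
    and [codiff] and [Ph] are picked by [xget], hence linear only a.e. Before a codifferential or a
    harmonic form is used as a piecewise constant test form, it is therefore exchanged for an a.e.
    equal member of [P0h], and inner products follow by [ip_feq]. *)

Section lebesgue_rV_basics.
Variable R : realType.
Implicit Types n : nat.

Local Notation leb := (@lebesgue_rV R _).

Definition cube n (M : R) : set 'rV[R]_n := [set x | forall i, `|x ord0 i| <= M].

Lemma coord_le_norm n (x : 'rV[R]_n) i : `|x ord0 i| <= `|x|.
Proof. by rewrite [leRHS]mx_normrE; exact: (le_bigmax _ (fun j => `|x j.1 j.2|) (ord0, i)). Qed.

Lemma norm_leP n (x : 'rV[R]_n) (M : R) : 0 <= M ->
  `|x| <= M <-> forall i, `|x ord0 i| <= M.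
Proof.
move=> M0; split=> [xM i|xM]; first exact: le_trans (coord_le_norm _ _) xM.
by rewrite [leLHS]mx_normrE; apply/bigmax_leP; split=> // -[i j] _ /=; rewrite ord1.
Qed.

Lemma measurable_coord_preimage n (i : 'I_n) (B : set R) : measurable B ->
  measurable [set x : 'rV[R]_n | B (x ord0 i)].
Proof.
move=> mB; have := @measurable_rV_coord R n i measurableT _ mB.
by rewrite setTI.
Qed.

Lemma measurable_all_coord n (B : 'I_n -> set R) : (forall i, measurable (B i)) ->
  measurable [set x : 'rV[R]_n | forall i, B i (x ord0 i)].
Proof.
move=> mB.
rewrite (_ : [set x | _] = \bigcap_(i in [set: 'I_n]) [set x : 'rV[R]_n | B i (x ord0 i)]).
  apply: fin_bigcap_measurable; first exact: finite_finset.
  by move=> i _; exact: measurable_coord_preimage.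
by apply/seteqP; split=> [x h i _|x h i]; [exact: h|exact: h].
Qed.

(** Cubes with rational centre and radius [1/(k+1)] form a countable family. It serves twice: for
    the measurability of open sets, and to pass from a.e. statements on boxes to an open set. *)
Lemma open_rational_cube n (U : set 'rV[R]_n) x : open U -> U x ->
  exists (q : 'rV[rat]_n) (k : nat),
    (forall i, `|ratr (q ord0 i) - x ord0 i| < k.+1%:R^-1) /\
    (forall y : 'rV[R]_n, (forall i, `|ratr (q ord0 i) - y ord0 i| <= k.+1%:R^-1) -> U y).
Proof.
move=> oU Ux.
have /nbhs_ballP[e /= e0 xeU] : nbhs x U by exact: open_nbhs_nbhs.
have [k ke] : exists k : nat, 2 * k.+1%:R^-1 < e.
  have [k] := @ltr_add_invr R 0 (e / 2) (divr_gt0 e0 (ltr0Sn _ _)).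
  by rewrite add0r => h; exists k; rewrite mulrC -ltr_pdivlMr.
have qP i : {q : rat | `|ratr q - x ord0 i| < k.+1%:R^-1}.
  apply: cid; have xk : x ord0 i - k.+1%:R^-1 < x ord0 i + k.+1%:R^-1 by rewrite ltrD2l gt0_cp.
  have [q] := rat_in_itvoo xk.
  rewrite in_itv/= => /andP[q1 q2]; exists q.
  by rewrite distrC ltr_distlC q1 q2.
exists (\row_i sval (qP i)), k; split=> [i|y By].
  by rewrite mxE; exact: (svalP (qP i)).
apply: xeU; split=> // i j; rewrite ord1.
have := By j; have := svalP (qP j); rewrite /= mxE /ball/= => h1 h2.
apply: lt_trans ke; rewrite mulr2n mulrDl mul1r.
rewrite (_ : x ord0 j - y ord0 j = (x ord0 j - ratr (sval (qP j))) + (ratr (sval (qP j)) - y ord0 j)); last by rewrite addrA subrK.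
by apply: le_lt_trans (ler_normD _ _) _; rewrite ltr_leD// distrC.
Qed.

(** The sigma-algebra is generated by the coordinates, so an open set has to be exhibited as a
    countable union of boxes; the [if] empties the boxes that leave [U]. *)
Lemma open_measurable_rV n (U : set 'rV[R]_n) : open U -> measurable U.
Proof.
move=> oU.
pose B (p : 'rV[rat]_n * nat) : set 'rV[R]_n :=
  [set x | forall i, ball (ratr (p.1 ord0 i) : R) (p.2.+1%:R^-1) (x ord0 i)].
rewrite (_ : U = \bigcup_p (if `[< B p `<=` U >] then B p else set0)).
  apply: countable_bigcupT_measurable; first exact: countableP.
  move=> p; case: asboolP => // _.
  apply: (measurable_all_coord (B := fun i => ball (ratr (p.1 ord0 i) : R) (p.2.+1%:R^-1))) => i.
  exact: measurable_ball.
apply/seteqP; split=> [x Ux|x [p _]]; last by case: asboolP => // h; exact: h.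
have [q [k [xq qU]]] := open_rational_cube oU Ux.
exists (q, k) => //; case: asboolP => // -[] y By.
by apply: qU => i; exact: ltW (By i).
Qed.

Lemma continuous_measurable_rV n (f : 'rV[R]_n -> R) : continuous f ->
  measurable_fun [set: 'rV[R]_n] f.
Proof.
move=> cf; apply: (measurability _ (RGenOpens.measurableE R)) => //.
move=> _ [_ [a [b ->]] <-]; rewrite setTI; apply: open_measurable_rV.
by move/continuousP: cf; apply; exact: interval_open.
Qed.

Lemma cube_measurable n M : measurable (@cube n M).
Proof.
rewrite (_ : cube _ = [set x | forall i, `[-M, M]%classic (x ord0 i)]).
  exact: (measurable_all_coord (B := fun=> `[-M, M]%classic)).
by apply/seteqP; split=> x h i; have := h i; rewrite /= in_itv/= ler_norml.
Qed.

Lemma rV_consE0 n (p : 'rV[R]_n * R) : rV_cons p ord0 ord0 = p.2.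
Proof.
rewrite (_ : ord0 = lshift n (ord0 : 'I_1)); last exact: val_inj.
by rewrite (row_mxEl (const_mx p.2 : 'rV_1) p.1 ord0 _ : rV_cons p _ _ = _) mxE.
Qed.

Lemma rV_consES n (p : 'rV[R]_n * R) j : rV_cons p ord0 (lift ord0 j) = p.1 ord0 j.
Proof.
rewrite (_ : lift ord0 j = rshift 1 j); last exact: val_inj.
exact: (row_mxEr (const_mx p.2 : 'rV_1) p.1 ord0 j).
Qed.

Lemma all_ordS n (P : 'I_n.+1 -> Prop) :
  P ord0 -> (forall j, P (lift ord0 j)) -> forall i, P i.
Proof. by move=> P0 PS i; case: (unliftP ord0 i) => [j|] ->. Qed.

Lemma cube_cons n (M : R) :
  @rV_cons R n @^-1` cube M = cube M `*` `[-M, M]%classic.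
Proof.
apply/seteqP; split=> [[x t] /= h|[x t] /= [h1 h2]].
  split=> [i|]; first by have := h (lift ord0 i); rewrite rV_consES.
  by have := h ord0; rewrite rV_consE0 in_itv/= ler_norml.
by apply: all_ordS => [|j]; rewrite ?rV_consE0 ?rV_consES//; move: h2; rewrite in_itv/= ler_norml.
Qed.

Lemma lebesgue_rV_cube n (M : R) : (leb (@cube n M) < +oo)%E.
Proof.
elim: n => [|n IH] /=; first by rewrite diracE; case: (_ \in _); rewrite ltry.
rewrite /pushforward cube_cons product_measure1E//; last exact: cube_measurable.
have mfin : (lebesgue_measure (`[(-M)%R, M]%classic : set R) < +oo)%E.
  by rewrite lebesgue_measure_itv/=; case: ifP => _; rewrite ltry.
by rewrite lte_mul_pinfty// ge0_fin_numE.
Qed.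

Lemma lebesgue_rV_sigma_finite n : sigma_finite setT (@lebesgue_rV R n).
Proof.
exists (fun k => cube k%:R) => [|k]; last by split; [exact: cube_measurable|exact: lebesgue_rV_cube].
apply/esym/seteqP; split=> // x _.
exists (Num.truncn `|x|).+1 => // i.
by rewrite (le_trans (coord_le_norm _ _))// ltW// truncnS_gt.
Qed.

HB.instance Definition _ n := Measure_isSigmaFinite.Build _ _ _ (@lebesgue_rV R n)
  (lebesgue_rV_sigma_finite n).

End lebesgue_rV_basics.

(** * Fubini in one coordinate, integrals of partial derivatives, null hyperplanes *)

Section integration.
Variable R : realType.
Implicit Types n : nat.

Local Notation leb := (@lebesgue_rV R _).

Local Notation leb2 n := (@lebesgue_rV R n \x @lebesgue_measure R)%E.

Lemma integrable_bounded_support d (T : measurableType d)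
    (mu : {measure set T -> \bar R}) (A : set T) (f : T -> R) (C : R) :
  measurable A -> (mu A < +oo)%E -> measurable_fun setT f ->
  (forall x, ~ A x -> f x = 0) -> (forall x, `|f x| <= C) ->
  mu.-integrable setT (EFin \o f).
Proof.
move=> mA Afin mf f0 fC.
have fE : (EFin \o f) \_ A = EFin \o f.
  by apply/funext => x; rewrite patchE; case: ifPn => //; rewrite notin_setE => /f0/= ->.
rewrite -fE; apply/(integrable_mkcond _ mA); apply: measurable_bounded_integrable => //.
  exact: measurable_funS mf.
by exists C; split=> [|y Cy x Ax]; rewrite ?num_real//= (le_trans (fC x)) ?ltW.
Qed.

(** The measure in dimension n+1 is the image of a product measure; the bound and the support in a
    cube supply the integrability that Fubini asks for. *)
Lemma integral_rV_cons n (f : 'rV[R]_n.+1 -> R) (M C : R) :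
  measurable_fun setT f -> (forall x, ~ cube M x -> f x = 0) -> (forall x, `|f x| <= C) ->
  (leb2 n).-integrable setT (EFin \o (f \o @rV_cons R n)) /\
  (\int[leb]_x (f x)%:E = \int[leb2 n]_p (f (rV_cons p))%:E)%E.
Proof.
move=> mf f0 fC.
have imu : (leb2 n).-integrable setT (EFin \o (f \o @rV_cons R n)).
  have := (@integrable_bounded_support _ _ (leb2 n) (@rV_cons R n @^-1` cube M) (f \o @rV_cons R n) C). apply.
  - by rewrite -[X in measurable X]setTI; apply: measurable_rV_cons => //; exact: cube_measurable.
  - exact: (@lebesgue_rV_cube R n.+1 M).
  - by apply: measurableT_comp => //; exact: measurable_rV_cons.
  - by move=> p np; apply: f0.
  - by move=> p; exact: fC.
split=> //.
pose p : {measure set ('rV[R]_n * (g_sigma_algebraType R.-ocitv.-measurable))%type -> \bar R} := leb2 n.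
have := @integral_pushforward _ _ ('rV[R]_n * (g_sigma_algebraType R.-ocitv.-measurable))%type _ R (@rV_cons R n) (@measurable_rV_cons R n) p setT (EFin \o f).
rewrite preimage_setT => -> //; exact/measurable_EFinP.
Qed.

(** A directional derivative sees only the restriction to a line, so it can be carried between the
    whole space, a slice and R. *)
Lemma is_derive_line (V V' : normedModType R) (f : V -> R) (g : V' -> R) a v a' v' (l : R) :
  (forall h : R, g (h *: v' + a') = f (h *: v + a)) -> is_derive a v f l -> is_derive a' v' g l.
Proof.
move=> fg [df <-].
have E : (fun h : R => h^-1 *: ((g \o shift a') (h *: v') - g a')) =
         (fun h : R => h^-1 *: ((f \o shift a) (h *: v) - f a)).
  apply/funext => h /=; rewrite fg; congr (_ *: (_ - _)).
  by have := fg 0; rewrite !scale0r !add0r.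
by split; rewrite /derivable /derive E.
Qed.

Lemma basis_vecE n (i j : 'I_n) : basis_vec R i ord0 j = (j == i)%:R.
Proof. by rewrite mxE eqxx. Qed.

Lemma rVD n (x y : 'rV[R]_n) i : (x + y) ord0 i = x ord0 i + y ord0 i.
Proof. exact: mxE. Qed.

Lemma rVN n (x : 'rV[R]_n) i : (- x) ord0 i = - x ord0 i.
Proof. exact: mxE. Qed.

Lemma rVZ n (h : R) (x : 'rV[R]_n) i : (h *: x) ord0 i = h * x ord0 i.
Proof. exact: mxE. Qed.

Lemma integral_derive1_eq0 (u v : R -> R) (M : R) :
  (forall t : R, is_derive t (1:R) u (v t)) -> continuous v ->
  (forall t, M < `|t| -> u t = 0) -> (forall t, M < `|t| -> v t = 0) ->
  (\int[@lebesgue_measure R]_t (v t)%:E = 0)%E.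
Proof.
move=> du cv u0 v0.
(* [N] exceeds both [M] and 0: the interval is nondegenerate and [u] vanishes at both ends. *)
pose N := `|M| + 1.
have NM : M < N by rewrite /N (le_lt_trans (ler_norm M))// ltrDl.
have N0 : 0 < N by rewrite /N ltr_wpDl.
have NN : - N < N by rewrite (@lt_trans _ _ 0) ?oppr_lt0.
have -> : (\int[lebesgue_measure]_t (v t)%:E =
           \int[lebesgue_measure]_(t in `[(- N)%R, N]) (v t)%:E)%E.
  rewrite [RHS]integral_mkcond; apply: eq_integral => t _; rewrite patchE.
  case: ifPn => //; rewrite notin_setE /= in_itv/= -ler_norml => /negP.
  by rewrite -ltNge => Nt; rewrite v0// (lt_trans NM).
have cu : continuous u.
  move=> t; apply: differentiable_continuous.
  by apply/derivable1_diffP; case: (du t).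
rewrite (@continuous_FTC2 R v u) => //.
- by rewrite !u0 ?subee//= ?normrN gtr0_norm.
- by apply: continuous_subspaceT => t; exact: cv.
- split.
  + by move=> t _; case: (du t).
  + by apply: cvg_at_right_filter; exact: cu.
  + by apply: cvg_at_left_filter; exact: cu.
- by move=> t _; rewrite derive1E; case: (du t).
Qed.

Lemma rV_cons_continuous n (x : 'rV[R]_n) : continuous (fun t : R => rV_cons (x, t)).
Proof.
move=> t; apply/cvgrPdist_le => e e0; near=> s.
have ts : `|t - s| <= e by near: s; apply: cvgr_dist_le.
apply/norm_leP; rewrite ?ltW//; apply: all_ordS => [|k]; rewrite rVD rVN.
  by rewrite !rV_consE0.
by rewrite !rV_consES subrr normr0 ltW.
Unshelve. all: by end_near. Qed.

Lemma rV_cons_continuous_l n (t : R) : continuous (fun x : 'rV[R]_n => rV_cons (x, t)).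
Proof.
move=> x; apply/(@cvgrPdist_le _ _ _ _ (nbhs_filter x)) => e e0.
apply/nbhs_ballP; exists e => // y; rewrite mx_norm_ball => xy.
apply/norm_leP; rewrite ?ltW//; apply: all_ordS => [|k]; rewrite rVD rVN.
  by rewrite !rV_consE0 subrr normr0 ltW.
by rewrite !rV_consES/= (le_trans _ (ltW xy))// (le_trans _ (coord_le_norm _ k))// rVD rVN.
Qed.

(** Induction on the dimension by Fubini. For the head coordinate the inner integral is over R and
    vanishes by the fundamental theorem of calculus; for any other one the inner integral is over
    the tail, where the induction hypothesis applies to each slice. *)
Lemma integral_partial_eq0 n (i : 'I_n) (u v : 'rV[R]_n -> R) (M C : R) :
  (forall x, is_derive x (basis_vec R i) u (v x)) -> continuous v ->
  (forall x, ~ cube M x -> u x = 0) -> (forall x, ~ cube M x -> v x = 0) ->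
  (forall x, `|v x| <= C) ->
  (\int[leb]_x (v x)%:E = 0)%E.
Proof.
elim: n i u v => [[]//|n IH] i u v du cv u0 v0 vC.
have [iv ->] := integral_rV_cons (continuous_measurable_rV cv) v0 vC.
case: (unliftP ord0 i) => [j|] ij.
  rewrite -(integral21_prod_meas1 iv); apply: integral0_eq => t _.
  have cc x : ~ cube M x -> ~ cube M (rV_cons (x, t)).
    by move=> nx h; apply: nx => k; have := h (lift ord0 k); rewrite rV_consES.
  apply: (IH j (fun x => u (rV_cons (x, t)))) => //=.
  - move=> x; apply: is_derive_line (du (rV_cons (x, t))) => h.
    congr u; apply/rowP; apply: all_ordS => [|k].
      by rewrite rVD rVZ !rV_consE0 basis_vecE ij/= mulr0 add0r.
    by rewrite rVD rVZ !rV_consES/= rVD rVZ !basis_vecE ij (inj_eq lift_inj).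
  - by move=> x; apply: continuous_comp; [exact: rV_cons_continuous_l|exact: cv].
  - by move=> x /cc; exact: u0.
  - by move=> x /cc; exact: v0.
rewrite -(integral12_prod_meas1 iv); apply: integral0_eq => x _.
have cc (t : R) : M < `|t| -> ~ cube M (rV_cons (x, t)).
  by move=> Mt /(_ ord0); rewrite rV_consE0 leNgt Mt.
apply: (@integral_derive1_eq0 (fun t => u (rV_cons (x, t))) _ M) => //=.
- move=> t; apply: is_derive_line (du (rV_cons (x, t))) => h.
  congr u; apply/rowP; apply: all_ordS => [|k].
    by rewrite rVD rVZ !rV_consE0 basis_vecE ij eqxx.
  by rewrite rVD rVZ !rV_consES basis_vecE ij/= mulr0 add0r.
- by move=> t; apply: continuous_comp; [exact: rV_cons_continuous|exact: cv].
- by move=> t /cc; exact: u0.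
- by move=> t /cc; exact: v0.
Qed.

Lemma measurable_hyperplane n (a : 'I_n -> R) (b : R) :
  measurable [set x : 'rV[R]_n | \sum_i a i * x ord0 i = b].
Proof.
have mf : measurable_fun setT (fun x : 'rV[R]_n => \sum_i a i * x ord0 i).
  apply: measurable_sum => i; apply: measurable_funM => //.
  exact: measurable_rV_coord.
by have := mf measurableT _ (measurable_set1 b); rewrite setTI.
Qed.

(** Slices in the head coordinate are single points if its coefficient is nonzero. Otherwise they
    are empty or all of R, the latter only over a hyperplane one dimension lower, which is null by
    induction. *)
Lemma hyperplane_null n (a : 'I_n -> R) (b : R) : (exists i, a i != 0) ->
  leb [set x : 'rV[R]_n | \sum_i a i * x ord0 i = b] = 0%E.
Proof.
elim: n a => [a [[]//]|n IH] a [i ai] /=.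
rewrite /pushforward /product_measure1 /=.
set F := (X in (\int[_]_x X x)%E).
have FE y : F y = lebesgue_measure [set t : R | a ord0 * t = b - \sum_j a (lift ord0 j) * y ord0 j].
  rewrite /F; congr (lebesgue_measure _); apply/seteqP.
  have E t : \sum_i a i * rV_cons (y, t) ord0 i =
      a ord0 * t + \sum_j a (lift ord0 j) * y ord0 j.
    by rewrite big_ord_recl rV_consE0; congr (_ + _); apply: eq_bigr => j _; rewrite rV_consES.
  split=> t /=; rewrite /xsection/= ?inE/= E; first by move=> <-; rewrite addrK.
  by move=> ->; rewrite subrK.
have [a0|a0] := eqVneq (a ord0) 0; last first.
  apply: integral0_eq => y _; apply: (etrans (FE y)).
  rewrite (_ : [set t | _] = [set (b - \sum_j a (lift ord0 j) * y ord0 j) / a ord0]) ?lebesgue_measure_set1//.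
  apply/seteqP; split=> t /=; first by move=> <-; rewrite mulrC mulKf.
  by move=> ->; rewrite mulrC divfK.
pose N := [set y : 'rV[R]_n | \sum_j a (lift ord0 j) * y ord0 j = b].
have F0 y : ~ N y -> F y = 0%E.
  move=> Ny; rewrite FE (_ : [set t | _] = set0) ?measure0//.
  apply/seteqP; split=> t //=; rewrite a0 mul0r => h; apply: Ny.
  by apply/esym/eqP; rewrite -subr_eq0 -h.
have FN y : N y -> F y = lebesgue_measure [set: R].
  move=> Ny; rewrite FE; congr (lebesgue_measure _); apply/seteqP; split=> t //= _.
  by rewrite Ny a0 mul0r subrr.
transitivity (\int[leb]_(y in N) lebesgue_measure [set: R])%E.
  rewrite [RHS]integral_mkcond; apply: eq_integral => y _; rewrite patchE.
  by case: ifPn => [|]; [rewrite inE => /FN|rewrite notin_setE => /F0].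
apply: null_set_integral => //; first exact: measurable_hyperplane.
apply: IH; case: (unliftP ord0 i) ai => [j ->|->]; last by rewrite a0 eqxx.
by exists j.
Qed.

End integration.

(** * Rules for directional derivatives of scalar functions *)

Section pointwise_derivatives.
Variables (R : realType) (V : normedModType R).
Implicit Types (f g : V -> R) (x v : V).

Lemma is_derive_add f g x v a b : is_derive x v f a -> is_derive x v g b ->
  is_derive x v (fun y => f y + g y) (a + b).
Proof. exact: is_deriveD. Qed.

Lemma is_derive_mul f g x v a b : is_derive x v f a -> is_derive x v g b ->
  is_derive x v (fun y => f y * g y) (f x * b + g x * a).
Proof. exact: is_deriveM. Qed.

Lemma is_derive_scale (c : R) f x v a : is_derive x v f a ->
  is_derive x v (fun y => c * f y) (c * a).
Proof.
move=> fa; have := is_derive_mul (is_derive_cst c x v) fa.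
by rewrite mulr0 addr0.
Qed.

Lemma is_derive_bigsum I (r : seq I) (P : pred I) (f : I -> V -> R) x v (a : I -> R) :
  (forall i, P i -> is_derive x v (f i) (a i)) ->
  is_derive x v (fun y => \sum_(i <- r | P i) f i y) (\sum_(i <- r | P i) a i).
Proof.
move=> fa; elim: r => [|i r IH].
  rewrite big_nil; under eq_fun do rewrite big_nil; exact: is_derive_cst.
rewrite big_cons; under eq_fun do rewrite big_cons.
by case: ifPn => // Pi; apply: is_derive_add => //; exact: fa.
Qed.

End pointwise_derivatives.

(** * Bump functions and the fundamental lemma of the calculus of variations *)

Section Cm_theory.
Variables (R : realType) (n : nat).
Implicit Types (u v : 'rV[R]_n -> R) (m : nat).

Lemma Cm_intro m u (v : 'I_n -> 'rV[R]_n -> R) : continuous u ->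
  (forall i x, is_derive x (basis_vec R i) u (v i x)) ->
  (forall i, Cm m (v i)) -> Cm m.+1 u.
Proof.
move=> cu du Cv; split=> // i.
have -> : 'D_(basis_vec R i) u = v i by apply/funext => x; case: (du i x).
by split=> // x; case: (du i x).
Qed.

Lemma Cm_continuous m u : Cm m u -> continuous u.
Proof. by case: m => [|m] []. Qed.

Lemma Cm_deriv m u i : Cm m.+1 u -> Cm m ('D_(basis_vec R i) u).
Proof. by case=> _ /(_ i)[]. Qed.

Lemma Cm_is_derive m u i x : Cm m.+1 u ->
  is_derive x (basis_vec R i) u ('D_(basis_vec R i) u x).
Proof. by case=> _ /(_ i)[/(_ x)/derivableP]. Qed.

Lemma CmW m u : Cm m.+1 u -> Cm m u.
Proof.
elim: m u => [|m IH] u Cu; first by split=> //; exact: Cm_continuous Cu.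
apply: (Cm_intro (v := fun i => 'D_(basis_vec R i) u)).
- exact: Cm_continuous Cu.
- by move=> i x; exact: Cm_is_derive Cu.
- by move=> i; apply: IH; exact: Cm_deriv.
Qed.

Lemma Cm_cst m (c : R) : Cm m (fun _ : 'rV[R]_n => c).
Proof.
elim: m c => [|m IH] c; first by split=> //; exact: cst_continuous.
by apply: (Cm_intro (v := fun=> fun=> 0)) => //; exact: cst_continuous.
Qed.

Lemma CmD m u v : Cm m u -> Cm m v -> Cm m (fun x => u x + v x).
Proof.
elim: m u v => [|m IH] u v Cu Cv.
  by split=> // x; apply: continuousD; [exact: (Cm_continuous Cu)|exact: (Cm_continuous Cv)].
apply: (Cm_intro (v := fun i x => 'D_(basis_vec R i) u x + 'D_(basis_vec R i) v x)).
- by move=> x; apply: continuousD; [exact: (Cm_continuous Cu)|exact: (Cm_continuous Cv)].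
- by move=> i x; apply: is_derive_add; [exact: Cm_is_derive Cu|exact: Cm_is_derive Cv].
- by move=> i; apply: IH; exact: Cm_deriv.
Qed.

Lemma CmM m u v : Cm m u -> Cm m v -> Cm m (fun x => u x * v x).
Proof.
elim: m u v => [|m IH] u v Cu Cv.
  by split=> // x; apply: continuousM; [exact: (Cm_continuous Cu)|exact: (Cm_continuous Cv)].
apply: (Cm_intro (v := fun i x => u x * 'D_(basis_vec R i) v x + v x * 'D_(basis_vec R i) u x)).
- by move=> x; apply: continuousM; [exact: (Cm_continuous Cu)|exact: (Cm_continuous Cv)].
- by move=> i x; apply: is_derive_mul; [exact: Cm_is_derive Cu|exact: Cm_is_derive Cv].
- by move=> i; apply: CmD; apply: IH; (exact: Cm_deriv || exact: CmW).
Qed.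

Lemma CmZ m (c : R) u : Cm m u -> Cm m (fun x => c * u x).
Proof. by move=> Cu; apply: CmM => //; exact: Cm_cst. Qed.

Lemma Cm_sum m I (r : seq I) (P : pred I) (u : I -> 'rV[R]_n -> R) :
  (forall i, P i -> Cm m (u i)) -> Cm m (fun x => \sum_(i <- r | P i) u i x).
Proof.
move=> Cu; elim: r => [|i r IH].
  by under eq_fun do rewrite big_nil; exact: Cm_cst.
case Pi: (P i); under eq_fun do rewrite big_cons Pi; last exact: IH.
by apply: CmD => //; exact: Cu.
Qed.

Lemma Cm_prod m I (r : seq I) (u : I -> 'rV[R]_n -> R) :
  (forall i, Cm m (u i)) -> Cm m (fun x => \prod_(i <- r) u i x).
Proof.
move=> Cu; elim: r => [|i r IH].
  by under eq_fun do rewrite big_nil; exact: Cm_cst.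
by under eq_fun do rewrite big_cons; apply: CmM; [exact: Cu|].
Qed.

Lemma coord_rV_continuous (i : 'I_n) : continuous (fun x : 'rV[R]_n => x ord0 i).
Proof. exact: coord_continuous. Qed.

End Cm_theory.

(** * Smoothness of [p(1/t) exp(-1/t)] at the origin *)

Section flat_functions.
Variable R : realType.
Implicit Types (p : {poly R}) (t : R).

(** The polynomial factor closes the family under differentiation, so smoothness follows by
    induction without a formula for higher derivatives. *)
Definition flat p t : R := if 0 < t then p.[t^-1] * expR (- t^-1) else 0.

(* The derivative of [p(1/t) exp(-1/t)] is [((p - p')(1/t)) (1/t)^2 exp(-1/t)]. *)
Definition flat_next p : {poly R} := (p - p^`()) * 'X^2.

(** With s = 1/t >= 1 the polynomial is at most A s^d, while exp(s) >= s^(d+2)/(d+2)!. The two extra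
    powers leave t^2, which yields a zero derivative at 0. *)
Lemma flat_bound p : exists C, forall t, 0 < t <= 1 -> `|flat p t| <= C * t ^+ 2.
Proof.
pose A := \sum_(i < size p) `|p`_i|; pose d := size p.
exists (A * (d.+2)`!%:R) => t /andP[t0 t1]; rewrite /flat t0.
have s1 : 1 <= t^-1 by rewrite invf_ge1.
have s0 : 0 <= t^-1 by rewrite invr_ge0 ltW.
have A0 : 0 <= A by apply: sumr_ge0.
have pA : `|p.[t^-1]| <= A * t^-1 ^+ d.
  rewrite horner_coef mulr_suml (le_trans (ler_norm_sum _ _ _))//.
  apply: ler_sum => i _; rewrite normrM normrX (ger0_norm s0) ler_wpM2l//.
  by rewrite ler_weXn2l// ltnW.
have eD : t^-1 ^+ d.+2 <= (d.+2)`!%:R * expR t^-1.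
  have := @expR_ge1Dxn R t^-1 d.+1 s0; rewrite -lerBrDl => /le_trans h.
  rewrite -ler_pdivrMl ?ltr0n ?fact_gt0// mulrC; apply: h.
  by rewrite lerBlDr lerDl.
rewrite normrM (ger0_norm (expR_ge0 _)) expRN.
rewrite ler_pdivrMr ?expR_gt0// (le_trans pA)//.
have -> : A * (d.+2)`!%:R * t ^+ 2 * expR t^-1 = A * (t ^+ 2 * ((d.+2)`!%:R * expR t^-1)) by ring.
rewrite ler_wpM2l// -ler_pdivrMl ?exprn_gt0//; apply: le_trans eD.
by rewrite -exprVn -exprD addnC addn2.
Qed.

Lemma flat_is_derive p t : is_derive t (1 : R) (flat p) (flat (flat_next p) t).
Proof.
have [t0|t0|->] := ltrgt0P t.
- have E : is_derive t (1:R) (fun s => p.[s^-1] * expR (- s^-1)) (flat (flat_next p) t).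
    rewrite /flat t0 /flat_next.
    have dV : is_derive t (1:R) (fun s : R => s^-1) (- t ^- 2).
      have := @is_deriveV R id t 1 1 (lt0r_neq0 t0) (is_derive_id t 1).
      by rewrite /GRing.scale/= mulr1.
    have dp : is_derive t (1:R) (fun s => p.[s^-1]) (p^`().[t^-1] * - t ^- 2).
      exact: (@is_derive1_comp R (horner p) (fun s => s^-1)).
    have de : is_derive t (1:R) (fun s => expR (- s^-1)) (expR (- t^-1) * (t ^- 2)).
      apply: (@is_derive1_comp R expR (fun s => - s^-1)).
      have := @is_deriveN R _ _ (fun s : R => s^-1) t 1 _ dV.
      by rewrite opprK.
    have := is_derive_mul dp de.
    rewrite hornerM hornerXn hornerD hornerN exprVn => /is_derive_eq; apply.
    ring.
  apply: near_eq_is_derive E; near=> s; rewrite /flat ifT//.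
  by near: s; exact: lt_nbhsr.
- have -> : flat (flat_next p) t = 0 by rewrite /flat ltNge ltW.
  apply: near_eq_is_derive (is_derive_cst 0 t 1); near=> s; rewrite /flat ifF//.
  apply/negbTE; rewrite -leNgt ltW//.
  by near: s; exact: lt_nbhsl.
have -> : flat (flat_next p) 0 = 0 by rewrite /flat ltxx.
have [C hC] := flat_bound p.
have C0 : 0 <= C.
  have : 0 < (1:R) <= 1 by rewrite ltr01 lexx.
  by move=> /hC; rewrite expr1n mulr1; apply: le_trans.
have lim : h^-1 *: ((flat p \o shift 0) (h *: (1:R)) - flat p 0) @[h --> 0^'] --> (0 : R).
  apply/cvgrPdist_le => e e0; near=> h.
  rewrite sub0r normrN /= addr0 {2}/flat ltxx subr0 [_ *: 1]mulr1.
  have h0 : h != 0 by near: h; exact: nbhs_dnbhs_neq.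
  have [hp|hn] := ltP 0 h; last by rewrite /flat ltNge hn/= scaler0 normr0 ltW.
  have h1 : h <= 1.
    rewrite (le_trans (ler_norm _))//; near: h; apply: dnbhs0_le; exact: ltr01.
  have hh : 0 < h <= 1 by rewrite hp.
  rewrite normrZ normrV ?unitfE// (gtr0_norm hp) mulrC ler_pdivrMr//.
  apply: (le_trans (hC _ hh)); rewrite expr2 mulrA ler_wpM2r ?(ltW hp)//.
  (* Dividing by [C + 1] covers the case [C = 0]. *)
  have : `|h| <= e / (C + 1) by near: h; apply: dnbhs0_le; rewrite divr_gt0// ltr_wpDl.
  rewrite (gtr0_norm hp) ler_pdivlMr ?ltr_wpDl// => hlt.
  by apply: le_trans hlt; rewrite mulrDr mulr1 mulrC lerDl (ltW hp).
split; first by apply/cvg_ex; exists 0.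
by apply/cvg_lim.
Unshelve. all: by end_near. Qed.

End flat_functions.

(** * Bump functions on boxes and a generating family of orthants *)

Section bumps.
Variables (R : realType) (n : nat).
Implicit Types (p : {poly R}) (t c d : R).

Lemma continuous_add (T : topologicalType) (u v : T -> R) :
  continuous u -> continuous v -> continuous (fun x => u x + v x).
Proof. by move=> cu cv x; apply: continuousD; [exact: cu|exact: cv]. Qed.

Lemma continuous_mul (T : topologicalType) (u v : T -> R) :
  continuous u -> continuous v -> continuous (fun x => u x * v x).
Proof. by move=> cu cv x; apply: continuousM; [exact: cu|exact: cv]. Qed.

Lemma flat_continuous p : continuous (flat p).
Proof.
move=> t; apply: differentiable_continuous.
by apply/derivable1_diffP; case: (flat_is_derive p t).
Qed.

Lemma flat_comp_is_derive p c d (i j : 'I_n) (x : 'rV[R]_n) :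
  is_derive x (basis_vec R j) (fun y : 'rV[R]_n => flat p (c * y ord0 i + d))
    (c * (i == j)%:R * flat (flat_next p) (c * x ord0 i + d)).
Proof.
pose g (h : R) : R := h * (c * (i == j)%:R) + (c * x ord0 i + d).
have dg : is_derive (0:R) (1:R) g (c * (i == j)%:R).
  have := is_derive_add (is_derive_mul (is_derive_id (0:R) (1:R))
     (is_derive_cst (c * (i == j)%:R) (0:R) (1:R))) (is_derive_cst (c * x ord0 i + d) (0:R) (1:R)).
  by move/is_derive_eq; apply; rewrite mul0r add0r addr0 mulr1.
have g0 : g 0 = c * x ord0 i + d by rewrite /g mul0r add0r.
have := @is_derive1_comp R (flat p) g 0 _ _ (flat_is_derive p (g 0)) dg.
rewrite g0 mulrC; apply: is_derive_line => h /=.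
rewrite addr0 /GRing.scale/= mulr1 /g rVD rVZ basis_vecE; congr (flat p _); ring.
Qed.

Lemma Cm_flat m k p c d (i : 'I_n) :
  Cm m (fun x : 'rV[R]_n => k * flat p (c * x ord0 i + d)).
Proof.
have cu k' p' : continuous (fun x : 'rV[R]_n => k' * flat p' (c * x ord0 i + d)).
  have cc e : continuous (fun _ : 'rV[R]_n => e : R) by exact: cst_continuous.
  have ca : continuous (fun x : 'rV[R]_n => c * x ord0 i + d).
    exact: continuous_add (continuous_mul (cc c) (@coord_rV_continuous R n i)) (cc d).
  apply: continuous_mul (cc k') _ => x.
  exact: continuous_comp (ca x) (@flat_continuous p' _).
elim: m k p => [|m IH] k p; first by split.
apply: (Cm_intro (v := fun j (x : 'rV[R]_n) => (k * (c * (i == j)%:R)) * flat (flat_next p) (c * x ord0 i + d))) => //.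
by move=> j x; rewrite -mulrA; apply: is_derive_scale; exact: flat_comp_is_derive.
Qed.

Definition test_fun (U : set 'rV[R]_n) (phi : 'rV[R]_n -> R) : Prop :=
  (forall m, Cm m phi) /\
  exists K, [/\ compact K, K `<=` U & forall x, ~ K x -> phi x = 0].

Definition obox (a b : 'I_n -> R) : set 'rV[R]_n :=
  [set x | forall i, a i < x ord0 i < b i].
Definition cbox (a b : 'I_n -> R) : set 'rV[R]_n :=
  [set x | forall i, a i <= x ord0 i <= b i].

(** With the argument scaled by k+1, each factor exp(-1/((k+1)s)) tends to 1 for s > 0 and stays 0
    for s <= 0: the bumps converge to the indicator of the open box and all vanish outside it. *)
Definition bump (a b : 'I_n -> R) (k : nat) (x : 'rV[R]_n) : R :=
  \prod_(i < n) (flat 1 (k.+1%:R * (x ord0 i - a i)) * flat 1 (k.+1%:R * (b i - x ord0 i))).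

Lemma flat1_itv t : 0 <= flat 1 t <= 1.
Proof.
rewrite /flat; case: ifPn => t0; last by rewrite lexx ler01.
by rewrite hornerC mul1r expR_ge0/= -expR0 ler_expR oppr_le0 invr_ge0 ltW.
Qed.

Lemma bump_itv a b k x : 0 <= bump a b k x <= 1.
Proof.
have F i : 0 <= flat 1 (k.+1%:R * (x ord0 i - a i)) * flat 1 (k.+1%:R * (b i - x ord0 i)) <= 1.
  have /andP[p0 p1] := flat1_itv (k.+1%:R * (x ord0 i - a i)).
  have /andP[q0 q1] := flat1_itv (k.+1%:R * (b i - x ord0 i)).
  by rewrite mulr_ge0//= mulr_ile1.
rewrite /bump; elim: (index_enum _) => [|i r /andP[IH0 IH1]]; first by rewrite big_nil ler01 lexx.
have /andP[F0 F1] := F i.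
by rewrite big_cons mulr_ge0//= mulr_ile1.
Qed.

Lemma bump_out a b k x : ~ obox a b x -> bump a b k x = 0.
Proof.
move=> /existsNP[i]/negP; rewrite negb_and => h.
rewrite /bump (bigD1 i)//=; case/orP: h => h.
  by rewrite /flat ifF ?mul0r// pmulr_rgt0// subr_gt0; exact/negbTE.
by rewrite /flat [in X in _ * X * _]ifF ?mulr0 ?mul0r// pmulr_rgt0// subr_gt0; exact/negbTE.
Qed.

Lemma flat1_cvg t : 0 < t -> flat 1 (k.+1%:R * t) @[k --> \oo] --> (1 : R).
Proof.
move=> t0.
have -> : (fun k : nat => flat 1 (k.+1%:R * t)) = (fun k : nat => expR (- (t^-1 * k.+1%:R^-1))).
  by apply/funext => k; rewrite /flat pmulr_rgt0// t0 hornerC mul1r invfM mulrC.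
have h : - (t^-1 * k.+1%:R^-1) @[k --> \oo] --> (0 : R).
  rewrite -[X in _ --> X]oppr0; apply: cvgN; rewrite -[X in _ --> X](mulr0 t^-1).
  exact: (cvgM (cvg_cst t^-1) (@cvg_harmonic R)).
by rewrite -[X in _ --> X]expR0; apply: continuous_cvg h; exact: continuous_expR.
Qed.

Lemma cvg_prod1 I (r : seq I) (f : I -> nat -> R) :
  (forall i, f i k @[k --> \oo] --> (1 : R)) ->
  \prod_(i <- r) f i k @[k --> \oo] --> (1 : R).
Proof.
move=> f1; elim: r => [|i r IH].
  by under eq_fun do rewrite big_nil; exact: cvg_cst.
under eq_fun do rewrite big_cons.
by have := cvgM (f1 i) IH; rewrite mulr1; apply.
Qed.

Lemma bump_cvg a b x : obox a b x -> bump a b k x @[k --> \oo] --> (1 : R).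
Proof.
move=> xab; apply: cvg_prod1 => i; have /andP[ax xb] := xab i.
have ax0 : 0 < x ord0 i - a i by rewrite subr_gt0.
have xb0 : 0 < b i - x ord0 i by rewrite subr_gt0.
by have := cvgM (flat1_cvg ax0) (flat1_cvg xb0); rewrite mulr1; apply.
Qed.

Lemma Cm_bump m a b k : Cm m (bump a b k).
Proof.
apply: Cm_prod => i; apply: CmM.
  have := Cm_flat m 1 1 k.+1%:R (- (k.+1%:R * a i)) i.
  by under eq_fun do rewrite mul1r -mulrBr.
have := Cm_flat m 1 1 (- k.+1%:R) (k.+1%:R * b i) i.
by under eq_fun do rewrite mul1r mulNr addrC -mulrBr.
Qed.

Lemma cbox_compact a b : compact (cbox a b).
Proof.
have := @rV_compact R n (fun i => `[a i, b i]%classic) (fun i => @segment_compact R (a i) (b i)).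
by rewrite (_ : [set v | _] = cbox a b).
Qed.

Lemma obox_cbox a b : obox a b `<=` cbox a b.
Proof. by move=> x h i; have /andP[/ltW -> /ltW ->] := h i. Qed.

Lemma bump_test_fun U a b k : cbox a b `<=` U -> test_fun U (bump a b k).
Proof.
move=> abU; split=> [m|]; first exact: Cm_bump.
exists (cbox a b); split=> //; first exact: cbox_compact.
by move=> x nx; apply: bump_out => /obox_cbox.
Qed.

Lemma measurable_obox a b : measurable (obox a b).
Proof.
rewrite (_ : obox a b = [set x | forall i, `]a i, b i[%classic (x ord0 i)]); last first.
  by apply/seteqP; split=> x h i; have := h i; rewrite /= in_itv.
exact: (measurable_all_coord (B := fun i => `]a i, b i[%classic)).
Qed.

(** Upper orthants are stable under intersection, generate the sigma-algebra, and cut an open box in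
    an open box; these are the ingredients of the Dynkin argument below. *)
Definition rect (a : 'I_n -> R) : set 'rV[R]_n := [set x | forall i, a i < x ord0 i].

Lemma measurable_rect a : measurable (rect a).
Proof.
rewrite (_ : rect a = [set x | forall i, `]a i, +oo[%classic (x ord0 i)]); last first.
  by apply/seteqP; split=> x h i; have := h i; rewrite /= in_itv/= andbT.
exact: (measurable_all_coord (B := fun i => `]a i, +oo[%classic)).
Qed.

Lemma measurable_rV_rect :
  @measurable rV_display ('rV[R]_n) = <<s [set A | exists a, A = rect a] >>.
Proof.
apply/seteqP; split; last first.
  apply: smallest_sub; first exact: sigma_algebra_measurable.
  by move=> _ [a ->]; exact: measurable_rect.
pose S := <<s [set A | exists a, A = rect a] >>.
have [S0 SC SU] : sigma_algebra setT S by exact: smallest_sigma_algebra.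
apply: smallest_sub; first exact: smallest_sigma_algebra.
move=> A; rewrite -bigcup_seq => -[i _] [B mB <-] /=; rewrite setTI {A}.
have {}mB : (R.-ocitv.-measurable).-sigma.-measurable B by exact: mB.
move: B mB; rewrite RGenOInfty.measurableE.
apply: smallest_sub.
  split=> [|A mA|F mF].
  - by rewrite /= preimage_set0.
  - by rewrite /= setTD -preimage_setC -setTD; exact: SC.
  - by rewrite /= preimage_bigcup; exact: SU.
move=> _ [t ->] /=.
(* The half-space [t < x_i] is exhausted by orthants whose other corner coordinates are -k. *)
rewrite (_ : _ @^-1` _ = \bigcup_k rect (fun j => if j == i then t else - k%:R)).
  by apply: SU => k; apply: sub_sigma_algebra; eexists; reflexivity.
apply/seteqP; split=> x /=.
  rewrite in_itv/= andbT => tx; exists (Num.truncn `|x|).+1 => // j.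
  case: eqVneq => [->//|_]; rewrite ltrNl (le_lt_trans _ (truncnS_gt _))//.
  by rewrite (le_trans _ (coord_le_norm x j))// -normrN ler_norm.
by move=> [k _ /(_ i)]; rewrite eqxx in_itv/= andbT.
Qed.

Lemma rect_setI_closed : setI_closed [set A | exists a, A = rect a].
Proof.
move=> _ _ [a ->] [b ->]; exists (fun i => Num.max (a i) (b i)).
apply/seteqP; split=> [x [ha hb] i|x h]; first by rewrite gt_max ha hb.
by split=> i; have := h i; rewrite gt_max => /andP[].
Qed.

Lemma rect_obox a b (c : ('I_n -> R)) : rect c `&` obox a b = obox (fun i => Num.max (a i) (c i)) b.
Proof.
apply/seteqP; split=> [x [hc h] i|x h].
  by have /andP[h1 h2] := h i; rewrite gt_max h1 h2 hc.
by split=> i; have := h i; rewrite gt_max => /andP[/andP[h1 h2] h3]; rewrite ?h1.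
Qed.

End bumps.

(** * Integrable functions orthogonal to all test functions *)

Section fundamental_lemma.
Variables (R : realType) (n : nat).
Local Notation leb := (@lebesgue_rV R n).
Local Open Scope ereal_scope.

Variables (D U : set 'rV[R]_n) (u : 'rV[R]_n -> R).
Hypotheses (mD : measurable D) (UD : U `<=` D).
Hypothesis iu : leb.-integrable D (EFin \o u).
Hypothesis u_test : forall phi, test_fun U phi -> (\int[leb]_(x in D) (phi x * u x) = 0)%R.

Let measurable_u : measurable_fun D u.
Proof. by apply/measurable_EFinP; exact: measurable_int iu. Qed.

(** Dominated convergence: the bumps tend to the indicator of the box and their products with [u]
    are bounded by |u|. *)
Let integral_obox a b : cbox a b `<=` U -> \int[leb]_(x in obox a b) (u x)%:E = 0.
Proof.
move=> abU.
have QD : obox a b `<=` D by move=> x /obox_cbox/abU/UD.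
have mbump k : measurable_fun D (bump a b k).
  apply: measurable_funTS; apply: continuous_measurable_rV.
  exact: Cm_continuous (Cm_bump 0 a b k).
have ib k : leb.-integrable D (fun x => (bump a b k x * u x)%:E).
  apply: le_integrable iu => //.
    by apply/measurable_EFinP; apply: measurable_funM.
  move=> x Dx; rewrite /= lee_fin normrM ler_piMl//.
  by have /andP[h0 h1] := bump_itv a b k x; rewrite ger0_norm.
have mf : measurable_fun D ((EFin \o u) \_ (obox a b)).
  by apply/(measurable_restrict _ (measurable_obox a b) mD); apply: measurable_funS (measurable_int _ iu) => // x [].
have cf : {ae leb, forall x, D x ->
    (bump a b k x * u x)%:E @[k --> \oo] --> ((EFin \o u) \_ (obox a b)) x}.
  apply: aeW => x _; rewrite patchE; case: ifPn => [|]; rewrite ?inE ?notin_setE => xQ /=.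
    apply: cvg_EFin; first by apply: nearW.
    rewrite -[X in _ --> X]mul1r; apply: cvgM; [exact: bump_cvg|exact: cvg_cst].
  by under eq_fun do rewrite bump_out// mul0r; exact: cvg_cst.
have ig : leb.-integrable D (fun x => `|(u x)%:E|) by exact: integrable_abse iu.
have bg : {ae leb, forall x, forall k : nat, D x -> `|(bump a b k x * u x)%:E| <= `|(u x)%:E|}.
  apply: aeW => x k Dx; rewrite /= lee_fin normrM ler_piMl//.
  by have /andP[h0 h1] := bump_itv a b k x; rewrite ger0_norm.
have [_ _] := dominated_convergence mD (fun k => measurable_int _ (ib k)) mf cf ig bg.
have -> : \int[leb]_(x in D) ((EFin \o u) \_ (obox a b)) x = \int[leb]_(x in obox a b) (u x)%:E.
  by rewrite -integral_mkcondr; congr (integral _ _ _); apply/setIidPr.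
have -> : (fun k => \int[leb]_(x in D) (bump a b k x * u x)%:E) = fun=> 0.
  apply/funext => k; rewrite -(fineK (integrable_fin_num mD (ib k))).
  by congr EFin; apply: u_test; exact: bump_test_fun.
by move/cvg_lim => <- //; apply: lim_cst.
Qed.

(** Dynkin's theorem extends the vanishing from boxes to the traces of all measurable sets, and a
    function whose integrals over all these vanish is zero a.e. *)
Let ae_eq0_obox a b : cbox a b `<=` U -> {ae leb, forall x, obox a b x -> u x = 0%R}.
Proof.
move=> abU; set Q := obox a b.
have QD : Q `<=` D by move=> x /obox_cbox/abU/UD.
have mQ : measurable Q by exact: measurable_obox.
have iuE E : measurable E -> leb.-integrable (E `&` Q) (EFin \o u).
  move=> mE; apply: integrableS iu => //; first exact: measurableI.
  by move=> x [_ /QD].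
have all0 : forall E, measurable E -> \int[leb]_(x in E `&` Q) (u x)%:E = 0.
  move=> E; rewrite measurable_rV_rect.
  apply: (@dynkin_induction _ _ _ (fun E => \int[leb]_(x in E `&` Q) (u x)%:E = 0) (measurable_rV_rect R n) (@rect_setI_closed R n)).
  - by rewrite setTI; exact: integral_obox.
  - move=> _ [c ->] /=; rewrite rect_obox; apply: integral_obox => x h; apply: abU => i.
    by have := h i; rewrite ge_max => /andP[/andP[-> _] ->].
  - move=> S mS S0 /=.
    have := @integral_setU _ _ _ leb (S `&` Q) (~` S `&` Q) (EFin \o u).
    rewrite -setIUl setUv setTI S0 add0e integral_obox// => <- //.
    + exact: measurableI.
    + by apply: measurableI => //; exact: measurableC.
    + by apply: measurable_funS (measurable_int _ iu) => // x [].
    + by rewrite disj_set2E; apply/eqP; rewrite setIACA setICr set0I.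
  - move=> F mF tF F0 /=; rewrite setI_bigcupl integral_bigcup.
    + by apply: eseries0 => k _ _; exact: F0.
    + by apply: trivIset_setIr.
    + by move=> k; exact: measurableI.
    + by rewrite -setI_bigcupl; apply: iuE; exact: bigcup_measurable.
have : ae_eq leb Q (EFin \o u) (cst 0).
  apply: integral_ae_eq => //.
    by rewrite -(setTI Q); exact: iuE.
  by move=> E EQ mE; rewrite integral0 -(all0 E mE); congr (integral _ _ _); apply/esym/setIidPl.
by apply: filterS => x /[apply] -[].
Qed.

(** [D] carries the integrals and [U] the test functions: with [D] the domain and [U] one open cell
    the result becomes local. The exceptional set is a countable union over rational boxes,
    enumerated through [unpickle]. *)
Lemma test_fun_ae_eq0 : open U -> {ae leb, forall x, U x -> u x = 0%R}.
Proof.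
move=> oU.
pose lo (q : 'rV[rat]_n) (k : nat) i : R := (ratr (q ord0 i) - k.+1%:R^-1)%R.
pose hi (q : 'rV[rat]_n) (k : nat) i : R := (ratr (q ord0 i) + k.+1%:R^-1)%R.
pose N m : set 'rV[R]_n := if unpickle m is Some (q, k) then
  (if `[< cbox (lo q k) (hi q k) `<=` U >] then [set x | ~ (obox (lo q k) (hi q k) x -> u x = 0%R)] else set0)
  else set0.
have N0 : leb.-negligible (\bigcup_m N m).
  apply: negligible_bigcup => m; rewrite /N; case: unpickle => [[q k]|]; last exact: negligible_set0.
  by case: asboolP => [/ae_eq0_obox//|_]; exact: negligible_set0.
apply: negligibleS N0 => x /= /not_implyP[Ux ux].
have [q [k [xq qU]]] := open_rational_cube oU Ux.
exists (pickle (q, k)) => //; rewrite /N pickleK; case: asboolP => [_ /=|]; last first.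
  case=> y yq; apply: qU => i; have := yq i; rewrite /lo /hi ler_distl => /andP[h1 h2].
  by rewrite lerBlDr h2 -lerBlDr h1.
move=> h; apply: ux; apply: h => i; have := xq i; rewrite /lo /hi ltr_distl => /andP[h1 h2].
by rewrite ltrBlDr h2 -ltrBlDr h1.
Qed.

End fundamental_lemma.

(** * Square integrable forms *)

Section L2_theory.
Variables (R : realType) (n : nat) (Omega : set 'rV[R]_n).
Hypotheses (mO : measurable Omega) (fO : (@lebesgue_rV R n Omega < +oo)%E).
Local Notation leb := (@lebesgue_rV R n).
Implicit Types (w g h : dform R n) (k : nat) (c : R).

Definition L2 w := forall A, measurable_fun Omega (fun x => w x A) /\
  leb.-integrable Omega (fun x => ((w x A) ^+ 2)%:E).

Lemma L2form_L2 k w : L2form Omega k w -> L2 w.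
Proof. by case. Qed.

Lemma ffunD (f f' : {ffun {set 'I_n} -> R}) A : (f + f') A = f A + f' A.
Proof. exact: ffunE. Qed.

Lemma ffunN (f : {ffun {set 'I_n} -> R}) A : (- f) A = - f A.
Proof. exact: ffunE. Qed.

Lemma ffunZ c (f : {ffun {set 'I_n} -> R}) A : (c *: f) A = c * f A.
Proof. exact: ffunE. Qed.

Lemma ffun0E A : (0 : {ffun {set 'I_n} -> R}) A = 0.
Proof. exact: ffunE. Qed.

(** From |ab| <= a^2 + b^2. *)
Lemma L2_mul_integrable w g A : L2 w -> L2 g ->
  leb.-integrable Omega (EFin \o (fun x => w x A * g x A)).
Proof.
move=> /(_ A)[mw iw] /(_ A)[mg ig].
have := integrableD mO iw ig; apply: le_integrable => //.
  by apply/measurable_EFinP; exact: measurable_funM.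
move=> x _ /=; rewrite lee_fin [leRHS]ger0_norm ?addr_ge0 ?sqr_ge0//.
rewrite -(real_normK (num_real (w x A))) -(real_normK (num_real (g x A))) normrM.
have := sqr_ge0 (`|w x A| - `|g x A|); have := normr_ge0 (w x A); have := normr_ge0 (g x A).
move: (`|w x A|) (`|g x A|) => a b; nra.
Qed.

Lemma L2D w g : L2 w -> L2 g -> L2 (fun x => w x + g x).
Proof.
move=> Lw Lg A; have [mw iw] := Lw A; have [mg ig] := Lg A.
have iwg := L2_mul_integrable A Lw Lg.
have E : (fun x => (w x + g x) A) = (fun x => w x A + g x A) by apply/funext => x; rewrite ffunD.
split; first by rewrite E; exact: measurable_funD.
have := integrableD mO (integrableD mO iw iwg) (integrableD mO iwg ig).
apply: eq_integrable => // x _ /=; rewrite ffunD -!EFinD; congr EFin; ring.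
Qed.

Lemma L2Z c w : L2 w -> L2 (fun x => c *: w x).
Proof.
move=> Lw A; have [mw iw] := Lw A.
under [X in measurable_fun _ X]eq_fun do rewrite ffunZ.
under [X in integrable _ _ X]eq_fun do rewrite ffunZ exprMn EFinM.
split; first by apply: measurable_funM => //; exact: measurable_cst.
exact: integrableZl.
Qed.

Lemma L2N w : L2 w -> L2 (fun x => - w x).
Proof.
move=> Lw; have := L2Z (-1) Lw; congr L2; apply/funext => x.
by rewrite scaleN1r.
Qed.

Lemma L2B w g : L2 w -> L2 g -> L2 (fun x => w x - g x).
Proof. by move=> Lw /L2N; exact: L2D. Qed.

Lemma L2_0 : L2 (fun=> 0).
Proof.
move=> A; under [X in measurable_fun _ X]eq_fun do rewrite ffun0E.
under [X in integrable _ _ X]eq_fun do rewrite ffun0E expr0n.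
by split; [exact: measurable_cst|exact: integrable0].
Qed.

Lemma L2_bounded w (M : R) : (forall A, measurable_fun Omega (fun x => w x A)) ->
  (forall x A, Omega x -> `|w x A| <= M) -> L2 w.
Proof.
move=> mw wM A; split=> //.
apply: measurable_bounded_integrable => //; first exact: measurable_funX.
exists (M ^+ 2); split=> [|y My x Ox]; rewrite ?num_real//= (le_trans _ (ltW My))//.
by rewrite normrX lerXn2r// ?nnegrE// ?wM// (le_trans (normr_ge0 _) (wM _ A Ox)).
Qed.

(** On a domain of finite measure the constant 1 is square integrable and can serve as second
    factor. *)
Lemma L2_integrable w A : L2 w -> leb.-integrable Omega (EFin \o (fun x => w x A)).
Proof.
move=> Lw; have L1 : L2 (fun=> [ffun=> 1]).
  apply: (@L2_bounded _ 1) => [B|x B _]; last by rewrite ffunE normr1.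
  by under eq_fun do rewrite ffunE; exact: measurable_cst.
have := L2_mul_integrable A Lw L1.
by under [X in integrable _ _ (EFin \o X)]eq_fun do rewrite ffunE mulr1.
Qed.

Lemma homogD k w g : homog k w -> homog k g -> homog k (fun x => w x + g x).
Proof. by move=> hw hg x A kA; rewrite ffunD hw// hg// addr0. Qed.

Lemma homogZ k c w : homog k w -> homog k (fun x => c *: w x).
Proof. by move=> hw x A kA; rewrite ffunZ hw// mulr0. Qed.

Lemma homogB k w g : homog k w -> homog k g -> homog k (fun x => w x - g x).
Proof. by move=> hw hg x A kA; rewrite ffunD ffunN hw// hg// subr0. Qed.

Lemma L2formD k w g : L2form Omega k w -> L2form Omega k g -> L2form Omega k (fun x => w x + g x).
Proof. by move=> [hw Lw] [hg Lg]; split; [exact: homogD|exact: L2D]. Qed.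

Lemma L2formZ k c w : L2form Omega k w -> L2form Omega k (fun x => c *: w x).
Proof. by move=> [hw Lw]; split; [exact: homogZ|exact: L2Z]. Qed.

Lemma L2formB k w g : L2form Omega k w -> L2form Omega k g -> L2form Omega k (fun x => w x - g x).
Proof. by move=> [hw Lw] [hg Lg]; split; [exact: homogB|exact: L2B]. Qed.

Lemma L2form0 k : L2form Omega k (fun=> 0).
Proof. by split; [move=> x A _; rewrite ffun0E|exact: L2_0]. Qed.

Lemma feq_refl w : feq Omega w w.
Proof. by apply: aeW. Qed.

Lemma feq_sym w g : feq Omega w g -> feq Omega g w.
Proof. by apply: filterS => x h Ox; rewrite h. Qed.

Lemma feq_trans w g h : feq Omega w g -> feq Omega g h -> feq Omega w h.
Proof. by apply: filterS2 => x h1 h2 Ox; rewrite h1// h2. Qed.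

Lemma feqB w w' g g' : feq Omega w w' -> feq Omega g g' ->
  feq Omega (fun x => w x - g x) (fun x => w' x - g' x).
Proof. by apply: filterS2 => x h1 h2 Ox; rewrite h1// h2. Qed.

Lemma feqD w w' g g' : feq Omega w w' -> feq Omega g g' ->
  feq Omega (fun x => w x + g x) (fun x => w' x + g' x).
Proof. by apply: filterS2 => x h1 h2 Ox; rewrite h1// h2. Qed.

Lemma feq_subr0 w g : feq Omega (fun x => w x - g x) (fun=> 0) <-> feq Omega w g.
Proof.
split; apply: filterS => x h Ox; last by rewrite h// subrr.
by apply/eqP; rewrite -subr_eq0 h.
Qed.

Lemma ip_feq w w' g g' : L2 w -> L2 w' -> L2 g -> L2 g' ->
  feq Omega w w' -> feq Omega g g' -> ip Omega w g = ip Omega w' g'.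
Proof.
move=> Lw Lw' Lg Lg' ww' gg'; apply: eq_bigr => A _; congr fine.
apply: ae_eq_integral => //.
- exact: measurable_int (L2_mul_integrable A Lw Lg).
- exact: measurable_int (L2_mul_integrable A Lw' Lg').
by move: ww' gg'; apply: filterS2 => x h1 h2 Ox; rewrite h1// h2.
Qed.

Lemma ipC w g : ip Omega w g = ip Omega g w.
Proof. by apply: eq_bigr => A _; apply: eq_Rintegral => x _; rewrite mulrC. Qed.

Lemma ipDl w w' g : L2 w -> L2 w' -> L2 g ->
  ip Omega (fun x => w x + w' x) g = ip Omega w g + ip Omega w' g.
Proof.
move=> Lw Lw' Lg; rewrite /ip -big_split/=; apply: eq_bigr => A _.
under eq_Rintegral do rewrite ffunD mulrDl.
by rewrite RintegralD//; exact: L2_mul_integrable.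
Qed.

Lemma ipZl c w g : L2 w -> L2 g -> ip Omega (fun x => c *: w x) g = c * ip Omega w g.
Proof.
move=> Lw Lg; rewrite /ip mulr_sumr; apply: eq_bigr => A _.
under eq_Rintegral do rewrite ffunZ -mulrA.
by rewrite RintegralZl//; exact: L2_mul_integrable.
Qed.

Lemma ipBl w w' g : L2 w -> L2 w' -> L2 g ->
  ip Omega (fun x => w x - w' x) g = ip Omega w g - ip Omega w' g.
Proof.
move=> Lw Lw' Lg; have := ipDl Lw (L2Z (-1) Lw') Lg.
rewrite (ipZl (-1) Lw' Lg) mulN1r => <-; congr ip.
by apply/funext => x; rewrite scaleN1r.
Qed.

Lemma ipDr w g g' : L2 w -> L2 g -> L2 g' ->
  ip Omega w (fun x => g x + g' x) = ip Omega w g + ip Omega w g'.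
Proof. by move=> *; rewrite ipC ipDl// !(ipC _ w). Qed.

Lemma ipBr w g g' : L2 w -> L2 g -> L2 g' ->
  ip Omega w (fun x => g x - g' x) = ip Omega w g - ip Omega w g'.
Proof. by move=> *; rewrite ipC ipBl// !(ipC _ w). Qed.

Lemma ipZr c w g : L2 w -> L2 g -> ip Omega w (fun x => c *: g x) = c * ip Omega w g.
Proof. by move=> *; rewrite ipC ipZl// ipC. Qed.

Lemma ip0l g : ip Omega (fun=> 0) g = 0.
Proof.
rewrite /ip big1// => A _; under eq_Rintegral do rewrite ffun0E mul0r.
by rewrite Rintegral_cst// mul0r.
Qed.

Lemma ip0r g : ip Omega g (fun=> 0) = 0.
Proof. by rewrite ipC ip0l. Qed.

Lemma ip_ge0 w : 0 <= ip Omega w w.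
Proof. by apply: sumr_ge0 => A _; apply: Rintegral_ge0 => x _; rewrite -expr2 sqr_ge0. Qed.

Lemma ip_eq0 w : L2 w -> ip Omega w w = 0 -> feq Omega w (fun=> 0).
Proof.
move=> Lw /eqP; rewrite psumr_eq0; last first.
  by move=> A _; apply: Rintegral_ge0 => x _; rewrite -expr2 sqr_ge0.
move=> /allP w0.
suff : {ae leb, forall x, forall A, Omega x -> w x A = 0}.
  by apply: filterS => x h Ox; apply/ffunP => A; rewrite h// ffun0E.
apply: filter_forall => A.
have iww := L2_mul_integrable A Lw Lw.
have h0 : Rintegral leb Omega (fun x => w x A * w x A) = 0.
  by apply/eqP; exact: (w0 A (mem_index_enum _)).
move: (congr1 EFin h0); rewrite /Rintegral.
rewrite fineK ?integrable_fin_num// => iw0.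
have : (\int[leb]_(x in Omega) `|(w x A * w x A)%:E|)%E = 0%E.
  rewrite -[RHS]iw0; apply: eq_integral => x _ /=.
  by rewrite ger0_norm// -expr2 sqr_ge0.
move/(ae_eq_integral_abs _ mO (measurable_int _ iww)); apply: filterS => x h Ox.
have [] := h Ox; move/eqP; rewrite mulf_eq0 orbb; exact: eqP.
Qed.

Lemma ip_sub_eq0 w g : L2 w -> L2 g ->
  ip Omega (fun x => w x - g x) (fun x => w x - g x) = 0 -> feq Omega w g.
Proof. by move=> Lw Lg h; apply/feq_subr0; apply: ip_eq0 => //; exact: L2B. Qed.

End L2_theory.

(** * The exterior derivative and its formal adjoint *)

Section second_derivatives.
Variables (R : realType) (n : nat).
Implicit Types (u : 'rV[R]_n -> R) (x : 'rV[R]_n).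
Local Notation e_ := (basis_vec R).
Local Notation "'d_ i u" := (derive u ^~ (e_ i)) (at level 10, i at level 8, u at level 8).

Lemma is_derive_continuous (f : R -> R) (df : R -> R) :
  (forall t : R, is_derive t (1 : R) f (df t)) -> continuous f.
Proof.
move=> h t; apply: differentiable_continuous.
by apply/derivable1_diffP; case: (h t).
Qed.

Lemma is_derive_on_line u (v : 'rV[R]_n -> R) x i (t : R) :
  (forall y, is_derive y (e_ i) u (v y)) ->
  is_derive t (1 : R) (fun s => u (x + s *: e_ i)) (v (x + t *: e_ i)).
Proof.
move=> h; apply: is_derive_line (h (x + t *: e_ i)) => s.
have -> : s *: (1 : R) = s by exact: mulr1.
by rewrite scalerDl addrCA.
Qed.

Lemma norm_basis_vec_le i : `|e_ i : 'rV[R]_n| <= 1.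
Proof.
apply/norm_leP => // j; rewrite basis_vecE.
by case: (_ == _); rewrite ?normr1 ?normr0.
Qed.

(** Mean value theorem twice: along [e_i] for the increment of [u] in direction [e_j], then along
    [e_j] for the first partial derivative. *)
Lemma second_difference u x i j (h : R) : 0 < h -> Cm 2 u ->
  exists2 y, `|y - x| <= 2 * h &
    u (x + h *: e_ i + h *: e_ j) - u (x + h *: e_ i) - u (x + h *: e_ j) + u x =
    h ^+ 2 * 'D_(e_ j) ('D_(e_ i) u) y.
Proof.
move=> h0 Cu.
have du l y : is_derive y (e_ l) u ('D_(e_ l) u y) by exact: Cm_is_derive Cu.
have ddu y : is_derive y (e_ j) ('D_(e_ i) u) ('D_(e_ j) ('D_(e_ i) u) y).
  by apply: Cm_is_derive; exact: Cm_deriv Cu.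
pose g s := u (x + h *: e_ j + s *: e_ i) + -1 * u (x + s *: e_ i).
pose dg s := 'D_(e_ i) u (x + h *: e_ j + s *: e_ i) + -1 * 'D_(e_ i) u (x + s *: e_ i).
have gd s : is_derive s (1:R) g (dg s).
  by apply: is_derive_add; [|apply: is_derive_scale]; exact: is_derive_on_line.
have [s s0h gE] : exists2 s, s \in `]0, h[ & g h - g 0 = dg s * (h - 0).
  apply: MVT => //; apply: continuous_subspaceT; exact: is_derive_continuous gd.
pose k t := 'D_(e_ i) u (x + s *: e_ i + t *: e_ j).
pose dk t := 'D_(e_ j) ('D_(e_ i) u) (x + s *: e_ i + t *: e_ j).
have kd t : is_derive t (1:R) k (dk t) by exact: is_derive_on_line.
have [t t0h kE] : exists2 t, t \in `]0, h[ & k h - k 0 = dk t * (h - 0).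
  apply: MVT => //; apply: continuous_subspaceT; exact: is_derive_continuous kd.
exists (x + s *: e_ i + t *: e_ j).
  rewrite -(addrA x) (addrC x) addrK mulr2n mulrDl mul1r.
  move: s0h t0h; rewrite !in_itv/= => /andP[s0 sh] /andP[t0 th].
  rewrite (le_trans (ler_normD _ _))// lerD// normrZ (gtr0_norm _)//.
    by rewrite (le_trans _ (ltW sh))// ler_piMr ?(ltW s0)// norm_basis_vec_le.
  by rewrite (le_trans _ (ltW th))// ler_piMr ?(ltW t0)// norm_basis_vec_le.
have E : dg s = k h - k 0.
  by rewrite /dg /k scale0r addr0 mulN1r (addrAC x).
rewrite -/(dk t) expr2; transitivity (g h - g 0); last by rewrite gE E kE subr0; ring.
rewrite /g scale0r !addr0 (addrAC x); ring.
Qed.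

(** The second difference is symmetric in [i] and [j], so the two mixed derivatives take a common
    value at points within 2h of [x]; continuity does the rest. *)
Lemma schwarz u x i j : Cm 2 u -> 'D_(e_ i) ('D_(e_ j) u) x = 'D_(e_ j) ('D_(e_ i) u) x.
Proof.
move=> Cu.
have cD a b : {for x, continuous ('D_(e_ a) ('D_(e_ b) u))}.
  exact: Cm_continuous (Cm_deriv a (Cm_deriv b Cu)) x.
apply/eqP; rewrite -subr_eq0 -normr_le0; apply/ler_addgt0Pl => e e0; rewrite addr0.
have e20 : 0 < e / 2 by rewrite divr_gt0.
have nb a b : exists2 d, 0 < d & forall y, `|y - x| < d ->
    `|'D_(e_ a) ('D_(e_ b) u) x - 'D_(e_ a) ('D_(e_ b) u) y| <= e / 2.
  have /(@cvgrPdist_le _ _ _ _ (nbhs_filter x)) /(_ _ e20) /nbhs_ballP[d /= d0 hd] := cD a b.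
  exists d => // y yx; apply: hd; rewrite mx_norm_ball /ball_/= distrC//.
have [d1 d10 h1] := nb i j; have [d2 d20 h2] := nb j i.
have [h [h0 hd1 hd2]] : exists h : R, [/\ 0 < h, 2 * h < d1 & 2 * h < d2].
  exists (Num.min d1 d2 / 4); split; first by rewrite divr_gt0// lt_min d10.
    have : Num.min d1 d2 <= d1 by rewrite ge_min lexx.
    have : 0 < Num.min d1 d2 by rewrite lt_min d10.
    by move: (Num.min _ _) => m; lra.
  have : Num.min d1 d2 <= d2 by rewrite ge_min lexx orbT.
  have : 0 < Num.min d1 d2 by rewrite lt_min d10.
  by move: (Num.min _ _) => m; lra.
have [y1 y1h E1] := second_difference x i j h0 Cu.
have [y2 y2h E2] := second_difference x j i h0 Cu.
have k1 := h1 _ (le_lt_trans y2h hd1).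
have k2 := h2 _ (le_lt_trans y1h hd2).
have h20 : h ^+ 2 != 0 by rewrite expf_neq0// gt_eqF.
have E12 : u (x + h *: e_ i + h *: e_ j) - u (x + h *: e_ i) - u (x + h *: e_ j) + u x =
   u (x + h *: e_ j + h *: e_ i) - u (x + h *: e_ j) - u (x + h *: e_ i) + u x.
  by rewrite (addrAC x (h *: e_ i)); congr (_ + _); exact: addrAC.
have E := mulfI h20 (etrans (esym E1) (etrans E12 E2)).
rewrite E distrC in k2.
rewrite (splitr e); apply: le_trans (lerD k1 k2); exact: ler_distD.
Qed.

End second_derivatives.

(** * Signs, d d = 0 and the formal adjoint of d *)

Section ext_d_theory.
Variables (R : realType) (n : nat).
Implicit Types (w : dform R n) (A B C : {set 'I_n}) (i j : 'I_n) (k : nat).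
Local Notation e_ := (basis_vec R).
Local Notation isign := (isign R).

Lemma isignD1 i j A : isign i (A :\ j) = if (j \in A) && (j < i)%N then - isign i A else isign i A.
Proof.
rewrite /Defs.isign.
have [/andP[jA ji]|nj] := boolP ((j \in A) && (j < i)%N).
  rewrite [in RHS](cardsD1 j) inE jA ji exprD expr1 mulN1r opprK; congr (_ ^+ _).
  by apply: eq_card => l; rewrite !inE; case: eqP.
congr (_ ^+ _); apply: eq_card => l; rewrite !inE.
by case: eqP => [->|//]; rewrite (negbTE nj).
Qed.

Lemma isignD1_self i A : isign i (A :\ i) = isign i A.
Proof. by rewrite isignD1 ltnn andbF. Qed.

Lemma isign_sqr i A : isign i A * isign i A = 1.
Proof. by rewrite -expr2 /Defs.isign sqrr_sign. Qed.

(** Exactly one inner sign flips, that of the larger index, which loses the smaller one from its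
    count. *)
Lemma isign_antisym i j C : i != j -> i \in C -> j \in C ->
  isign i C * isign j (C :\ i) = - (isign j C * isign i (C :\ j)).
Proof.
move=> ij iC jC; rewrite !isignD1 iC jC /=.
by case: ltngtP ij => [_ _|_ _|/val_inj ->]; rewrite ?eqxx// ?mulrN ?opprK mulrC.
Qed.

Lemma ext_d_Cm m w : (forall A, Cm m.+1 (fun x => w x A)) -> forall B, Cm m (fun x => ext_d w x B).
Proof.
move=> Cw B; under eq_fun do rewrite ffunE.
by apply: Cm_sum => i _; apply: CmZ; exact: Cm_deriv.
Qed.

(** Exchanging the two removed indices turns the double sum into its opposite: the signs anticommute
    and the partial derivatives commute. *)
Lemma ext_d_ext_d w : smooth_form w -> ext_d (ext_d w) = fun=> 0.
Proof.
move=> Sw; apply/funext => x; apply/ffunP => C; rewrite ffun0E ffunE.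
pose a i j := isign i C * isign j (C :\ i) * 'D_(e_ i) ('D_(e_ j) (fun y => w y (C :\ i :\ j))) x.
transitivity (\sum_(i in C) \sum_(j in C | j != i) a i j).
  apply: eq_bigr => i iC.
  have -> : (fun y => ext_d w y (C :\ i)) = (fun y => \sum_(j in C :\ i) isign j (C :\ i) *
      'D_(e_ j) (fun z => w z (C :\ i :\ j)) y) by apply/funext => y; rewrite ffunE.
  have := @is_derive_bigsum R _ _ (index_enum 'I_n) (mem (C :\ i)) (fun j y => isign j (C :\ i) *
     'D_(e_ j) (fun z => w z (C :\ i :\ j)) y) x (e_ i) (fun j => isign j (C :\ i) *
     'D_(e_ i) ('D_(e_ j) (fun z => w z (C :\ i :\ j))) x).
  case.
    move=> j _; apply: is_derive_scale; apply: (@Cm_is_derive _ _ 0); apply: Cm_deriv.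
    exact: Sw.
  move=> _ ->; rewrite mulr_sumr; apply: eq_big => [j|j _]; first by rewrite !inE andbC.
  by rewrite mulrA.
set S := (X in X = 0).
have : S = - S.
  rewrite {1}/S (exchange_big_dep (mem C)) /=; last by move=> i j _ /andP[].
  rewrite /S -sumrN; apply: eq_bigr => i iC; rewrite -sumrN.
  apply: eq_big => [j|j /andP[jC]]; first by rewrite iC/= eq_sym.
  rewrite iC/= => ij; rewrite /a.
  have -> : C :\ j :\ i = C :\ i :\ j by rewrite finset.setDDl finset.setUC -finset.setDDl.
  have ji : j != i by rewrite eq_sym.
  by rewrite (isign_antisym ji jC iC) mulNr (schwarz x j i (Sw (C :\ i :\ j) 2)).
lra.
Qed.

(* The formal adjoint of [ext_d], computed on smooth representatives. *)
Definition cod w : dform R n := fun x => [ffun A : {set 'I_n} =>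
  - \sum_(i | i \notin A) isign i A * 'D_(e_ i) (fun y => w y (i |: A)) x].

Lemma cod_Cm m w : (forall A, Cm m.+1 (fun x => w x A)) -> forall B, Cm m (fun x => cod w x B).
Proof.
move=> Cw B; under eq_fun do rewrite ffunE -mulN1r.
by apply: CmZ; apply: Cm_sum => i _; apply: CmZ; exact: Cm_deriv.
Qed.

(** The pairs (B, i in B) and (A, i not in A) correspond by A = B minus i; this exchange carries the
    components of [ext_d] to those of [cod]. *)
Lemma sum_face_coface (F : 'I_n -> {set 'I_n} -> {set 'I_n} -> R) :
  \sum_(B : {set 'I_n}) \sum_(i in B) F i (B :\ i) B = \sum_(A : {set 'I_n}) \sum_(i | i \notin A) F i A (i |: A).
Proof.
rewrite !pair_big_dep/=.
rewrite (reindex_onto (fun p : {set 'I_n} * 'I_n => (p.2 |: p.1, p.2)) (fun p => (p.1 :\ p.2, p.2))) /=.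
  apply: eq_big => [[A i]|[A i] /=]; rewrite ?finset.setU11 /=.
    by rewrite xpair_eqE eqxx andbT; apply/eqP/idP => [<-|/finset.setU1K//]; rewrite !inE eqxx.
  by rewrite xpair_eqE => /andP[/eqP -> _].
by move=> [B i] /= iB; rewrite finset.setD1K.
Qed.

End ext_d_theory.

Lemma Rintegral_sum d (T : measurableType d) (R : realType)
    (mu : {measure set T -> \bar R}) (D : set T) I (r : seq I) (P : pred I) (F : I -> T -> R) :
  measurable D -> (forall i, P i -> mu.-integrable D (EFin \o F i)) ->
  \int[mu]_(x in D) (\sum_(i <- r | P i) F i x) = \sum_(i <- r | P i) \int[mu]_(x in D) F i x.
Proof.
move=> mD iF; elim: r => [|i r IH].
  rewrite big_nil; under eq_Rintegral do rewrite big_nil.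
  by rewrite Rintegral_cst// mul0r.
rewrite big_cons; case Pi: (P i); under eq_Rintegral do rewrite big_cons Pi; last exact: IH.
rewrite RintegralD ?IH//; first exact: iF.
have := integrable_sum mD r iF; apply: eq_integrable => // x _.
by rewrite /= sumEFin.
Qed.

(** * Integration by parts with compact support *)

Section compact_support.
Variables (R : realType) (n : nat).
Local Notation leb := (@lebesgue_rV R n).
Local Notation e_ := (basis_vec R).
Implicit Types (f u v : 'rV[R]_n -> R) (K D : set 'rV[R]_n).

Lemma compact_closed_rV K : compact K -> closed K.
Proof. by apply: compact_closed; exact: norm_hausdorff. Qed.

Lemma compact_cube K : compact K -> exists M, K `<=` cube M.
Proof.
move=> /compact_bounded[M [_ hM]]; exists (M + 1) => x Kx i.
by rewrite (le_trans (coord_le_norm x i))// hM// ltrDl.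
Qed.

Lemma compact_support_bound f K : continuous f -> compact K ->
  (forall x, ~ K x -> f x = 0) -> exists C, forall x, `|f x| <= C.
Proof.
move=> cf cK f0.
have /compact_bounded[M [_ hM]] : compact (f @` K).
  by apply: continuous_compact => //; exact: continuous_subspaceT.
exists (`|M| + 1) => x; have [Kx|/f0 ->] := pselect (K x); last by rewrite normr0 addr_ge0.
by apply: hM; [rewrite (le_lt_trans (ler_norm M))// ltrDl|exists x].
Qed.

Lemma compact_support_integrable f K D : continuous f -> compact K -> measurable D ->
  (forall x, ~ K x -> f x = 0) -> leb.-integrable D (EFin \o f).
Proof.
move=> cf cK mD f0; have [M KM] := compact_cube cK; have [C fC] := compact_support_bound cf cK f0.
apply: (@integrableS _ _ _ _ setT) => //.
apply: (@integrable_bounded_support _ _ _ _ (cube M) f C) => //.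
- exact: cube_measurable.
- exact: lebesgue_rV_cube.
- exact: continuous_measurable_rV.
- by move=> x nx; apply: f0 => /KM.
Qed.

Lemma compact_support_derive f K i x : compact K -> (forall x, ~ K x -> f x = 0) ->
  ~ K x -> 'D_(e_ i) f x = 0.
Proof.
move=> cK f0 nKx; rewrite -(derive_cst (0 : R) x (e_ i)).
apply: near_eq_derive.
have : nbhs x (~` K).
  by apply: open_nbhs_nbhs; split=> //; apply: closed_openC; exact: compact_closed_rV.
by apply: filterS => y /f0.
Qed.

Lemma integration_by_parts_rV u v K D i : measurable D -> compact K -> K `<=` D ->
  Cm 1 u -> Cm 1 v -> (forall x, ~ K x -> u x = 0) ->
  \int[leb]_(x in D) ('D_(e_ i) u x * v x) = - \int[leb]_(x in D) (u x * 'D_(e_ i) v x).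
Proof.
move=> mD cK KD Cu Cv u0.
have [cu cv] := (Cm_continuous Cu, Cm_continuous Cv).
have [cdu cdv] := (Cm_continuous (Cm_deriv i Cu), Cm_continuous (Cm_deriv i Cv)).
have du0 x : ~ K x -> 'D_(e_ i) u x = 0 by move=> nK; exact: compact_support_derive nK.
have c1 := continuous_mul cdu cv; have c2 := continuous_mul cu cdv.
have z1 x : ~ K x -> 'D_(e_ i) u x * v x = 0 by move/du0 ->; rewrite mul0r.
have z2 x : ~ K x -> u x * 'D_(e_ i) v x = 0 by move/u0 ->; rewrite mul0r.
have i1 := compact_support_integrable c1 cK mD z1.
have i2 := compact_support_integrable c2 cK mD z2.
apply/eqP; rewrite -addr_eq0 -RintegralD//; apply/eqP.
pose w x := u x * v x; pose dw x := u x * 'D_(e_ i) v x + v x * 'D_(e_ i) u x.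
have dwE x : is_derive x (e_ i) w (dw x).
  by apply: is_derive_mul; exact: (@Cm_is_derive _ _ 0).
have cdw : continuous dw by apply: continuous_add => //; exact: continuous_mul.
have dw0 x : ~ K x -> dw x = 0 by move=> nK; rewrite /dw u0// du0// mul0r mulr0 addr0.
have [M KM] := compact_cube cK; have [C dwC] := compact_support_bound cdw cK dw0.
rewrite /Rintegral (_ : (\int[leb]_(x in D) _)%E = 0%E)//.
transitivity (\int[leb]_x (dw x)%:E)%E.
  rewrite integral_mkcond; apply: eq_integral => x _; rewrite patchE.
  case: ifPn => [_|]; first by rewrite /dw addrC [v x * _]mulrC.
  by rewrite notin_setE => nD; rewrite dw0// => /KD.
apply: (integral_partial_eq0 (M := M) dwE cdw) dwC => x nM.
  by rewrite /w u0 ?mul0r// => /KM.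
by apply: dw0 => /KM.
Qed.

End compact_support.

(** * The weak codifferential *)

Section test_forms.
Variables (R : realType) (n : nat) (Omega : set 'rV[R]_n).
Hypotheses (oO : open Omega) (fO : (@lebesgue_rV R n Omega < +oo)%E).
Local Notation leb := (@lebesgue_rV R n).
Local Notation e_ := (basis_vec R).
Implicit Types (w g h phi psi mu eta : dform R n) (k : nat).

Let mO : measurable Omega. Proof. exact: open_measurable_rV. Qed.

Lemma dform0P (f : {ffun {set 'I_n} -> R}) A : f = 0 -> f A = 0.
Proof. by move=> ->; rewrite ffun0E. Qed.

Lemma test_form_L2form k phi : test_form Omega k phi -> L2form Omega k phi.
Proof.
move=> [hphi sphi [K [cK KO phi0]]]; split=> //.
have cphi A : continuous (fun x => phi x A) by exact: Cm_continuous (sphi A 0).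
have bd A : exists C, forall x, `|phi x A| <= C.
  by apply: compact_support_bound cK _ => // x /phi0 /dform0P ->.
have mphi A : measurable_fun Omega (fun x => phi x A).
  by apply: measurable_funTS; exact: continuous_measurable_rV.
move=> A; have [C hC] := bd A; split=> //.
apply: measurable_bounded_integrable => //; first exact: measurable_funX.
exists (C ^+ 2); split=> [|y My x Ox]; rewrite ?num_real//= (le_trans _ (ltW My))//.
by rewrite normrX lerXn2r// ?nnegrE// (le_trans (normr_ge0 _) (hC x)).
Qed.

Lemma test_formS k (U : set 'rV[R]_n) phi : U `<=` Omega -> test_form U k phi -> test_form Omega k phi.
Proof. by move=> UO [? ? [K [cK KU ?]]]; split=> //; exists K; split=> // x /KU/UO. Qed.

Lemma test_formD k phi psi : test_form Omega k phi -> test_form Omega k psi ->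
  test_form Omega k (fun x => phi x + psi x).
Proof.
move=> [h1 s1 [K1 [c1 K1O z1]]] [h2 s2 [K2 [c2 K2O z2]]]; split.
- exact: homogD.
- by move=> A m; under eq_fun do rewrite ffunD; exact: CmD.
exists (K1 `|` K2); split; first exact: compactU.
  by move=> x [/K1O|/K2O].
by move=> x /not_orP[/z1 -> /z2 ->]; rewrite addr0.
Qed.

Lemma test_formZ k c phi : test_form Omega k phi -> test_form Omega k (fun x => c *: phi x).
Proof.
move=> [h1 s1 [K1 [c1 K1O z1]]]; split.
- exact: homogZ.
- by move=> A m; under eq_fun do rewrite ffunZ; exact: CmZ.
by exists K1; split=> // x /z1 ->; rewrite scaler0.
Qed.

Lemma homog_ext_d k phi : homog k phi -> homog k.+1 (ext_d phi).
Proof.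
move=> hphi x B kB; rewrite ffunE big1// => i iB.
have -> : (fun y => phi y (B :\ i)) = fun=> 0.
  apply/funext => y; apply: hphi; apply: contra kB => /eqP <-.
  by rewrite (cardsD1 i B) iB.
by rewrite derive_cst mulr0.
Qed.

Lemma homog_cod k w : homog k.+1 w -> homog k (cod w).
Proof.
move=> hw x B kB; rewrite ffunE big1 ?oppr0// => i iB.
have -> : (fun y => w y (i |: B)) = fun=> 0.
  by apply/funext => y; apply: hw; rewrite cardsU1 iB eqSS.
by rewrite derive_cst mulr0.
Qed.

Lemma test_form_ext_d k phi : test_form Omega k phi -> test_form Omega k.+1 (ext_d phi).
Proof.
move=> [h1 s1 [K1 [c1 K1O z1]]]; split.
- exact: homog_ext_d.
- by move=> A m; apply: ext_d_Cm => B; exact: s1.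
exists K1; split=> // x nK; apply/ffunP => B; rewrite ffun0E ffunE big1// => i _.
by rewrite (compact_support_derive i c1 _ nK) ?mulr0// => y /z1 /dform0P ->.
Qed.

Lemma test_form_cod k phi : test_form Omega k.+1 phi -> test_form Omega k (cod phi).
Proof.
move=> [h1 s1 [K1 [c1 K1O z1]]]; split.
- exact: homog_cod.
- by move=> A m; apply: cod_Cm => B; exact: s1.
exists K1; split=> // x nK; apply/ffunP => B; rewrite ffun0E ffunE big1 ?oppr0// => i _.
by rewrite (compact_support_derive i c1 _ nK) ?mulr0// => y /z1 /dform0P ->.
Qed.

(** Integration by parts in each component, then the exchange of faces and cofaces. [w] is only
    asked to be C^1, so the Whitney polynomial of a single cell qualifies. *)
Lemma ip_ext_d_cod k phi w : test_form Omega k phi -> (forall A, Cm 1 (fun x => w x A)) ->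
  ip Omega (ext_d phi) w = ip Omega phi (cod w).
Proof.
move=> [h1 s1 [K [cK KO z1]]] Cw.
have C1 A : Cm 1 (fun x => phi x A) by exact: s1.
have z A x : ~ K x -> phi x A = 0 by move=> /z1 /dform0P ->.
have ibp i A B := integration_by_parts_rV i mO cK KO (C1 A) (Cw B) (z A).
have int1 i A B : leb.-integrable Omega (EFin \o (fun x => 'D_(e_ i) (fun y => phi y A) x * w x B)).
  apply: (@compact_support_integrable _ _ _ K) => //.
    apply: continuous_mul; last exact: Cm_continuous (Cw B).
    exact: Cm_continuous (Cm_deriv i (C1 A)).
  by move=> x nK; rewrite (compact_support_derive i cK (z A) nK) mul0r.
have int2 i A B : leb.-integrable Omega (EFin \o (fun x => phi x A * 'D_(e_ i) (fun y => w y B) x)).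
  apply: (@compact_support_integrable _ _ _ K) => //.
    apply: continuous_mul; first exact: Cm_continuous (C1 A).
    exact: Cm_continuous (Cm_deriv i (Cw B)).
  by move=> x nK; rewrite z// mul0r.
transitivity (\sum_(B : {set 'I_n}) \sum_(i in B) isign R i (B :\ i) *
    \int[leb]_(x in Omega) ('D_(e_ i) (fun y => phi y (B :\ i)) x * w x B)).
  apply: eq_bigr => B _.
  transitivity (\int[leb]_(x in Omega) (\sum_(i in B) isign R i (B :\ i) *
      ('D_(e_ i) (fun y => phi y (B :\ i)) x * w x B))).
    apply: eq_Rintegral => x _; rewrite ffunE mulr_suml; apply: eq_bigr => i iB.
    by rewrite isignD1_self mulrA.
  rewrite Rintegral_sum//; last first.
    by move=> i iB; exact: (integrableZl mO (isign R i (B :\ i)) (int1 i (B :\ i) B)).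
  by apply: eq_bigr => i iB; rewrite RintegralZl.
rewrite (sum_face_coface (fun i A B => isign R i A *
    \int[leb]_(x in Omega) ('D_(e_ i) (fun y => phi y A) x * w x B))).
apply: eq_bigr => A _; apply/esym.
transitivity (\int[leb]_(x in Omega) (\sum_(i | i \notin A) - isign R i A *
    (phi x A * 'D_(e_ i) (fun y => w y (i |: A)) x))).
  apply: eq_Rintegral => x _; rewrite ffunE mulrN mulr_sumr -sumrN; apply: eq_bigr => i iA.
  ring.
rewrite Rintegral_sum//; last first.
  by move=> i iA; exact: (integrableZl mO (- isign R i A) (int2 i A (i |: A))).
by apply: eq_bigr => i iA; rewrite RintegralZl// ibp mulrN mulNr.
Qed.

End test_forms.

(** * The weak codifferential and the space [Hstar0] *)

Section codifferential.
Variables (R : realType) (n : nat) (Omega : set 'rV[R]_n).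
Hypotheses (oO : open Omega) (fO : (@lebesgue_rV R n Omega < +oo)%E).
Local Notation leb := (@lebesgue_rV R n).
Implicit Types (w g h phi psi mu eta : dform R n) (k : nat).

Let mO : measurable Omega. Proof. exact: open_measurable_rV. Qed.
Let tL2 k phi : test_form Omega k phi -> L2 Omega phi.
Proof. by move/(test_form_L2form oO fO)/L2form_L2. Qed.

Lemma test_form_ae_eq0 k g (U : set 'rV[R]_n) : open U -> U `<=` Omega -> L2form Omega k g ->
  (forall phi, test_form U k phi -> ip Omega phi g = 0) -> {ae leb, forall x, U x -> g x = 0}.
Proof.
move=> oU UO [hg Lg] g0.
suff : {ae leb, forall x, forall A, U x -> g x A = 0}.
  by apply: filterS => x h Ux; apply/ffunP => A; rewrite h// ffun0E.
apply: filter_forall => A.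
have [kA|/hg h] := eqVneq #|A| k; last by apply: aeW => x _; exact: h.
apply: (@test_fun_ae_eq0 _ _ Omega) => //; first exact: L2_integrable.
move=> u [Cu [K [cK KU u0]]].
(* One component at a time: the test form is [u dx^A], of degree [k] because |A| = k. *)
pose phi : dform R n := fun x => [ffun B => if B == A then u x else 0].
have tphi : test_form U k phi.
  split.
  - by move=> x B kB; rewrite ffunE; case: (eqVneq B A) kB => // ->; rewrite kA eqxx.
  - move=> B m; under eq_fun do rewrite ffunE.
    by case: (eqVneq B A) => // _; exact: Cm_cst.
  exists K; split=> // x /u0 ux; apply/ffunP => B; rewrite !ffunE ux.
  by case: ifP.
rewrite -[RHS](g0 _ tphi) /ip (bigD1 A)//= [X in _ + X]big1 ?addr0.
  by apply: eq_Rintegral => x _; rewrite ffunE eqxx.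
move=> B /negbTE BA; under eq_Rintegral do rewrite ffunE BA mul0r.
by rewrite Rintegral_cst// mul0r.
Qed.

Lemma test_form_feq0 k g : L2form Omega k g ->
  (forall phi, test_form Omega k phi -> ip Omega phi g = 0) -> feq Omega g (fun=> 0).
Proof. by move=> Lg g0; exact: test_form_ae_eq0 Lg g0. Qed.

Lemma is_codiff_unique k mu g g' : is_codiff Omega k.+1 mu g -> is_codiff Omega k.+1 mu g' ->
  feq Omega g g'.
Proof.
move=> [/= Lg cg] [/= Lg' cg']; apply/feq_subr0.
apply: (@test_form_feq0 k); first exact: L2formB.
move=> phi tphi; have Lphi := tL2 tphi; have L2g := L2form_L2 Lg; have L2g' := L2form_L2 Lg'.
by rewrite ipBr// -cg// -cg'// subrr.
Qed.

Lemma is_codiffD k mu mu' g g' : L2 Omega mu -> L2 Omega mu' ->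
  is_codiff Omega k.+1 mu g -> is_codiff Omega k.+1 mu' g' ->
  is_codiff Omega k.+1 (fun x => mu x + mu' x) (fun x => g x + g' x).
Proof.
move=> Lm Lm' [/= Lg cg] [/= Lg' cg']; split; first exact: L2formD.
move=> phi tphi; have Lphi := tL2 tphi; have Ldphi := tL2 (test_form_ext_d tphi).
have L2g := L2form_L2 Lg; have L2g' := L2form_L2 Lg'.
by rewrite !ipDr// cg// cg'.
Qed.

Lemma is_codiffZ k c mu g : L2 Omega mu ->
  is_codiff Omega k.+1 mu g -> is_codiff Omega k.+1 (fun x => c *: mu x) (fun x => c *: g x).
Proof.
move=> Lm [/= Lg cg]; split; first exact: L2formZ.
move=> phi tphi; have Lphi := tL2 tphi; have Ldphi := tL2 (test_form_ext_d tphi).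
have L2g := L2form_L2 Lg.
by rewrite !ipZr// cg.
Qed.

Lemma subE_scale w g : (fun x => w x - g x) = (fun x => w x + (-1) *: g x) :> dform R n.
Proof. by apply/funext => x; rewrite scaleN1r. Qed.

Lemma is_codiffB k mu mu' g g' : L2 Omega mu -> L2 Omega mu' ->
  is_codiff Omega k.+1 mu g -> is_codiff Omega k.+1 mu' g' ->
  is_codiff Omega k.+1 (fun x => mu x - mu' x) (fun x => g x - g' x).
Proof.
move=> Lm Lm' cg cg'; rewrite !subE_scale; apply: is_codiffD => //; first exact: L2Z.
exact: is_codiffZ.
Qed.

Lemma is_codiff_feq k mu mu' g g' : L2 Omega mu -> L2 Omega mu' -> L2form Omega k g' ->
  feq Omega mu mu' -> feq Omega g g' -> is_codiff Omega k.+1 mu g -> is_codiff Omega k.+1 mu' g'.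
Proof.
move=> Lm Lm' Lg' mm' gg' [/= Lg cg]; split=> // phi tphi.
have Lphi := tL2 tphi; have Ldphi := tL2 (test_form_ext_d tphi).
rewrite -(ip_feq mO Ldphi Ldphi Lm Lm' (feq_refl _ _) mm') cg//.
by rewrite (ip_feq mO Lphi Lphi (L2form_L2 Lg) (L2form_L2 Lg') (feq_refl _ _) gg').
Qed.

Lemma is_codiff_codiff k mu g : is_codiff Omega k mu g -> is_codiff Omega k mu (codiff Omega k mu).
Proof. by move=> cg; rewrite /codiff; apply: (@xgetPex _ _ (is_codiff Omega k mu)); exists g. Qed.

Lemma codiff_feq k mu g : is_codiff Omega k.+1 mu g -> feq Omega (codiff Omega k.+1 mu) g.
Proof. by move=> cg; apply: (is_codiff_unique _ cg); exact: is_codiff_codiff cg. Qed.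

Lemma is_codiff_cod k phi : test_form Omega k.+1 phi -> is_codiff Omega k.+1 phi (cod phi).
Proof.
move=> tphi; split; first exact: test_form_L2form (test_form_cod tphi).
move=> psi tpsi; apply: (ip_ext_d_cod oO tpsi) => A.
by case: tphi => _ sphi _; exact: sphi.
Qed.

Lemma graph_normsqE k mu g : is_codiff Omega k.+1 mu g ->
  graph_normsq Omega k.+1 mu = ip Omega mu mu + ip Omega g g.
Proof.
move=> cg; have cc := is_codiff_codiff cg.
have Lg := L2form_L2 cg.1; have Lc := L2form_L2 cc.1.
by congr (_ + _); apply: ip_feq => //; exact: codiff_feq.
Qed.

(** A workable form of the closure: squared norms instead of a root, and any weak codifferential [g]
    instead of the one chosen by [codiff]. *)
Lemma Hstar0_approx k mu g (e : R) : is_codiff Omega k.+1 mu g -> Hstar0 Omega k.+1 mu -> 0 < e ->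
  exists2 phi, test_form Omega k.+1 phi &
    ip Omega (fun x => mu x - phi x) (fun x => mu x - phi x) +
    ip Omega (fun x => g x - cod phi x) (fun x => g x - cod phi x) < e.
Proof.
move=> cg [[Lm _] ap] e0; have [|phi [tphi]] := ap (Num.sqrt e); first by rewrite sqrtr_gt0.
have cB := is_codiffB (L2form_L2 Lm) (tL2 tphi) cg (is_codiff_cod tphi).
by rewrite (graph_normsqE cB) ltr_sqrt// => h; exists phi.
Qed.

Lemma Hstar0_intro k mu g : L2form Omega k.+1 mu -> is_codiff Omega k.+1 mu g ->
  (forall e : R, 0 < e -> exists phi h, [/\ test_form Omega k.+1 phi, is_codiff Omega k.+1 phi h &
    ip Omega (fun x => mu x - phi x) (fun x => mu x - phi x) +
    ip Omega (fun x => g x - h x) (fun x => g x - h x) < e]) -> Hstar0 Omega k.+1 mu.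
Proof.
move=> Lm cg ap; split=> [|e e0]; first by split=> //; exists g.
have [|phi [h [tphi ch]]] := ap (e ^+ 2); first exact: exprn_gt0.
rewrite -(graph_normsqE (is_codiffB (L2form_L2 Lm) (tL2 tphi) cg ch)) => he.
exists phi; split=> //; rewrite -[X in _ < X](gtr0_norm e0) -sqrtr_sqr ltr_sqrt//.
exact: exprn_gt0.
Qed.

Lemma Hstar0_L2form k mu : Hstar0 Omega k mu -> L2form Omega k mu.
Proof. by case=> -[]. Qed.

Lemma Hstar0_is_codiff k mu : Hstar0 Omega k mu -> is_codiff Omega k mu (codiff Omega k mu).
Proof. by case=> -[_ [g]] cg _; exact: is_codiff_codiff cg. Qed.

(** The parallelogram law with the norm of [w - g] dropped; it plays the role of the triangle
    inequality for squared norms. *)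
Lemma ip_sumsq_le w g : L2 Omega w -> L2 Omega g ->
  ip Omega (fun x => w x + g x) (fun x => w x + g x) <= 2 * ip Omega w w + 2 * ip Omega g g.
Proof.
move=> Lw Lg; have := ip_ge0 Omega (fun x => w x - g x).
have LD := L2D mO Lw Lg; have LB := L2B mO Lw Lg.
rewrite ipBl// !ipBr// ipDl// !ipDr// (ipC _ g w).
move: (ip _ w w) (ip _ w g) (ip _ g g) => a b c; lra.
Qed.

Lemma subDD w w' g g' : (fun x => w x + w' x - (g x + g' x)) =
  (fun x => (w x - g x) + (w' x - g' x)) :> dform R n.
Proof. by apply/funext => x; rewrite opprD addrACA. Qed.

Lemma Hstar0D k mu mu' : Hstar0 Omega k.+1 mu -> Hstar0 Omega k.+1 mu' ->
  Hstar0 Omega k.+1 (fun x => mu x + mu' x).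
Proof.
move=> Hm Hm'; have cg := Hstar0_is_codiff Hm; have cg' := Hstar0_is_codiff Hm'.
have Lm := Hstar0_L2form Hm; have Lm' := Hstar0_L2form Hm'.
apply: (Hstar0_intro _ (is_codiffD (L2form_L2 Lm) (L2form_L2 Lm') cg cg')); first exact: L2formD.
(* Squared errors get doubled by [ip_sumsq_le], so two errors below e/4 add up to less than e. *)
move=> e e0; have e40 : 0 < e / 4 by rewrite divr_gt0.
have [phi tphi h] := Hstar0_approx cg Hm e40.
have [phi' tphi' h'] := Hstar0_approx cg' Hm' e40.
have ct := is_codiff_cod tphi; have ct' := is_codiff_cod tphi'.
exists (fun x => phi x + phi' x), (fun x => cod phi x + cod phi' x); split.
- exact: test_formD.
- by apply: is_codiffD => //; [exact: tL2 tphi|exact: tL2 tphi'].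
rewrite !subDD.
have := ip_sumsq_le (L2B mO (L2form_L2 Lm) (tL2 tphi)) (L2B mO (L2form_L2 Lm') (tL2 tphi')).
have := ip_sumsq_le (L2B mO (L2form_L2 cg.1) (L2form_L2 ct.1)) (L2B mO (L2form_L2 cg'.1) (L2form_L2 ct'.1)).
move: h h' => /=; do ![move: (ip _ _ _)] => a b c d p q; lra.
Qed.

Lemma subZZ (c : R) w g : (fun x => c *: w x - c *: g x) = (fun x => c *: (w x - g x)) :> dform R n.
Proof. by apply/funext => x; rewrite scalerBr. Qed.

Lemma Hstar0Z k (c : R) mu : Hstar0 Omega k.+1 mu -> Hstar0 Omega k.+1 (fun x => c *: mu x).
Proof.
move=> Hm; have cg := Hstar0_is_codiff Hm; have Lm := Hstar0_L2form Hm.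
apply: (Hstar0_intro _ (is_codiffZ c (L2form_L2 Lm) cg)); first exact: L2formZ.
(* [c ^+ 2 + 1] dominates the scaling factor of squared norms and is positive even for [c = 0]. *)
move=> e e0; have c0 : 0 < c ^+ 2 + 1 by rewrite ltr_wpDl// sqr_ge0.
have ec0 : 0 < e / (c ^+ 2 + 1) by rewrite divr_gt0.
have [phi tphi h] := Hstar0_approx cg Hm ec0; have ct := is_codiff_cod tphi.
exists (fun x => c *: phi x), (fun x => c *: cod phi x); split.
- exact: test_formZ.
- by apply: is_codiffZ => //; exact: tL2 tphi.
have L1 := L2B mO (L2form_L2 Lm) (tL2 tphi); have L2' := L2B mO (L2form_L2 cg.1) (L2form_L2 ct.1).
rewrite !subZZ !ipZl ?ipZr//; try exact: L2Z.
move: h; rewrite ltr_pdivlMr//; set s := (X in X * _ < _) => h.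
have s0 : 0 <= s by rewrite addr_ge0// ip_ge0.
rewrite !mulrA -mulrDr -expr2 -/s; apply: le_lt_trans h.
by rewrite mulrC ler_wpM2l// lerDl.
Qed.

Lemma Hstar0B k mu mu' : Hstar0 Omega k.+1 mu -> Hstar0 Omega k.+1 mu' ->
  Hstar0 Omega k.+1 (fun x => mu x - mu' x).
Proof. by move=> Hm Hm'; rewrite (subE_scale mu mu'); exact: (Hstar0D Hm (Hstar0Z (-1) Hm')). Qed.

Lemma Hstar0_feq k mu mu' : L2form Omega k.+1 mu' -> feq Omega mu mu' ->
  Hstar0 Omega k.+1 mu -> Hstar0 Omega k.+1 mu'.
Proof.
move=> Lm' mm' Hm; have cg := Hstar0_is_codiff Hm; have Lm := Hstar0_L2form Hm.
have cg' := is_codiff_feq (L2form_L2 Lm) (L2form_L2 Lm') cg.1 mm' (feq_refl _ _) cg.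
apply: (Hstar0_intro Lm' cg') => e e0.
have [phi tphi h] := Hstar0_approx cg Hm e0; have Lp := tL2 tphi.
exists phi, (cod phi); split=> //; first exact: is_codiff_cod.
have LB := L2B mO (L2form_L2 Lm) Lp; have LB' := L2B mO (L2form_L2 Lm') Lp.
have fB := feqB mm' (feq_refl Omega phi).
by rewrite -(ip_feq mO LB LB' LB LB' fB fB).
Qed.

(** Weak form of delta delta = 0: transposing onto the test form leaves [ext_d (ext_d psi)]. *)
Lemma is_codiff_smooth_codiff k eta g : is_codiff Omega k.+2 eta g -> is_codiff Omega k.+1 g (fun=> 0).
Proof.
move=> [/= Lg cg]; split; first exact: L2form0.
move=> psi tpsi; rewrite ip0r// -cg; last exact: test_form_ext_d.
rewrite ext_d_ext_d; last by case: tpsi.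
exact: ip0l.
Qed.

(** If test forms [phi] approach [eta] in the graph norm, their codifferentials approach [g]; as
    these and [g] have zero codifferential, the graph distance reduces to an L^2 term already under
    control. *)
Lemma Hstar0_codiff k eta g : Hstar0 Omega k.+2 eta -> is_codiff Omega k.+2 eta g -> Hstar0 Omega k.+1 g.
Proof.
move=> He cg; apply: (Hstar0_intro cg.1 (is_codiff_smooth_codiff cg)) => e e0.
have [phi tphi h] := Hstar0_approx cg He e0.
exists (cod phi), (fun=> 0); split; first exact: test_form_cod.
  exact: is_codiff_smooth_codiff (is_codiff_cod tphi).
have -> : (fun x : 'rV[R]_n => 0 - 0) = (fun=> 0) :> dform R n by apply/funext => x; rewrite subr0.
by rewrite ip0l// addr0; apply: le_lt_trans h; rewrite lerDr ip_ge0.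
Qed.

End codifferential.

(** [S] is a mere predicate without a spanning family: a matrix of maximal rank among those with row
    space inside [S] has all of [S] as its row space. The conclusion then follows because [cokermx]
    detects membership in a row space. *)
Lemma double_annihilator (F : fieldType) (E : finType) (S : set (E -> F)) (v : E -> F) :
  S (fun=> 0) -> (forall s t, S s -> S t -> S (fun e => s e + t e)) ->
  (forall c s, S s -> S (fun e => c * s e)) ->
  (forall c : E -> F, (forall s, S s -> \sum_e c e * s e = 0) -> \sum_e c e * v e = 0) ->
  S v.
Proof.
move=> S0 SD SZ Sv; set m := #|E|.
pose row_of (s : E -> F) : 'rV[F]_m := \row_j s (enum_val j).
pose fun_of (u : 'rV[F]_m) : E -> F := fun e => u ord0 (enum_rank e).
have row_ofK s : fun_of (row_of s) = s.
  by apply/funext => e; rewrite /fun_of mxE enum_rankK.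
pose inS (A : 'M[F]_m) := forall u : 'rV[F]_m, (u <= A)%MS -> S (fun_of u).
pose P r := `[< exists2 A : 'M[F]_m, inS A & \rank A = r >].
have P0 : exists r, P r.
  exists 0; apply/asboolP; exists 0; last exact: mxrank0.
  move=> u; rewrite submx0 => /eqP ->; congr S: S0.
  by apply/funext => e; rewrite /fun_of mxE.
have Pm r : P r -> (r <= m)%N by move=> /asboolP[A _ <-]; exact: rank_leq_row.
have [r /asboolP[A AS rA] rmax] := ex_maxnP P0 Pm.
have SA s : S s -> (row_of s <= A)%MS.
  move=> Ss; have AsS : inS (A + <<row_of s>>)%MS.
    move=> u /sub_addsmxP[[u1 u2] /= ->].
    have h1 : S (fun_of (u1 *m A)) by apply: AS; exact: submxMl.
    have : (u2 *m <<row_of s>> <= row_of s)%MS by rewrite (submx_trans (submxMl _ _))// genmxE.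
    move=> /sub_rVP[c ->]; have h2 := SZ c _ Ss.
    congr S: (SD _ _ h1 h2); apply/funext => e.
    by rewrite /fun_of !mxE enum_rankK.
  have := rmax _ (asboolT (ex_intro2 _ _ _ AsS erefl)); rewrite -rA.
  move=> rk; have := mxrank_leqif_sup (addsmxSl A <<row_of s>>%MS) => -[_].
  rewrite eqn_leq rk mxrankS ?addsmxSl//= => /esym.
  by rewrite addsmx_sub genmxE => /andP[].
rewrite -(row_ofK v); apply: AS; rewrite submxE; apply/eqP/rowP => j.
(* Each column of [cokermx A] is a functional annihilating [S]. *)
pose c e := cokermx A (enum_rank e) j.
have dot s : \sum_e c e * s e = (row_of s *m cokermx A) ord0 j.
  rewrite mxE (reindex (fun i : 'I_m => enum_val i)) /=; last exact/onW_bij/enum_val_bij.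
  by apply: eq_bigr => i _; rewrite [row_of s _ _]mxE /c enum_valK mulrC.
rewrite -dot Sv ?mxE// => s /SA; rewrite dot submxE => /eqP ->; exact: mxE.
Qed.

(** * Barycentric coordinates *)

Section barycentric.
Variables (R : realType) (n : nat) (v : 'I_n.+1 -> 'rV[R]_n).
Hypotheses (n0 : (0 < n)%N) (hv : affinely_independent v).
Local Notation leb := (@lebesgue_rV R n).

(** Vertices in homogeneous coordinates, the 1 in column 0: affine independence makes this matrix
    invertible, and solving for the extended point gives the sum 1 and the position at once. *)
Let V : 'M[R]_n.+1 := \matrix_(i, j) oapp (v i ord0) 1 (unlift ord0 j).

Let ext (x : 'rV[R]_n) : 'rV[R]_n.+1 := \row_j oapp (x ord0) 1 (unlift ord0 j).

Let V0 (u : 'rV[R]_n.+1) : (u *m V) ord0 ord0 = \sum_i u ord0 i.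
Proof. by rewrite mxE; apply: eq_bigr => i _; rewrite mxE unlift_none mulr1. Qed.

Let VS (u : 'rV[R]_n.+1) j : (u *m V) ord0 (lift ord0 j) = (\sum_i u ord0 i *: v i) ord0 j.
Proof. by rewrite mxE summxE; apply: eq_bigr => i _; rewrite !mxE liftK. Qed.

Let V_unit : V \in unitmx.
Proof.
rewrite -row_free_unit -kermx_eq0; apply/eqP/row_matrixP => i; rewrite row0.
have : row i (kermx V) *m V = 0 by rewrite -row_mul mulmx_ker row0.
move: (row i _) => u uV; apply/rowP => j; rewrite [RHS]mxE.
apply: (hv (c := fun i => u ord0 i)); first by rewrite -V0 uV mxE.
by apply/rowP => l; rewrite -VS uV !mxE.
Qed.

Definition bary (i : 'I_n.+1) (x : 'rV[R]_n) : R := (ext x *m invmx V) ord0 i.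

Lemma bary_sum x : \sum_i bary i x = 1 /\ \sum_i bary i x *: v i = x.
Proof.
have h : ext x *m invmx V *m V = ext x by rewrite -mulmxA mulVmx// mulmx1.
split; first by rewrite -V0 h mxE unlift_none.
by apply/rowP => j; rewrite -VS h mxE liftK.
Qed.

Lemma bary_unique (c : 'I_n.+1 -> R) x : \sum_i c i = 1 -> \sum_i c i *: v i = x ->
  forall i, c i = bary i x.
Proof.
move=> c1 cx i; apply/eqP; rewrite -subr_eq0; apply/eqP.
have [b1 bx] := bary_sum x.
apply: (hv (c := fun i => c i - bary i x)).
  by rewrite sumrB c1 b1 subrr.
by under eq_bigr do rewrite scalerBl; rewrite sumrB cx bx subrr.
Qed.

Lemma bary_vertex i j : bary i (v j) = (i == j)%:R.
Proof.
rewrite -(@bary_unique (fun l => (l == j)%:R))//.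
  by rewrite (bigD1 j)//= eqxx big1 ?addr0// => l /negbTE ->.
by rewrite (bigD1 j)//= eqxx scale1r big1 ?addr0// => l /negbTE ->; rewrite scale0r.
Qed.

Lemma bary_affine i : exists (a : 'I_n -> R) (b : R), forall x, bary i x = \sum_j a j * x ord0 j + b.
Proof.
exists (fun j => invmx V (lift ord0 j) i), (invmx V ord0 i) => x.
rewrite /bary mxE big_ord_recl addrC mxE unlift_none mul1r; congr (_ + _).
by apply: eq_bigr => j _; rewrite mxE liftK mulrC.
Qed.

Lemma bary_continuous i : continuous (bary i).
Proof.
have [a [b h]] := bary_affine i.
rewrite (_ : bary i = fun x => \sum_j a j * x ord0 j + b); last exact/funext.
have c0 (c : R) : continuous (fun _ : 'rV[R]_n => c) by exact: cst_continuous.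
apply: continuous_add; last exact: c0.
elim: (index_enum _) => [|j r IH]; first by under eq_fun do rewrite big_nil; exact: c0.
under eq_fun do rewrite big_cons; apply: continuous_add => //.
by apply: continuous_mul; [exact: c0|exact: coord_rV_continuous].
Qed.

Lemma cellP x : cell v x <-> forall i, 0 <= bary i x.
Proof.
split=> [[c [c0 _ c1 xc]] i|b0]; first by rewrite -(bary_unique c1).
have [b1 bx] := bary_sum x; exists (fun i => bary i x); split=> // i.
by rewrite inE.
Qed.

Lemma bary_gt0_interior x : (forall i, 0 < bary i x) -> (cell v)° x.
Proof.
move=> b0; rewrite /interior.
have : \forall y \near x, forall i, 0 < bary i y.
  apply: (@filter_forall _ _ _ _ (nbhs_filter x)) => i.
  exact: (@cvgr_gt _ _ _ (nbhs_filter x) _ _ (@bary_continuous i x)).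
by apply: filterS => y hy; apply/cellP => i; exact: ltW.
Qed.

(** The coordinate is affine, equal to 1 at its own vertex and to 0 at another one, so its gradient
    is nonzero and its zero set is a null hyperplane. *)
Lemma bary_neq0_ae i : {ae leb, forall x, bary i x <> 0}.
Proof.
have [a [b h]] := bary_affine i.
have bE x : bary i x = 0 <-> \sum_j a j * x ord0 j = - b.
  by rewrite h; split=> [/eqP|->]; [rewrite addr_eq0 => /eqP|rewrite addNr].
exists [set x : 'rV[R]_n | \sum_j a j * x ord0 j = - b]; split.
- exact: measurable_hyperplane.
- apply: hyperplane_null; apply: contrapT => na.
  have a0 j : a j = 0 by apply/eqP; apply: contrapT => aj; apply: na; exists j; exact/negP.
  have bc j : bary i (v j) = b by rewrite h big1 ?add0r// => l _; rewrite a0 mul0r.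
  (* A second vertex exists because n > 0. *)
  have [l il] : exists l, l != i.
    have n2 : (1 < n.+1)%N by [].
    have [i0|] := eqVneq i ord0; last by exists ord0; rewrite eq_sym.
    by exists (Ordinal n2); rewrite i0.
  have := bc l; rewrite -(bc i) !bary_vertex eqxx eq_sym (negbTE il) => /eqP.
  by rewrite eq_sym oner_eq0.
- by move=> x /= /contrapT/bE.
Qed.

Lemma cell_interior_ae : {ae leb, forall x, cell v x -> (cell v)° x}.
Proof.
have : {ae leb, forall x, forall i, bary i x <> 0}.
  by apply: filter_forall => i; exact: bary_neq0_ae.
apply: filterS => x b0 /cellP cx; apply: bary_gt0_interior => i.
by rewrite lt_neqAle cx andbT eq_sym; exact/eqP.
Qed.

End barycentric.

(** * Whitney forms *)

Section whitney_forms.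
Variables (R : realType) (n : nat).
Implicit Types (a b : {ffun {set 'I_n} -> R}) (A B C : {set 'I_n}) (i j : 'I_n) (k : nat).
Local Notation e_ := (basis_vec R).
Local Notation isign := (isign R).
Local Notation ssign := (ssign R).

(** Elements of [P1m] by their two constant coefficients, [b] one degree higher than [a]. The
    derivative of [whitney a b], and the codifferential of its star, depend on [b] only. *)
Definition whitney a b : dform R n := fun x => a + koszul (fun=> b) x.

Definition khom k a := forall A, #|A| != k -> a A = 0.

Lemma P0P k (p : dform R n) : P0 k p <-> exists2 a, khom k a & p = fun=> a.
Proof.
split=> [[hp cp]|[a ha ->]]; last by split=> // x A; exact: ha.
by exists (p 0) => [A /hp //|]; apply/funext => x; exact: cp.
Qed.

Lemma P1mP k (p : dform R n) :
  P1m k p <-> exists a b, [/\ khom k a, khom k.+1 b & p = whitney a b].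
Proof.
split=> [[_ [_ [/P0P[a ha ->] /P0P[b hb ->] ->]]]|[a [b [ha hb ->]]]]; first by exists a, b.
by exists (fun=> a), (fun=> b); split=> //; apply/P0P; [exists a|exists b].
Qed.

Lemma whitneyE a b x A : whitney a b x A =
  a A + \sum_(i | i \notin A) isign i A * x ord0 i * b (i |: A).
Proof. by rewrite ffunD ffunE. Qed.

Lemma whitneyD a b a' b' x : whitney (a + a') (b + b') x = whitney a b x + whitney a' b' x.
Proof.
apply/ffunP => A; rewrite [RHS]ffunD !whitneyE ffunD addrACA; congr (_ + _).
by rewrite -big_split; apply: eq_bigr => i _; rewrite ffunD mulrDr.
Qed.

Lemma whitneyZ c a b x : whitney (c *: a) (c *: b) x = c *: whitney a b x.
Proof.
apply/ffunP => A; rewrite ffunZ !whitneyE ffunZ mulrDr; congr (_ + _).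
by rewrite mulr_sumr; apply: eq_bigr => i _; rewrite ffunZ mulrCA.
Qed.

Lemma whitney0 a x : whitney a 0 x = a.
Proof.
apply/ffunP => A; rewrite whitneyE big1 ?addr0// => i _.
by rewrite ffun0E mulr0.
Qed.

Lemma is_derive_whitney a b A j x :
  is_derive x (e_ j) (fun y => whitney a b y A) (if j \notin A then isign j A * b (j |: A) else 0).
Proof.
have -> : (fun y => whitney a b y A) =
    (fun y : 'rV[R]_n => a A + \sum_(i | i \notin A) (isign i A * b (i |: A)) * y ord0 i).
  by apply/funext => y; rewrite whitneyE; congr (_ + _); apply: eq_bigr => i _; rewrite mulrAC.
have coordD i : is_derive x (e_ j) (fun y : 'rV[R]_n => y ord0 i) (i == j)%:R.
  apply: (@is_derive_line R R _ (fun h => h * (i == j)%:R + x ord0 i) _ 0 1) => [h|].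
    by rewrite addr0 rVD rVZ basis_vecE [_ *: 1]mulr1.
  have := is_derive_add (is_derive_mul (is_derive_id (0:R) (1:R))
     (is_derive_cst ((i == j)%:R : R) (0:R) (1:R))) (is_derive_cst (x ord0 i) (0:R) (1:R)).
  by move/is_derive_eq; apply; rewrite mul0r add0r addr0 mulr1.
have := is_derive_add (is_derive_cst (a A) x (e_ j)) (@is_derive_bigsum R _ _ (index_enum 'I_n)
  (fun i => i \notin A) (fun i (y : 'rV[R]_n) => (isign i A * b (i |: A)) * y ord0 i) x (e_ j) _
  (fun i _ => is_derive_scale (isign i A * b (i |: A)) (coordD i))).
move/is_derive_eq; apply; rewrite add0r.
case: ifPn => jA.
  rewrite (bigD1 j)//= eqxx mulr1 big1 ?addr0// => i /andP[_ /negbTE ->].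
  by rewrite mulr0.
rewrite big1// => i iA; case: eqVneq iA => [->|_ _]; last by rewrite mulr0.
by rewrite (negbTE jA).
Qed.

Lemma Cm_whitney m a b A : Cm m (fun x => whitney a b x A).
Proof.
suff C1 : forall l, Cm l.+1 (fun x => whitney a b x A) by exact: CmW.
move=> l; apply: (Cm_intro _ (fun j x => is_derive_whitney a b A j x)); last by move=> j; exact: Cm_cst.
under eq_fun do rewrite whitneyE.
apply: (@Cm_continuous _ _ 0); apply: CmD; first exact: Cm_cst.
apply: Cm_sum => i _; apply: CmM; last exact: Cm_cst.
by apply: CmZ; split=> //; exact: coord_rV_continuous.
Qed.

(** The homotopy formula d(kappa b) = (k+1) b: each of the k+1 indices of [B] contributes [b B],
    since its sign occurs twice. *)
Lemma ext_d_whitney k a b x : khom k.+1 b -> ext_d (whitney a b) x = k.+1%:R *: b.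
Proof.
move=> hb; apply/ffunP => B; rewrite ffunE ffunZ.
transitivity (\sum_(i in B) b B).
  apply: eq_bigr => i iB; have [_ ->] := is_derive_whitney a b (B :\ i) i x.
  by rewrite !inE eqxx/= finset.setD1K// isignD1_self mulrA isign_sqr mul1r.
rewrite sumr_const; have [<-|/hb ->] := eqVneq #|B| k.+1; first by rewrite mulr_natl.
by rewrite mul0rn mulr0.
Qed.

(** The exponent of [ssign] kept as a natural number, so that sign identities become exact counting
    identities. *)
Definition inversions C : nat := (\sum_(p in C) \sum_(q | q \notin C) (q < p))%N.

Lemma ssign_inversions C : ssign C = (-1) ^+ inversions C.
Proof.
rewrite /Defs.ssign; congr (_ ^+ _).
transitivity #|[pred p : 'I_n * 'I_n | [&& p.1 \in C, p.2 \notin C & (p.2 < p.1)%N]]|.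
  by apply: eq_card => p; apply/idP/idP; rewrite !inE.
rewrite -sum1_card /inversions pair_big_dep/= big_mkcond/= [RHS]big_mkcond/=.
apply: eq_bigr => -[p q] _ /=; rewrite inE/=.
by case: (p \in C); case: (q \in C); case: ltnP.
Qed.

Lemma card_lt_sum i (P : pred 'I_n) :
  #|[pred j : 'I_n | P j && (j < i)%N]| = (\sum_(j | P j) (j < i))%N.
Proof.
rewrite -sum1_card [RHS]big_mkcond/= big_mkcond; apply: eq_bigr => j _.
by rewrite inE; case: (P j); case: ltnP.
Qed.

(** Removing [i] loses the inversions headed by [i] and creates one for each larger element of [C];
    adding the smaller elements of [C] completes the count |C| - 1. *)
Lemma inversionsD1 i C : i \in C ->
  (inversions (C :\ i) + \sum_(q | q \notin C) (q < i) + \sum_(j in C) (j < i) =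
   inversions C + #|C|.-1)%N.
Proof.
move=> iC.
have E : (inversions (C :\ i) = \sum_(p in C :\ i) \sum_(q | q \notin C) (q < p) + \sum_(p in C :\ i) (i < p))%N.
  rewrite /inversions -big_split; apply: eq_bigr => p pC /=.
  rewrite (bigD1 i) ?inE ?eqxx//= addnC; congr addn.
  by apply: eq_bigl => q; rewrite !inE; case: eqVneq => [->|]; rewrite ?iC//= andbT.
have EC : (inversions C = \sum_(q | q \notin C) (q < i) + \sum_(p in C :\ i) \sum_(q | q \notin C) (q < p))%N.
  rewrite /inversions (bigD1 i)//=; congr addn.
  by apply: eq_bigl => p; rewrite !inE andbC.
have ltC : (\sum_(j in C) (j < i) = \sum_(p in C :\ i) (p < i))%N.
  rewrite (bigD1 i)//= ltnn add0n; apply: eq_bigl => p; by rewrite !inE andbC.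
have tot : (\sum_(p in C :\ i) (i < p) + \sum_(p in C :\ i) (p < i) = #|C|.-1)%N.
  rewrite -big_split/= (cardsD1 i C) iC add1n/= -sum1_card; apply: eq_bigr => p.
  by rewrite !inE -val_eqE/= => /andP[+ _]; case: ltngtP.
by rewrite E EC ltC -tot; lia.
Qed.

Lemma ssignD1 i C : i \in C ->
  isign i (~: C) * ssign (C :\ i) * isign i C = (-1) ^+ #|C|.-1 * ssign C.
Proof.
move=> iC; rewrite !ssign_inversions /Defs.isign.
rewrite -!exprD; rewrite [in RHS]addnC -(inversionsD1 iC).
rewrite (addnC _ (inversions _)); congr (_ ^+ (_ + _ + _))%N.
  by rewrite -card_lt_sum; apply: eq_card => j; rewrite !inE.
by rewrite -card_lt_sum; apply: eq_card => j; rewrite !inE.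
Qed.

(** For [b] of degree m this is (-1)^m m times the star of [b], the counterpart for [P1sm] of
    d(kappa b) = m b. *)
Definition cod_const b : {ffun {set 'I_n} -> R} := [ffun A : {set 'I_n} =>
  - (#|~: A|%:R * ((-1) ^+ #|~: A|.-1 * ssign (~: A)) * b (~: A))].

Lemma cod_hodge_whitney a b x : cod (hodge (whitney a b)) x = cod_const b.
Proof.
apply/ffunP => A; rewrite !ffunE; congr (- _).
transitivity (\sum_(i in ~: A) ((-1) ^+ #|~: A|.-1 * ssign (~: A)) * b (~: A)); last first.
  by rewrite sumr_const -[LHS]mulr_natl !mulrA.
apply: eq_big => [i|i iA]; first by rewrite !inE.
have iC : i \in ~: A by rewrite inE.
have CE : ~: (i |: A) = ~: A :\ i.
  by apply/setP => j; rewrite !inE negb_or.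
have := is_derive_scale (ssign (~: A :\ i)) (is_derive_whitney a b (~: A :\ i) i x).
have -> : (fun y => hodge (whitney a b) y (i |: A)) = (fun y => ssign (~: A :\ i) * whitney a b y (~: A :\ i)).
  by apply/funext => y; rewrite ffunE CE.
case=> _ ->; rewrite !inE eqxx/= finset.setD1K//.
have := ssignD1 iC; rewrite finset.setCK => <-.
by rewrite isignD1_self !mulrA.
Qed.

Lemma cod_const_eq0 k b : khom k.+1 b -> cod_const b = 0 -> b = 0.
Proof.
move=> hb /ffunP b0; apply/ffunP => C; rewrite ffun0E.
have [kC|/hb//] := eqVneq #|C| k.+1.
have := b0 (~: C); rewrite ffunE ffun0E finset.setCK kC => /eqP.
rewrite oppr_eq0 !mulf_eq0 /Defs.ssign !signr_eq0 pnatr_eq0/= => /eqP; exact.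
Qed.

Lemma card_setC_n A k : (k <= n)%N -> (#|~: A| == n - k)%N = (#|A| == k).
Proof.
move=> kn; rewrite cardsCs finset.setCK card_ord.
have An : (#|A| <= n)%N by rewrite -[X in (_ <= X)%N]card_ord max_card.
by apply/eqP/eqP; lia.
Qed.

Lemma P1smP k (p : dform R n) : (k <= n)%N -> P1sm k p ->
  exists a b, [/\ khom (n - k) a, khom (n - k).+1 b & p = hodge (whitney a b)].
Proof. by move=> kn [q /P1mP[a [b [ha hb ->]]] <-]; exists a, b. Qed.

Lemma homog_P1sm k (p : dform R n) : (k <= n)%N -> P1sm k p -> homog k p.
Proof.
move=> kn /(P1smP kn)[a [b [ha hb ->]]] x A kA; rewrite ffunE whitneyE ha ?card_setC_n//.
rewrite add0r big1 ?mulr0// => i iA; rewrite hb ?mulr0//.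
by rewrite cardsU1 iA eqSS card_setC_n.
Qed.

Lemma homog_P1m k (p : dform R n) : P1m k p -> homog k p.
Proof.
move=> /P1mP[a [b [ha hb ->]]] x A kA; rewrite whitneyE ha// add0r big1// => i iA.
by rewrite hb ?mulr0// cardsU1 iA eqSS.
Qed.

Lemma P0_P1m k (p : dform R n) : P0 k p -> P1m k p.
Proof.
move=> /P0P[a ha ->]; apply/P1mP; exists a, 0; split=> //.
  by move=> A _; rewrite ffun0E.
by apply/funext => x; rewrite whitney0.
Qed.

Lemma hodge_const_onto k a : (k <= n)%N -> khom k a ->
  exists2 a', khom (n - k) a' & hodge (fun _ : 'rV[R]_n => a') = fun=> a.
Proof.
move=> kn ha; exists [ffun B : {set 'I_n} => ssign B * a (~: B)].
  move=> A kA; rewrite ffunE ha ?mulr0//.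
  by apply: contra kA; rewrite -(card_setC_n _ kn) finset.setCK.
apply/funext => x; apply/ffunP => B; rewrite !ffunE finset.setCK mulrA -expr2 /Defs.ssign sqrr_sign.
exact: mul1r.
Qed.

Lemma P0_P1sm k (p : dform R n) : (k <= n)%N -> P0 k p -> P1sm k p.
Proof.
move=> kn /P0P[a ha ->]; have [a' ha' <-] := hodge_const_onto kn ha.
by exists (fun=> a') => //; apply: P0_P1m; apply/P0P; exists a'.
Qed.

End whitney_forms.

(** The geometry in the form used by the discrete theory: disjoint open cells covering a bounded
    open set up to a null set. *)
Record mesh (R : realType) (n : nat) (Omega : set 'rV[R]_n) (N : nat)
    (G : 'I_N -> 'I_n.+1 -> 'rV[R]_n) : Prop := {
  mesh_open : open Omega;
  mesh_finite : (@lebesgue_rV R n Omega < +oo)%E;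
  mesh_bounded : exists M, Omega `<=` cube M;
  mesh_sub : forall T, (cell (G T))° `<=` Omega;
  mesh_disjoint : forall S T, S != T -> (cell (G S))° `&` (cell (G T))° = set0;
  mesh_cover : {ae @lebesgue_rV R n, forall x, Omega x -> exists T, (cell (G T))° x} }.

(** * Piecewise forms *)

Section mesh.
Variables (R : realType) (n : nat) (Omega : set 'rV[R]_n).
Variables (N : nat) (G : 'I_N -> 'I_n.+1 -> 'rV[R]_n).
Hypothesis hm : mesh Omega G.

Let oO := mesh_open hm.
Let fO := mesh_finite hm.
Let bO := mesh_bounded hm.
Let Gdisj := mesh_disjoint hm.
Let Gae := mesh_cover hm.

Local Notation leb := (@lebesgue_rV R n).
Local Notation form := {ffun {set 'I_n} -> R}.
Implicit Types (w g eta mu tau : dform R n) (T S : 'I_N) (k : nat) (p q : 'I_N -> dform R n)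
  (a b : 'I_N -> form).

Let mO : measurable Omega. Proof. exact: open_measurable_rV. Qed.

Definition ocell T : set 'rV[R]_n := (cell (G T))°.
Local Notation oc := ocell.

Lemma ocell_open T : open (oc T).
Proof. exact: open_interior. Qed.

Lemma ocell_inj S T x : oc S x -> oc T x -> S = T.
Proof.
move=> Sx Tx; apply/eqP; apply: contraPT (I) => ST.
by have := Gdisj ST; rewrite -subset0 => /(_ x); rewrite /setI/= => /(_ (conj Sx Tx)).
Qed.

Definition on_cells w p : Prop := forall T x, oc T x -> w x = p T x.

(** A sum over cells, so that linear operations pass through termwise. Open cells are disjoint,
    hence at most one term survives; off the open cells the value is 0, the convention also made in
    [dh]. *)
Definition pcw p : dform R n := fun x => \sum_T (if `[< oc T x >] then p T x else 0).

Lemma pcw_on_cells p : on_cells (pcw p) p.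
Proof.
move=> T x Tx; rewrite /pcw (bigD1 T)//= asboolT// big1 ?addr0// => S ST.
by case: asboolP => // Sx; move: ST; rewrite (ocell_inj Sx Tx) eqxx.
Qed.

Lemma pcw_out p x : ~ (exists T, oc T x) -> pcw p x = 0.
Proof. by move=> nx; rewrite /pcw big1// => T _; case: asboolP => // Tx; case: nx; exists T. Qed.

Lemma pcw_L2 p : (forall T A, continuous (fun x => p T x A)) -> L2 Omega (pcw p).
Proof.
move=> cp; have [M OM] := bO.
have cub : compact (@cube R n M).
  have -> : @cube R n M = cbox (fun=> - M) (fun=> M); last exact: cbox_compact.
  by apply/seteqP; split=> x h i; have := h i; rewrite ler_norml.
have bd T A : exists C, forall x, cube M x -> `|p T x A| <= C.
  have /compact_bounded[C [_ hC]] : compact ((fun x => p T x A) @` @cube R n M).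
    by apply: continuous_compact => //; exact: continuous_subspaceT.
  exists (`|C| + 1) => x Kx; apply: hC; last by exists x.
  by rewrite (le_lt_trans (ler_norm C))// ltrDl.
have pE A x : pcw p x A = \sum_T ((fun x => p T x A) \_ (oc T)) x.
  rewrite /pcw sum_ffunE; apply: eq_bigr => T _; rewrite patchE.
  case: asboolP => Tx; first by rewrite mem_set.
  by rewrite memNset// ffun0E.
move=> A.
have mA : measurable_fun Omega (fun x => pcw p x A).
  apply: (eq_measurable_fun (fun x => \sum_T ((fun x => p T x A) \_ (oc T)) x)).
    by move=> x _; rewrite pE.
  apply: measurable_sum => T; apply/measurable_restrict => //.
    by apply: open_measurable_rV; exact: ocell_open.
  apply: measurable_funTS; apply: continuous_measurable_rV; exact: cp.
split=> //; apply: measurable_bounded_integrable => //; first exact: measurable_funX.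
pose C T := sval (cid (bd T A)).
have hC T x : cube M x -> `|p T x A| <= C T by exact: (svalP (cid (bd T A))).
have C0 T : Omega !=set0 -> 0 <= C T.
  by move=> [x /OM Mx]; exact: le_trans (normr_ge0 _) (hC T x Mx).
exists ((\sum_T C T) ^+ 2); split=> [|y My x Ox]; rewrite ?num_real//= (le_trans _ (ltW My))//.
have OT : Omega !=set0 by exists x.
rewrite normrX lerXn2r// ?nnegrE ?sumr_ge0//; first by move=> T _; exact: C0.
rewrite pE (le_trans (ler_norm_sum _ _ _))//; apply: ler_sum => T _.
by rewrite patchE; case: ifP => _; rewrite ?normr0 ?C0//; apply: hC; exact: OM.
Qed.

Lemma pcw_homog k p : (forall T, homog k (p T)) -> homog k (pcw p).
Proof.
move=> hp x A kA; rewrite /pcw sum_ffunE big1// => T _.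
by case: asboolP => _; rewrite ?hp ?ffun0E.
Qed.

Lemma piecewise_pcw k (V : set (dform R n)) p : (forall T, V (p T)) -> (forall T, homog k (p T)) ->
  (forall T A, continuous (fun x => p T x A)) -> piecewise Omega G k V (pcw p).
Proof.
move=> Vp hp cp; split; first by split; [exact: pcw_homog|exact: pcw_L2].
by move=> T; exists (p T) => // x; exact: pcw_on_cells.
Qed.

Lemma piecewiseP k (V : set (dform R n)) w : piecewise Omega G k V w ->
  exists2 p, (forall T, V (p T)) & on_cells w p.
Proof.
move=> [_ Vw].
have h T : {p | V p & forall x, oc T x -> w x = p x} by apply: cid2; exact: Vw.
exists (fun T => s2val (h T)) => [T|T x Tx]; first exact: (s2valP (h T)).
exact: (s2valP' (h T)).
Qed.

Lemma P0hP k w : P0h Omega G k w -> exists2 a, (forall T, khom k (a T)) & on_cells w (fun T => fun=> a T).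
Proof.
move=> /piecewiseP[p Vp wp].
have h T : {a | khom k a & p T = fun=> a} by apply: cid2; apply/P0P; exact: Vp.
exists (fun T => s2val (h T)) => [T|T x Tx]; first exact: (s2valP (h T)).
by rewrite (wp T)// [in LHS](s2valP' (h T)).
Qed.

Lemma P1mhP k w : P1mh Omega G k w -> exists a b,
  [/\ forall T, khom k (a T), forall T, khom k.+1 (b T) & on_cells w (fun T => whitney (a T) (b T))].
Proof.
move=> /piecewiseP[p Vp wp].
have h T : {ab : form * form | [/\ khom k ab.1, khom k.+1 ab.2 & p T = whitney ab.1 ab.2]}.
  by apply: cid; have /P1mP[a [b h]] := Vp T; exists (a, b).
exists (fun T => (sval (h T)).1), (fun T => (sval (h T)).2); split=> [T|T|T x Tx].
- by have [] := svalP (h T).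
- by have [] := svalP (h T).
by rewrite (wp T)//; have [_ _ <-] := svalP (h T).
Qed.

Lemma P1smhP k w : (k <= n)%N -> P1smh Omega G k w -> exists a b,
  [/\ forall T, khom (n - k) (a T), forall T, khom (n - k).+1 (b T) &
      on_cells w (fun T => hodge (whitney (a T) (b T)))].
Proof.
move=> kn /piecewiseP[p Vp wp].
have h T : {ab : form * form | [/\ khom (n - k) ab.1, khom (n - k).+1 ab.2 & p T = hodge (whitney ab.1 ab.2)]}.
  by apply: cid; have /(P1smP kn)[a [b h]] := Vp T; exists (a, b).
exists (fun T => (sval (h T)).1), (fun T => (sval (h T)).2); split=> [T|T|T x Tx].
- by have [] := svalP (h T).
- by have [] := svalP (h T).
by rewrite (wp T)//; have [_ _ <-] := svalP (h T).
Qed.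

Lemma P0h_intro k a : (forall T, khom k (a T)) -> P0h Omega G k (pcw (fun T => fun=> a T)).
Proof.
move=> ha; apply: piecewise_pcw => [T|T x A|T A]; last exact: cst_continuous.
  by apply/P0P; exists (a T).
exact: ha.
Qed.

Lemma P1mh_intro k a b : (forall T, khom k (a T)) -> (forall T, khom k.+1 (b T)) ->
  P1mh Omega G k (pcw (fun T => whitney (a T) (b T))).
Proof.
move=> ha hb.
have Vw T : P1m k (whitney (a T) (b T)) by apply/P1mP; exists (a T), (b T).
apply: piecewise_pcw => // [T|T A]; first exact: homog_P1m.
exact: Cm_continuous (Cm_whitney 0 _ _ _).
Qed.

Lemma P0h_L2form k w : P0h Omega G k w -> L2form Omega k w. Proof. by case. Qed.
Lemma P1mh_L2form k w : P1mh Omega G k w -> L2form Omega k w. Proof. by case. Qed.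
Lemma P1smh_L2form k w : P1smh Omega G k w -> L2form Omega k w. Proof. by case. Qed.

Lemma P0h_P1mh k w : P0h Omega G k w -> P1mh Omega G k w.
Proof.
move=> [Lw Vw]; split=> // T; have [p Vp wp] := Vw T.
by exists p => //; exact: P0_P1m.
Qed.

Lemma P0h_P1smh k w : (k <= n)%N -> P0h Omega G k w -> P1smh Omega G k w.
Proof.
move=> kn [Lw Vw]; split=> // T; have [p Vp wp] := Vw T.
by exists p => //; exact: P0_P1sm.
Qed.

Lemma piecewiseD k (V : set (dform R n)) w w' :
  (forall p q : dform R n, V p -> V q -> V (fun x => p x + q x)) ->
  piecewise Omega G k V w -> piecewise Omega G k V w' ->
  piecewise Omega G k V (fun x => w x + w' x).
Proof.
move=> VD [Lw Vw] [Lw' Vw']; split; first exact: L2formD.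
move=> T; have [p Vp wp] := Vw T; have [p' Vp' wp'] := Vw' T.
by exists (fun x => p x + p' x); [exact: VD|move=> x Tx; rewrite wp// wp'].
Qed.

Lemma piecewiseZ k (V : set (dform R n)) (c : R) w :
  (forall p : dform R n, V p -> V (fun x => c *: p x)) ->
  piecewise Omega G k V w -> piecewise Omega G k V (fun x => c *: w x).
Proof.
move=> VZ [Lw Vw]; split; first exact: L2formZ.
move=> T; have [p Vp wp] := Vw T.
by exists (fun x => c *: p x); [exact: VZ|move=> x Tx; rewrite wp].
Qed.

Lemma khomD k (f f' : form) : khom k f -> khom k f' -> khom k (f + f').
Proof. by move=> hf hf' A kA; rewrite ffunD hf// hf'// addr0. Qed.

Lemma khomZ k (c : R) (f : form) : khom k f -> khom k (c *: f).
Proof. by move=> hf A kA; rewrite ffunZ hf// mulr0. Qed.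

Lemma P0_D k (p q : dform R n) : P0 k p -> P0 k q -> P0 k (fun x => p x + q x).
Proof. by move=> /P0P[f hf ->] /P0P[f' hf' ->]; apply/P0P; exists (f + f') => //; exact: khomD. Qed.

Lemma P0_Z k (c : R) (p : dform R n) : P0 k p -> P0 k (fun x => c *: p x).
Proof. by move=> /P0P[f hf ->]; apply/P0P; exists (c *: f) => //; exact: khomZ. Qed.

Lemma P1m_D k (p q : dform R n) : P1m k p -> P1m k q -> P1m k (fun x => p x + q x).
Proof.
move=> /P1mP[f [g [hf hg ->]]] /P1mP[f' [g' [hf' hg' ->]]]; apply/P1mP.
exists (f + f'), (g + g'); split; try exact: khomD.
by apply/funext => x; rewrite whitneyD.
Qed.

Lemma P1m_Z k (c : R) (p : dform R n) : P1m k p -> P1m k (fun x => c *: p x).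
Proof.
move=> /P1mP[f [g [hf hg ->]]]; apply/P1mP.
exists (c *: f), (c *: g); split; try exact: khomZ.
by apply/funext => x; rewrite whitneyZ.
Qed.

Lemma hodgeD (p q : dform R n) x : hodge (fun x => p x + q x) x = hodge p x + hodge q x.
Proof. by apply/ffunP => A; rewrite !ffunE mulrDr. Qed.

Lemma hodgeZ (c : R) (p : dform R n) x : hodge (fun x => c *: p x) x = c *: hodge p x.
Proof. by apply/ffunP => A; rewrite !ffunE [LHS]mulrCA. Qed.

Lemma P1sm_D k (p q : dform R n) : P1sm k p -> P1sm k q -> P1sm k (fun x => p x + q x).
Proof.
move=> [p' Vp' <-] [q' Vq' <-]; exists (fun x => p' x + q' x); first exact: P1m_D.
by apply/funext => x; rewrite hodgeD.
Qed.

Lemma P1sm_Z k (c : R) (p : dform R n) : P1sm k p -> P1sm k (fun x => c *: p x).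
Proof.
move=> [p' Vp' <-]; exists (fun x => c *: p' x); first exact: P1m_Z.
by apply/funext => x; rewrite hodgeZ.
Qed.

Lemma P0hD k w w' : P0h Omega G k w -> P0h Omega G k w' -> P0h Omega G k (fun x => w x + w' x).
Proof. by apply: piecewiseD; exact: P0_D. Qed.

Lemma P0hZ k (c : R) w : P0h Omega G k w -> P0h Omega G k (fun x => c *: w x).
Proof. by apply: piecewiseZ; exact: P0_Z. Qed.

Lemma P0hB k w w' : P0h Omega G k w -> P0h Omega G k w' -> P0h Omega G k (fun x => w x - w' x).
Proof. by move=> Hw Hw'; rewrite (subE_scale w w'); exact: (P0hD Hw (P0hZ (-1) Hw')). Qed.

Lemma P1mhD k w w' : P1mh Omega G k w -> P1mh Omega G k w' -> P1mh Omega G k (fun x => w x + w' x).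
Proof. by apply: piecewiseD; exact: P1m_D. Qed.

Lemma P1mhZ k (c : R) w : P1mh Omega G k w -> P1mh Omega G k (fun x => c *: w x).
Proof. by apply: piecewiseZ; exact: P1m_Z. Qed.

Lemma P1smhD k w w' : P1smh Omega G k w -> P1smh Omega G k w' -> P1smh Omega G k (fun x => w x + w' x).
Proof. by apply: piecewiseD; exact: P1sm_D. Qed.

Lemma P1smhZ k (c : R) w : P1smh Omega G k w -> P1smh Omega G k (fun x => c *: w x).
Proof. by apply: piecewiseZ; exact: P1sm_Z. Qed.

Lemma P1smhB k w w' : P1smh Omega G k w -> P1smh Omega G k w' -> P1smh Omega G k (fun x => w x - w' x).
Proof. by move=> Hw Hw'; rewrite (subE_scale w w'); exact: (P1smhD Hw (P1smhZ (-1) Hw')). Qed.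

(** An equality everywhere: in an open cell the derivative depends only on the germ, and elsewhere
    both sides are 0 by convention. *)
Lemma dh_on_cells k w a b : (forall T, khom k.+1 (b T)) -> on_cells w (fun T => whitney (a T) (b T)) ->
  dh G w = pcw (fun T => fun=> k.+1%:R *: b T).
Proof.
move=> hb wab; apply/funext => x; rewrite /dh; case: asboolP => [[T Tx]|nx]; last by rewrite pcw_out.
rewrite (pcw_on_cells _ Tx) -(@ext_d_whitney _ _ k (a T) (b T) x (hb T)).
apply/ffunP => B; rewrite !ffunE; apply: eq_bigr => i _; congr (_ * _).
apply: near_eq_derive.
have : nbhs x (oc T) by apply: open_nbhs_nbhs; split=> //; exact: ocell_open.
by apply: filterS => y Ty; rewrite (wab T).
Qed.

Lemma dh_P0h k w : P1mh Omega G k w -> P0h Omega G k.+1 (dh G w).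
Proof.
move=> /P1mhP[a [b [ha hb wab]]]; rewrite (dh_on_cells hb wab).
by apply: P0h_intro => T; exact: khomZ.
Qed.

Lemma dhD k w w' : P1mh Omega G k w -> P1mh Omega G k w' ->
  dh G (fun x => w x + w' x) = (fun x => dh G w x + dh G w' x).
Proof.
move=> /P1mhP[a [b [ha hb wab]]] /P1mhP[a' [b' [ha' hb' wab']]].
rewrite (dh_on_cells hb wab) (dh_on_cells hb' wab').
rewrite (@dh_on_cells k _ (fun T => a T + a' T) (fun T => b T + b' T)).
- apply/funext => x; rewrite /pcw -big_split; apply: eq_bigr => T _ /=.
  by case: asboolP => _; rewrite ?addr0// scalerDr.
- by move=> T; exact: khomD.
- by move=> T x Tx; rewrite whitneyD (wab T)// (wab' T).
Qed.

Lemma dhZ k (c : R) w : P1mh Omega G k w -> dh G (fun x => c *: w x) = (fun x => c *: dh G w x).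
Proof.
move=> /P1mhP[a [b [ha hb wab]]]; rewrite (dh_on_cells hb wab).
rewrite (@dh_on_cells k _ (fun T => c *: a T) (fun T => c *: b T)).
- apply/funext => x; rewrite /pcw scaler_sumr; apply: eq_bigr => T _ /=.
  by case: asboolP => _; rewrite ?scaler0// scalerA mulrC -scalerA.
- by move=> T; exact: khomZ.
- by move=> T x Tx; rewrite whitneyZ (wab T).
Qed.

Lemma dh_P0h_eq0 k w : P0h Omega G k w -> dh G w = fun=> 0.
Proof.
move=> /P0hP[a ha wa]; rewrite (@dh_on_cells k w a (fun=> 0)).
- by apply/funext => x; rewrite /pcw big1// => T _; rewrite scaler0 if_same.
- by move=> T A _; rewrite ffun0E.
- by move=> T x Tx; rewrite whitney0; exact: wa.
Qed.

(* Constancy holds only almost everywhere here, which saves proving that every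
   cell has positive measure. *)
Lemma dh_eq0_P0h k w : P1mh Omega G k w -> feq Omega (dh G w) (fun=> 0) ->
  exists2 w0, P0h Omega G k w0 & feq Omega w w0.
Proof.
move=> /P1mhP[a [b [ha hb wab]]]; rewrite (dh_on_cells hb wab) => d0.
exists (pcw (fun T => fun=> a T)); first exact: P0h_intro.
move: Gae d0; apply: filterS2 => x hx dx Ox; have [T Tx] := hx Ox.
have := dx Ox; rewrite !(pcw_on_cells _ Tx) (wab T)// => /eqP.
by rewrite scaler_eq0 pnatr_eq0/= => /eqP ->; rewrite whitney0.
Qed.

End mesh.

(** * Finite spanning families, the projection [Ph], cellwise codifferentials *)

Section discrete.
Variables (R : realType) (n : nat) (Omega : set 'rV[R]_n).
Variables (N : nat) (G : 'I_N -> 'I_n.+1 -> 'rV[R]_n).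
Hypothesis hm : mesh Omega G.

Let oO := mesh_open hm.
Let fO := mesh_finite hm.
Let Gae := mesh_cover hm.
Let mO : measurable Omega. Proof. exact: open_measurable_rV. Qed.

Local Notation leb := (@lebesgue_rV R n).
Local Notation form := {ffun {set 'I_n} -> R}.
Local Notation oc := (ocell G).
Local Notation ip := (ip Omega).
Local Notation feq := (feq Omega).
Implicit Types (w g eta mu tau zeta : dform R n) (T S : 'I_N) (k : nat)
  (a b : 'I_N -> form).

Definition comb (E : finType) (om : E -> dform R n) (c : E -> R) : dform R n :=
  fun x => \sum_e c e *: om e x.

(** Agreement is asked on open cells only, the values of a discrete form on interfaces being
    arbitrary. *)
Definition spans (V : set (dform R n)) (E : finType) (om : E -> dform R n) : Prop :=
  (forall e, V (om e)) /\ forall w, V w -> exists c, forall T x, oc T x -> w x = comb om c x.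

(** [L] is linear only on [V], so the membership of partial sums and the expansion of [L] are proved
    together. *)
Lemma sum_linear (E : finType) (V : set (dform R n)) (om : E -> dform R n) (L : dform R n -> R) (c : E -> R) :
  V (fun=> 0) -> (forall w w', V w -> V w' -> V (fun x => w x + w' x)) ->
  (forall d w, V w -> V (fun x => d *: w x)) ->
  L (fun=> 0) = 0 -> (forall w w', V w -> V w' -> L (fun x => w x + w' x) = L w + L w') ->
  (forall d w, V w -> L (fun x => d *: w x) = d * L w) ->
  (forall e, V (om e)) -> V (comb om c) /\ L (comb om c) = \sum_e c e * L (om e).
Proof.
move=> V0 VD VZ L0 LD LZ Vom; rewrite /comb; elim: (index_enum E) => [|e r [IH1 IH2]].
  by rewrite big_nil; under [X in V X]eq_fun do rewrite big_nil; under [X in L X]eq_fun do rewrite big_nil.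
rewrite big_cons; under [X in V X]eq_fun do rewrite big_cons.
under [X in L X]eq_fun do rewrite big_cons.
have Ve := VZ (c e) _ (Vom e).
by split; [exact: VD|rewrite (LD _ _ Ve IH1) IH2 (LZ _ _ (Vom e))].
Qed.

(** If the subset in the index does not have size [k] the entry is the zero form; the index type is
    thus the same in every degree. *)
Definition unit_form k (e : 'I_N * {set 'I_n}) T : form :=
  [ffun B => ((T == e.1) && (B == e.2) && (#|e.2| == k))%:R].

Lemma khom_unit_form k e T : khom k (unit_form k e T).
Proof.
move=> A kA; rewrite ffunE; case: (eqVneq A e.2) => [AE|_]; last by rewrite andbF.
by rewrite -AE (negbTE kA) andbF.
Qed.

Lemma unit_form_decomp k a T : (forall T, khom k (a T)) ->
  a T = \sum_e a e.1 e.2 *: unit_form k e T.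
Proof.
move=> ha; apply/ffunP => B; rewrite sum_ffunE (bigD1 (T, B))//= big1 ?addr0.
  rewrite ffunZ ffunE !eqxx/=; have [kB|/ha ->] := eqVneq #|B| k; first by rewrite mulr1.
  by rewrite mul0r.
move=> [S A] /= SA; rewrite ffunZ ffunE/=; case: (eqVneq T S) => [TS|_]; last by rewrite mulr0.
case: (eqVneq B A) => [BA|_]; last by rewrite mulr0.
by move: SA; rewrite TS BA eqxx.
Qed.

Lemma P0h_finite_dim k : exists (E : finType) (om : E -> dform R n), spans (P0h Omega G k) om.
Proof.
exists _, (fun e => pcw G (fun T => fun=> unit_form k e T)); split=> [e|w /P0hP[a ha wa]].
  by apply: (P0h_intro hm) => T; exact: khom_unit_form.
exists (fun e => a e.1 e.2) => T x Tx; rewrite (wa T)// [LHS](unit_form_decomp T ha).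
by apply: eq_bigr => e _; rewrite (pcw_on_cells hm _ Tx).
Qed.

Lemma whitney_sum (E : finType) (c : E -> R) (f f' : E -> form) x :
  whitney (\sum_e c e *: f e) (\sum_e c e *: f' e) x = \sum_e c e *: whitney (f e) (f' e) x.
Proof.
elim: (index_enum E) => [|e r IH]; first by rewrite !big_nil whitney0.
by rewrite !big_cons whitneyD whitneyZ IH.
Qed.

Lemma P1mh_finite_dim k : exists (E : finType) (om : E -> dform R n), spans (P1mh Omega G k) om.
Proof.
exists (('I_N * {set 'I_n}) + ('I_N * {set 'I_n}))%type, (fun e => match e with
  | inl e => pcw G (fun T => whitney (unit_form k e T) 0)
  | inr e => pcw G (fun T => whitney 0 (unit_form k.+1 e T)) end).
have h0 j : khom j (0 : form) by move=> A _; rewrite ffun0E.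
split=> [[e|e]|w /P1mhP[a [b [ha hb wab]]]].
- by apply: (P1mh_intro hm (a := unit_form k e) (b := fun=> 0)) => // T; exact: khom_unit_form.
- by apply: (P1mh_intro hm (a := fun=> 0) (b := unit_form k.+1 e)) => // T; exact: khom_unit_form.
exists (fun e => match e with inl e => a e.1 e.2 | inr e => b e.1 e.2 end) => T x Tx.
rewrite (wab T)// /comb big_sumType/=.
rewrite (unit_form_decomp T ha) (unit_form_decomp T hb).
rewrite -[X in whitney X _]addr0 -[X in whitney _ X]add0r whitneyD; congr (_ + _).
  rewrite -[X in whitney _ X](_ : \sum_e a e.1 e.2 *: 0 = 0); last by rewrite big1// => e _; rewrite scaler0.
  by rewrite whitney_sum; apply: eq_bigr => e _; rewrite (pcw_on_cells hm _ Tx).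
rewrite -[X in whitney X _](_ : \sum_e b e.1 e.2 *: 0 = 0); last by rewrite big1// => e _; rewrite scaler0.
by rewrite whitney_sum; apply: eq_bigr => e _; rewrite (pcw_on_cells hm _ Tx).
Qed.

Lemma on_cells_eq_feq w w' : (forall T x, oc T x -> w x = w' x) -> feq w w'.
Proof. by move=> ww'; move: Gae; apply: filterS => x h /h[T Tx]; exact: (ww' T). Qed.

Lemma P0h0 k : P0h Omega G k (fun=> 0).
Proof.
split; first exact: L2form0.
by move=> T; exists (fun=> 0) => //; apply/P0P; exists 0 => // A _; rewrite ffun0E.
Qed.

Lemma P1mh0 k : P1mh Omega G k (fun=> 0).
Proof. exact: P0h_P1mh (P0h0 k). Qed.

(** Solvability of the Gram system by the double annihilator theorem: coefficients that annihilate
    its range give a combination of norm zero, and so annihilate the right-hand side as well. *)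
Lemma Ph_exists k w : L2 Omega w ->
  exists g, P0h Omega G k g /\ forall v, P0h Omega G k v -> ip (fun x => w x - g x) v = 0.
Proof.
move=> Lw; have [E [om [Vom spn]]] := P0h_finite_dim k.
have PL g : P0h Omega G k g -> L2 Omega g by move=> /P0h_L2form/L2form_L2.
have Lom e : L2 Omega (om e) := PL _ (Vom e).
have lin g c : L2 Omega g -> P0h Omega G k (comb om c) /\ ip (comb om c) g = \sum_e c e * ip (om e) g.
  move=> Lg; apply: (sum_linear (V := P0h Omega G k) (L := ip ^~ g)) => //.
  - exact: P0h0.
  - by move=> *; exact: P0hD.
  - by move=> *; exact: P0hZ.
  - by rewrite ip0l//.
  - by move=> w1 w2 /PL ? /PL ?; rewrite ipDl.
  - by move=> d w1 /PL ?; rewrite ipZl.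
pose Sg (s : _ -> R) := exists2 g, P0h Omega G k g & forall e, s e = ip (om e) g.
have [|||c h|g Vg hg] := @double_annihilator _ _ Sg (fun e => ip (om e) w).
- by exists (fun=> 0); [exact: (P0h0 k)|move=> e; rewrite ip0r//].
- move=> s t [g Vg hs] [g' Vg' ht]; exists (fun x => g x + g' x); first exact: P0hD.
  by move=> e; have Lg := PL _ Vg; have Lg' := PL _ Vg'; rewrite hs ht ipDr.
- move=> c s [g Vg hs]; exists (fun x => c *: g x); first exact: P0hZ.
  by move=> e; have Lg := PL _ Vg; rewrite hs ipZr.
- have [Vc _] := lin w c Lw; have Lc := PL _ Vc.
  have cc : ip (comb om c) (comb om c) = 0.
    by rewrite (lin _ c Lc).2; apply: h; exists (comb om c).
  have c0 := ip_eq0 mO Lc cc.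
  rewrite -(lin w c Lw).2 (ip_feq mO Lc (L2_0 _) Lw Lw c0 (feq_refl _ _)).
  exact: ip0l.
exists g; split=> // v Vv; have [c vc] := spn v Vv.
have Lg := PL _ Vg; have LB := L2B mO Lw Lg.
have [Vc Ec] := lin _ c LB.
rewrite (ip_feq mO LB LB (PL _ Vv) (PL _ Vc) (feq_refl _ _) (on_cells_eq_feq vc)) ipC Ec.
by rewrite big1// => e _; rewrite ipBr// hg subrr mulr0.
Qed.

Lemma Ph_P0h k w : L2 Omega w -> P0h Omega G k (Ph Omega G k w).
Proof. by move=> /(Ph_exists k) /(xgetPex (fun=> 0))[]. Qed.

Lemma Ph_ip k w v : L2 Omega w -> P0h Omega G k v -> ip (Ph Omega G k w) v = ip w v.
Proof.
move=> Lw Vv; have [Vg /(_ v Vv)] := xgetPex (fun=> 0) (Ph_exists k Lw).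
have Lg := L2form_L2 (P0h_L2form Vg); have Lv := L2form_L2 (P0h_L2form Vv).
by rewrite ipBl// => /eqP; rewrite subr_eq0 => /eqP ->.
Qed.

Lemma khom0 k : khom k (0 : form).
Proof. by move=> A _; rewrite ffun0E. Qed.

Lemma khom_cod_const k (f : form) : (k < n)%N -> khom (n - k.+1).+1 f -> khom k (cod_const f).
Proof.
move=> kn hf A kA; have := @homog_cod _ _ k (hodge (whitney 0 f)) _ 0 A kA.
rewrite cod_hodge_whitney; apply; apply: homog_P1sm => //.
by exists (whitney 0 f) => //; apply/P1mP; exists 0, f; split=> //; exact: khom0.
Qed.

(** Test forms supported in one open cell see only the polynomial on it, whose codifferential is the
    constant [cod_const (b T)]; finitely many cells then cover almost all of [Omega]. *)
Lemma codiff_on_cells k eta g a b : is_codiff Omega k.+1 eta g ->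
  (k < n)%N -> L2 Omega eta -> (forall T, khom (n - k.+1).+1 (b T)) ->
  on_cells G eta (fun T => hodge (whitney (a T) (b T))) ->
  feq g (pcw G (fun T => fun=> cod_const (b T))).
Proof.
move=> [/= Lg cg] kn Leta hb eab.
suff : {ae leb, forall x, forall T, oc T x -> g x = cod_const (b T)}.
  move: Gae; apply: filterS2 => x h1 h2 Ox; have [T Tx] := h1 Ox.
  by rewrite (h2 T Tx) (pcw_on_cells hm _ Tx).
apply: filter_forall => T.
have Lc : L2form Omega k (fun=> cod_const (b T)).
  split=> [x|]; first exact: khom_cod_const.
  have := L2_bounded mO fO (w := fun=> cod_const (b T)) (M := \sum_A `|cod_const (b T) A|).
  apply=> [A|x A _]; first exact: measurable_cst.
  by rewrite (bigD1 A)//= lerDl sumr_ge0.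
have : {ae leb, forall x, oc T x -> g x - cod_const (b T) = 0}.
  apply: (test_form_ae_eq0 oO fO (k := k) (g := fun x => g x - cod_const (b T))).
  - exact: ocell_open.
  - exact: mesh_sub.
  - exact: L2formB.
  move=> phi tphi; have tphiO := test_formS (mesh_sub hm (T := T)) tphi.
  have Lphi := L2form_L2 (test_form_L2form oO fO tphiO).
  rewrite ipBr//; [|exact: L2form_L2 Lg|exact: L2form_L2 Lc].
  rewrite -cg//; apply/eqP; rewrite subr_eq0; apply/eqP.
  (* [ext_d phi] vanishes outside a compact part of the cell, so [eta] may be replaced by the
     polynomial of that cell, which is smooth on the whole space. *)
  have -> : ip (ext_d phi) eta = ip (ext_d phi) (hodge (whitney (a T) (b T))).
    apply: eq_bigr => A _; apply: eq_Rintegral => x _.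
    have [_ _ [K [cK KT e0]]] := test_form_ext_d tphi.
    have [Kx|/e0 ->] := pselect (K x); last by rewrite ffun0E !mul0r.
    by rewrite (eab T)//; exact: KT.
  rewrite (ip_ext_d_cod oO tphiO) ?cod_hodge_whitney//.
    by congr Defs.ip; apply/funext => x; rewrite cod_hodge_whitney.
  move=> A; under eq_fun do rewrite ffunE.
  by apply: CmZ; exact: Cm_whitney.
by apply: filterS => x h Tx; apply/eqP; rewrite -subr_eq0 h.
Qed.

End discrete.

(** * The conforming and nonconforming spaces *)

Section duality.
Variables (R : realType) (n : nat) (Omega : set 'rV[R]_n).
Variables (N : nat) (G : 'I_N -> 'I_n.+1 -> 'rV[R]_n).
Hypothesis hm : mesh Omega G.

Let oO := mesh_open hm.
Let fO := mesh_finite hm.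
Let Gae := mesh_cover hm.
Let mO : measurable Omega. Proof. exact: open_measurable_rV. Qed.

Local Notation leb := (@lebesgue_rV R n).
Local Notation form := {ffun {set 'I_n} -> R}.
Local Notation oc := (ocell G).
Local Notation ip := (ip Omega).
Local Notation feq := (feq Omega).
Local Notation P0h := (P0h Omega G).
Local Notation P1mh := (P1mh Omega G).
Local Notation P1smh := (P1smh Omega G).
Local Notation Wstar0 := (Wstar0 Omega G).
Local Notation Wnc := (Wnc Omega G).
Local Notation dh := (dh G).
Local Notation delta := (codiff Omega).
Implicit Types (w g eta mu tau zeta : dform R n) (T S : 'I_N) (k : nat)
  (a b : 'I_N -> form).

Lemma P0h_L2 k w : P0h k w -> L2 Omega w. Proof. by move=> /P0h_L2form/L2form_L2. Qed.
Lemma P1mh_L2 k w : P1mh k w -> L2 Omega w. Proof. by move=> /P1mh_L2form/L2form_L2. Qed.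
Lemma P1smh_L2 k w : P1smh k w -> L2 Omega w. Proof. by move=> /P1smh_L2form/L2form_L2. Qed.
Lemma Wnc_P1mh k w : Wnc k w -> P1mh k w. Proof. by case. Qed.
Lemma Wnc_L2 k w : Wnc k w -> L2 Omega w. Proof. by move=> /Wnc_P1mh/P1mh_L2. Qed.
Lemma Wstar0_L2 k w : Wstar0 k w -> L2 Omega w. Proof. by move=> [/P1smh_L2]. Qed.

Lemma Wstar0_is_codiff k eta : Wstar0 k eta -> is_codiff Omega k eta (delta k eta).
Proof. by move=> [_ /Hstar0_is_codiff]. Qed.

Lemma Wstar0_codiff_L2 k eta : Wstar0 k eta -> L2 Omega (delta k eta).
Proof. by move=> /Wstar0_is_codiff[/L2form_L2]. Qed.

Lemma Wstar0D k w w' : Wstar0 k.+1 w -> Wstar0 k.+1 w' -> Wstar0 k.+1 (fun x => w x + w' x).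
Proof. by move=> [Vw Hw] [Vw' Hw']; split; [exact: P1smhD|exact: Hstar0D]. Qed.

Lemma Wstar0Z k (c : R) w : Wstar0 k.+1 w -> Wstar0 k.+1 (fun x => c *: w x).
Proof. by move=> [Vw Hw]; split; [exact: P1smhZ|exact: Hstar0Z]. Qed.

Lemma Wstar0B k w w' : Wstar0 k.+1 w -> Wstar0 k.+1 w' -> Wstar0 k.+1 (fun x => w x - w' x).
Proof. by move=> [Vw Hw] [Vw' Hw']; split; [exact: P1smhB|exact: Hstar0B]. Qed.

Lemma codiffD k w w' : Wstar0 k.+1 w -> Wstar0 k.+1 w' ->
  feq (delta k.+1 (fun x => w x + w' x)) (fun x => delta k.+1 w x + delta k.+1 w' x).
Proof.
move=> Ww Ww'; apply: codiff_feq => //; apply: is_codiffD => //; try exact: Wstar0_is_codiff.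
  exact: Wstar0_L2 Ww.
exact: Wstar0_L2 Ww'.
Qed.

Lemma codiffZ k (c : R) w : Wstar0 k.+1 w ->
  feq (delta k.+1 (fun x => c *: w x)) (fun x => c *: delta k.+1 w x).
Proof.
move=> Ww; apply: codiff_feq => //; apply: is_codiffZ => //; last exact: Wstar0_is_codiff.
exact: Wstar0_L2 Ww.
Qed.

Lemma codiffB k w w' : Wstar0 k.+1 w -> Wstar0 k.+1 w' ->
  feq (delta k.+1 (fun x => w x - w' x)) (fun x => delta k.+1 w x - delta k.+1 w' x).
Proof.
move=> Ww Ww'; apply: codiff_feq => //; apply: is_codiffB => //; try exact: Wstar0_is_codiff.
  exact: Wstar0_L2 Ww.
exact: Wstar0_L2 Ww'.
Qed.

Lemma codiff_feq_congr k w w' : Wstar0 k.+1 w -> L2 Omega w' -> feq w w' ->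
  feq (delta k.+1 w') (delta k.+1 w).
Proof.
move=> Ww Lw' ww'; have cw := Wstar0_is_codiff Ww.
apply: codiff_feq => //; apply: (is_codiff_feq oO fO (Wstar0_L2 Ww) Lw' _ ww' (feq_refl _ _) cw).
exact: cw.1.
Qed.

Lemma Wstar00 k : Wstar0 k.+1 (fun=> 0).
Proof.
have c0 : is_codiff Omega k.+1 (fun=> 0) (fun=> 0).
  by split; [exact: L2form0|move=> phi _; rewrite !ip0r].
split; first by split; [exact: L2form0|move=> T; exists (fun=> 0) => //; exists (fun=> 0);
  [apply/P1mP; exists 0, 0; split; [exact: khom0|exact: khom0|]; apply/funext => x; rewrite whitney0
  |apply/funext => x; apply/ffunP => A; rewrite !ffunE [LHS]mulr0]].
have t0 : test_form Omega k.+1 (fun=> 0).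
  split; first by move=> x A _; rewrite ffun0E.
    by move=> A m; under eq_fun do rewrite ffun0E; exact: Cm_cst.
  by exists set0; split=> //; exact: compact0.
apply: (Hstar0_intro oO fO (g := fun=> 0)) => //; first exact: L2form0.
move=> e e0; exists (fun=> 0), (fun=> 0); split=> //.
have -> : (fun x : 'rV[R]_n => 0 - 0) = (fun=> 0) :> dform R n by apply/funext => x; rewrite subr0.
by rewrite ip0l// addr0.
Qed.

Lemma Wstar0_codiff_P0h k eta : (k < n)%N -> Wstar0 k.+1 eta ->
  exists2 g, P0h k g & feq (delta k.+1 eta) g.
Proof.
move=> kn We; have [Ve _] := We; have [a [b [ha hb eab]]] := P1smhP kn Ve.
exists (pcw G (fun T => fun=> cod_const (b T))).
  by apply: (P0h_intro hm) => T; exact: khom_cod_const.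
exact: (codiff_on_cells hm (Wstar0_is_codiff We) kn (Wstar0_L2 We) hb eab).
Qed.

(** [cod_const] is injective in the degree at hand: where it vanishes the Koszul part is gone and
    the star of [a T] remains. *)
Lemma cod_const_ae_eq0 k eta a b : (k < n)%N ->
  (forall T, khom (n - k.+1) (a T)) -> (forall T, khom (n - k.+1).+1 (b T)) ->
  on_cells G eta (fun T => hodge (whitney (a T) (b T))) ->
  feq (pcw G (fun T => fun=> cod_const (b T))) (fun=> 0) ->
  exists c, [/\ forall T, khom k.+1 (c T), P0h k.+1 (pcw G (fun T => fun=> c T)) &
    feq eta (pcw G (fun T => fun=> c T))].
Proof.
move=> kn ha hb eab g0.
(* The base point 0 is arbitrary, the star of a constant form being constant. *)
pose c T : form := hodge (fun=> a T) 0.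
have hc T : khom k.+1 (c T).
  have : homog k.+1 (hodge (fun _ : 'rV[R]_n => a T)).
    apply: homog_P1sm => //; exists (fun=> a T) => //.
    by apply: P0_P1m; apply/P0P; exists (a T).
  exact.
exists c; split=> //; first exact: (P0h_intro hm).
move: Gae g0; apply: filterS2 => x h1 h2 Ox; have [T Tx] := h1 Ox.
have := h2 Ox; rewrite (pcw_on_cells hm _ Tx) => /(cod_const_eq0 (hb T)) b0.
rewrite (eab T)// (pcw_on_cells hm _ Tx) b0 /c.
by apply/ffunP => A; rewrite [LHS]ffunE [RHS]ffunE whitney0.
Qed.

Lemma codiff_eq0_P0h k eta : (k < n)%N -> Wstar0 k.+1 eta -> feq (delta k.+1 eta) (fun=> 0) ->
  exists2 eta0, P0h k.+1 eta0 & feq eta eta0.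
Proof.
move=> kn We d0; have [Ve _] := We; have [a [b [ha hb eab]]] := P1smhP kn Ve.
have cE := codiff_on_cells hm (Wstar0_is_codiff We) kn (Wstar0_L2 We) hb eab.
have [c [_ V0 ec]] := cod_const_ae_eq0 kn ha hb eab (feq_trans (feq_sym cE) d0).
by exists (pcw G (fun T => fun=> c T)).
Qed.

(** Testing with the piecewise constant representative of [g], whose [dh] vanishes, gives [g = 0].
    Then [eta] is piecewise constant, and the Koszul image of its values gives k+1 times its squared
    norm. As [eta] may be nonconforming, [g] stands for its cellwise codifferential. *)
Lemma P1smh_nondegenerate k eta a b g : (k < n)%N -> P1smh k.+1 eta ->
  (forall T, khom (n - k.+1) (a T)) -> (forall T, khom (n - k.+1).+1 (b T)) ->
  on_cells G eta (fun T => hodge (whitney (a T) (b T))) ->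
  L2 Omega g -> feq g (pcw G (fun T => fun=> cod_const (b T))) ->
  (forall w, P1mh k w -> ip w g - ip (dh w) eta = 0) ->
  feq eta (fun=> 0) /\ feq g (fun=> 0).
Proof.
move=> kn Ve ha hb eab Lg gE B0; have Le := P1smh_L2 Ve.
set g' := pcw G _ in gE; have Vg' : P0h k g' by apply: (P0h_intro hm) => T; exact: khom_cod_const.
have Lg' := P0h_L2 Vg'.
have g'0 : feq g' (fun=> 0).
  apply: (ip_eq0 mO Lg'); have := B0 g' (P0h_P1mh Vg'); rewrite (dh_P0h_eq0 hm Vg') ip0l// subr0.
  by rewrite (ip_feq mO Lg' Lg' Lg Lg' (feq_refl _ _) gE).
have g0 := feq_trans gE g'0; split=> //.
have [c [hc V0 ee0]] := cod_const_ae_eq0 kn ha hb eab g'0.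
set eta0 := pcw G _ in V0 ee0; have L0 := P0h_L2 V0.
apply: (feq_trans ee0); apply: (ip_eq0 mO L0).
pose w := pcw G (fun T => whitney 0 (c T)).
have h0 T : khom k (0 : form) by exact: khom0.
have Vw : P1mh k w by exact: (P1mh_intro hm (a := fun=> 0)).
have dw : dh w = fun x => k.+1%:R *: eta0 x.
  rewrite (dh_on_cells hm hc (pcw_on_cells hm _)); apply/funext => x.
  rewrite /eta0 /pcw scaler_sumr; apply: eq_bigr => T _.
  by case: asboolP; rewrite ?scaler0.
have := B0 w Vw; have Lw := P1mh_L2 Vw; have Ldw : L2 Omega (dh w) by exact: P0h_L2 (dh_P0h hm Vw).
rewrite (ip_feq mO Lw Lw Lg (L2_0 _) (feq_refl _ _) g0) ip0r// sub0r => /eqP.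
rewrite (ip_feq mO Ldw Ldw Le L0 (feq_refl _ _) ee0) dw ipZl// oppr_eq0 mulf_eq0 pnatr_eq0/=.
by move/eqP.
Qed.

(* Since [Wnc] is the annihilator of [Wstar0] in a finite-dimensional pairing
   which is nondegenerate on the [Wstar0] side, a piecewise constant form
   annihilated by [dh Wnc] lies in [Wstar0]. *)
Lemma P0h_orth_dh_Wstar0 k mu : (k < n)%N -> P0h k.+1 mu ->
  (forall tau, Wnc k tau -> ip mu (dh tau) = 0) ->
  Wstar0 k.+1 mu /\ feq (delta k.+1 mu) (fun=> 0).
Proof.
move=> kn Vmu mu_orth; have Lmu := P0h_L2 Vmu.
have [E [om [Vom spn]]] := P1mh_finite_dim hm k.
have linL g zeta c : L2 Omega g -> L2 Omega zeta -> P1mh k (comb om c) /\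
    ip (comb om c) g - ip (dh (comb om c)) zeta = \sum_e c e * (ip (om e) g - ip (dh (om e)) zeta).
  move=> Lg Lz; have Ld w : P1mh k w -> L2 Omega (dh w) by move=> /(dh_P0h hm)/P0h_L2.
  apply: (sum_linear (V := P1mh k) (L := fun w => ip w g - ip (dh w) zeta)) => //.
  - exact: P1mh0.
  - by move=> *; exact: (P1mhD hm).
  - by move=> *; exact: (P1mhZ hm).
  - by rewrite (dh_P0h_eq0 hm (P0h0 Omega G k)) !ip0l// subr0.
  - move=> w w' Vw Vw'; have [Lw Lw'] := (P1mh_L2 Vw, P1mh_L2 Vw').
    have [Ldw Ldw'] := (Ld _ Vw, Ld _ Vw').
    by rewrite (dhD hm Vw Vw') !ipDl// opprD addrACA.
  - move=> d w Vw; have Lw := P1mh_L2 Vw; have Ldw := Ld _ Vw.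
    by rewrite (dhZ hm d Vw) !ipZl// mulrBr.
pose s_ eta e := ip (om e) (delta k.+1 eta) - ip (dh (om e)) eta.
pose Sg (s : _ -> R) := exists2 eta, Wstar0 k.+1 eta & forall e, s e = s_ eta e.
have Lom e : L2 Omega (om e) := P1mh_L2 (Vom e).
have Ldom e : L2 Omega (dh (om e)) := P0h_L2 (dh_P0h hm (Vom e)).
(* The functional is w -> -<dh w, mu>; the zero form in the first slot gives it the shape of the
   pairings [s_ eta]. *)
have [|||c h|eta We etaE] := @double_annihilator _ _ Sg (fun e => ip (om e) (fun=> 0) - ip (dh (om e)) mu).
- have W0 := Wstar00 k; exists (fun=> 0) => // e; rewrite /s_ ip0r// subr0.
  have := codiffZ 0 W0; have -> : (fun x : 'rV[R]_n => 0 *: 0) = (fun=> 0) :> dform R n.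
    by apply/funext => x; rewrite scale0r.
  move=> d0; have d0' : feq (delta k.+1 (fun=> 0)) (fun=> 0).
    by apply: feq_trans d0 _; apply: aeW => x _; rewrite scale0r.
  have Ld0 := Wstar0_codiff_L2 W0.
  by rewrite (ip_feq mO (Lom e) (Lom e) Ld0 (L2_0 _) (feq_refl _ _) d0') ip0r.
- move=> s t [eta We hs] [eta' We' ht]; have WD := Wstar0D We We'.
  exists (fun x => eta x + eta' x) => // e.
  have [L1 L1'] := (Wstar0_L2 We, Wstar0_L2 We').
  have [L3 L3'] := (Wstar0_codiff_L2 We, Wstar0_codiff_L2 We').
  have LD := L2D mO L3 L3'.
  rewrite hs ht /s_ (ip_feq mO (Lom e) (Lom e) (Wstar0_codiff_L2 WD) LD (feq_refl _ _) (codiffD We We')).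
  by rewrite !ipDr// opprD addrACA.
- move=> c s [eta We hs]; have WZ := Wstar0Z c We.
  exists (fun x => c *: eta x) => // e.
  have L1 := Wstar0_L2 We; have L3 := Wstar0_codiff_L2 We; have LZ := L2Z mO c L3.
  rewrite hs /s_ (ip_feq mO (Lom e) (Lom e) (Wstar0_codiff_L2 WZ) LZ (feq_refl _ _) (codiffZ c We)).
  by rewrite !ipZr// mulrBr.
- have [Vc <-] := linL (fun=> 0) mu c (L2_0 _) Lmu.
  (* Coefficients annihilating every [s_ eta] define a member of [Wnc], to which the orthogonality
     of [mu] applies. *)
  have Wc : Wnc k (comb om c).
    split=> // eta We; have [_ ->] := linL (delta k.+1 eta) eta c (Wstar0_codiff_L2 We) (Wstar0_L2 We).
    by apply: h; exists eta.
  by rewrite ip0r// sub0r ipC mu_orth// oppr0.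
have [Ve _] := We; have [a [b [ha hb eab]]] := P1smhP kn Ve.
have Le := Wstar0_L2 We; have Lde := Wstar0_codiff_L2 We.
have cE := codiff_on_cells hm (Wstar0_is_codiff We) kn Le hb eab.
have [m hmT mum] := P0hP Vmu.
have hinv T : {f : form | khom (n - k.+1) f & hodge (fun _ : 'rV[R]_n => f) = fun=> m T}.
  by apply: cid2; exact: hodge_const_onto.
pose a' T := s2val (hinv T).
(* On each cell [mu] is the star of a constant, so [eta - mu] keeps the Koszul coefficients of
   [eta], and [delta eta] is its cellwise codifferential. *)
have on : on_cells G (fun x => eta x - mu x) (fun T => hodge (whitney (a T - a' T) (b T))).
  move=> T x Tx; rewrite (eab T)// (mum T)// -[m T]/((fun=> m T) x) -(s2valP' (hinv T)).
  have -> : whitney (a T - a' T) (b T) = fun x => whitney (a T) (b T) x + (-1) *: whitney (a' T) 0 x.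
    apply/funext => y; rewrite -whitneyZ -whitneyD scaleN1r; congr whitney.
    by rewrite scaler0 addr0.
  rewrite hodgeD hodgeZ scaleN1r; congr (_ - _).
  by apply/ffunP => A; rewrite [LHS]ffunE [RHS]ffunE whitney0.
have ha'' T : khom (n - k.+1) (a T - a' T).
  by apply: khomD => //; rewrite -scaleN1r; apply: khomZ; exact: (s2valP (hinv T)).
have Vdiff : P1smh k.+1 (fun x => eta x - mu x) by apply: (P1smhB hm) => //; exact: P0h_P1smh.
have Ldiff := P1smh_L2 Vdiff.
have [w Vw|d0 g0] := P1smh_nondegenerate kn Vdiff ha'' hb on Lde cE.
  have [c wc] := spn w Vw; have [Vc Lc] := linL (delta k.+1 eta) (fun x => eta x - mu x) c Lde Ldiff.
  have dwc : feq (dh w) (dh (comb om c)).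
    have [a1 [b1 [_ hb1 wab1]]] := P1mhP Vw.
    rewrite (dh_on_cells hm hb1 wab1) (dh_on_cells hm hb1 (a := a1) (w := comb om c)).
      exact: feq_refl.
    by move=> T x Tx; rewrite -(wc T)// (wab1 T).
  have Lw := P1mh_L2 Vw; have Lcm := P1mh_L2 Vc.
  have Ldw := P0h_L2 (dh_P0h hm Vw); have Ldc := P0h_L2 (dh_P0h hm Vc).
  rewrite (ip_feq mO Lw Lcm Lde Lde (on_cells_eq_feq hm wc) (feq_refl _ _)).
  rewrite (ip_feq mO Ldw Ldc Ldiff Ldiff dwc (feq_refl _ _)) Lc big1// => e _.
  rewrite ipBr//; have := etaE e; rewrite /s_ ip0r// => h.
  by rewrite opprB addrCA -h sub0r subrr mulr0.
have em : feq eta mu by apply/feq_subr0.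
split; first split; first exact: P0h_P1smh.
  by apply: (Hstar0_feq oO fO _ em); [exact: P0h_L2form Vmu|case: We].
exact: feq_trans (codiff_feq_congr We Lmu em) g0.
Qed.

(** The chosen [delta eta] is exchanged for its piecewise constant representative, which is a
    genuine member of [P0h] and lies in [Hstar0] because the codifferential maps [Hstar0] into
    itself. *)
Lemma Wstar0_complex k eta : (k.+1 < n)%N -> Wstar0 k.+2 eta ->
  exists g, [/\ P0h k.+1 g, Wstar0 k.+1 g, feq (delta k.+1 g) (fun=> 0) & feq (delta k.+2 eta) g].
Proof.
move=> kn We; have [g Vg eg] := Wstar0_codiff_P0h kn We.
have ce := Wstar0_is_codiff We; have [_ He] := We.
have Le := Wstar0_L2 We.
have cg : is_codiff Omega k.+2 eta g.
  by apply: (is_codiff_feq oO fO Le Le _ (feq_refl _ _) eg ce); exact: P0h_L2form Vg.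
have Hg := Hstar0_codiff oO fO He cg; have c0 := is_codiff_smooth_codiff oO cg.
exists g; split=> //; last exact: codiff_feq c0.
by split=> //; apply: P0h_P1smh => //; exact: ltnW.
Qed.

Lemma P0h_orth_codiff_Wnc k mu : P0h k mu ->
  (forall eta, Wstar0 k.+1 eta -> ip mu (delta k.+1 eta) = 0) -> Wnc k mu.
Proof.
move=> Vmu mu_orth; split=> [|eta We]; first exact: P0h_P1mh.
by rewrite mu_orth// (dh_P0h_eq0 hm Vmu) ip0l// subr0.
Qed.

Lemma Wnc_adjoint k w eta : Wnc k w -> Wstar0 k.+1 eta -> ip w (delta k.+1 eta) = ip (dh w) eta.
Proof. by move=> [_ h] /h /eqP; rewrite subr_eq0 => /eqP. Qed.

Lemma dh_L2 k w : P1mh k w -> L2 Omega (dh w).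
Proof. by move=> /(dh_P0h hm)/P0h_L2. Qed.

Lemma dhB k w w' : P1mh k w -> P1mh k w' ->
  dh (fun x => w x - w' x) = (fun x => dh w x - dh w' x).
Proof.
move=> Vw Vw'; rewrite (subE_scale w w') (dhD hm Vw (P1mhZ hm (-1) Vw')) (dhZ hm _ Vw').
by rewrite -subE_scale.
Qed.

Lemma WncB k w w' : Wnc k w -> Wnc k w' -> Wnc k (fun x => w x - w' x).
Proof.
move=> Ww Ww'; have [Vw Vw'] := (Wnc_P1mh Ww, Wnc_P1mh Ww').
split=> [|eta We].
  by rewrite (subE_scale w w'); exact: (P1mhD hm Vw (P1mhZ hm (-1) Vw')).
have [Lw Lw'] := (P1mh_L2 Vw, P1mh_L2 Vw'); have [Ld Ld'] := (dh_L2 Vw, dh_L2 Vw').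
have [Le Lde] := (Wstar0_L2 We, Wstar0_codiff_L2 We).
by rewrite (dhB Vw Vw') !ipBl// !(Wnc_adjoint _ We)// subrr.
Qed.

(** Dual to delta delta = 0: [delta eta] is conforming up to a null set, so [dh] can be moved onto
    it and leaves a second codifferential. *)
Lemma Wnc_dh k tau : (k.+1 < n)%N -> Wnc k tau -> Wnc k.+1 (dh tau).
Proof.
move=> kn Wt; have Vt := Wnc_P1mh Wt; apply: (P0h_orth_codiff_Wnc (dh_P0h hm Vt)) => eta We.
have [g [Vg Wg dg eg]] := Wstar0_complex kn We.
have [Lt Ldt] := (Wnc_L2 Wt, dh_L2 Vt); have Lg := P0h_L2 Vg.
rewrite (ip_feq mO Ldt Ldt (Wstar0_codiff_L2 We) Lg (feq_refl _ _) eg) -(Wnc_adjoint Wt Wg).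
by rewrite (ip_feq mO Lt Lt (Wstar0_codiff_L2 Wg) (L2_0 _) (feq_refl _ _) dg) ip0r.
Qed.

Lemma Ph_feq k w w' : L2 Omega w -> L2 Omega w' -> feq w w' -> feq (Ph Omega G k w) (Ph Omega G k w').
Proof.
move=> Lw Lw' ww'; have [V V'] := (Ph_P0h hm k Lw, Ph_P0h hm k Lw').
have [LP LP'] := (P0h_L2 V, P0h_L2 V').
apply: (ip_sub_eq0 mO LP LP'); set u := (fun x => _ - _).
have Vu : P0h k u by exact: (P0hB hm).
have Lu := P0h_L2 Vu; rewrite {1}/u (ipBl mO LP LP' Lu) (Ph_ip hm Lw Vu) (Ph_ip hm Lw' Vu).
by apply/eqP; rewrite subr_eq0; apply/eqP; exact: (ip_feq mO Lw Lw' Lu Lu ww' (feq_refl _ _)).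
Qed.

Lemma Ph_ip_feq k w v v0 : L2 Omega w -> L2 Omega v -> P0h k v0 -> feq v v0 ->
  ip (Ph Omega G k w) v = ip w v.
Proof.
move=> Lw Lv Vv0 vv0; have LP := P0h_L2 (Ph_P0h hm k Lw); have L0 := P0h_L2 Vv0.
rewrite (ip_feq mO LP LP Lv L0 (feq_refl _ _) vv0) (Ph_ip hm Lw Vv0).
by rewrite (ip_feq mO Lw Lw Lv L0 (feq_refl _ _) vv0).
Qed.

End duality.

Lemma cancel3 (V : zmodType) (a b c a' b' c' : V) :
  a + b + c = a' + b' + c' -> a = a' -> c = 0 -> c' = 0 -> b = b'.
Proof. by move=> h ea eb eb'; move: h; rewrite ea eb eb' !addr0 => /addrI. Qed.

Lemma cancel3_l (V : zmodType) (a b c a' b' c' : V) :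
  a + b + c = a' + b' + c' -> b = 0 -> b' = 0 -> c = 0 -> c' = 0 -> a = a'.
Proof. by move=> h ea eb ec ed; move: h; rewrite ea eb ec ed !addr0. Qed.

Lemma cancel3_r (V : zmodType) (a b c a' b' c' : V) :
  a + b + c = a' + b' + c' -> a = a' -> b = b' -> c = c'.
Proof. by move=> h ea eb; move: h; rewrite ea eb => /addrI. Qed.

(** The closed cells cover [closure Omega], and almost every point of a closed cell is interior to
    it; finite measure comes from a bounding cube. *)
Lemma mesh_of_subdivision (R : realType) (n : nat) (Omega : set 'rV[R]_n) (N : nat)
    (G : 'I_N -> 'I_n.+1 -> 'rV[R]_n) :
  (0 < n)%N -> polyhedral_domain Omega -> simplicial_subdivision Omega G -> mesh Omega G.
Proof.
move=> n0 [_ oO _ bO _] [Gind Gcov Gsub Gdisj _].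
have [M OM] : exists M, Omega `<=` cube M.
  have [M [_ hM]] := bO; exists (M + 1) => x Ox i.
  by rewrite (le_trans (coord_le_norm x i))// hM// ltrDl.
split=> //; last 1 first.
- have : {ae @lebesgue_rV R n, forall x, forall T, cell (G T) x -> (cell (G T))° x}.
    by apply: filter_forall => T; exact: cell_interior_ae.
  apply: filterS => x h Ox; have := @subset_closure _ Omega x Ox.
  by rewrite Gcov => -[T _ Tx]; exists T; exact: h.
- apply: le_lt_trans (lebesgue_rV_cube n M); apply: le_measure; rewrite ?inE//.
    exact: open_measurable_rV.
  exact: cube_measurable.
- by exists M.
Qed.

(** * The three schemes *)

Section schemes.
Variables (R : realType) (n : nat) (Omega : set 'rV[R]_n).
Variables (N : nat) (G : 'I_N -> 'I_n.+1 -> 'rV[R]_n).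
Hypothesis hm : mesh Omega G.
Variables (j : nat) (f wc zetac sigmac thetac : dform R n).
Hypotheses (jn : (j.+1 < n)%N) (Lf : L2form Omega j.+1 f).
Hypothesis hc : solves_c Omega G j.+1 f wc zetac sigmac thetac.

Let mO : measurable Omega. Proof. apply: open_measurable_rV; exact: mesh_open hm. Qed.

Local Notation ip := (ip Omega).
Local Notation feq := (feq Omega).
Local Notation P0h := (P0h Omega G).
Local Notation Wstar0 := (Wstar0 Omega G).
Local Notation Wnc := (Wnc Omega G).
Local Notation Hnc := (Hnc Omega G).
Local Notation Hs0 := (Hs0 Omega G).
Local Notation dh := (dh G).
Local Notation delta := (codiff Omega).
Local Notation Ph := (Ph Omega G).
Implicit Types (w g eta mu tau zeta theta : dform R n).

Let jn' : (j < n)%N := ltnW jn.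

Let L2f : L2 Omega f := L2form_L2 Lf.
Let Vwc : P0h j.+1 wc. Proof. by case: hc. Qed.
Let Wzc : Wstar0 j.+2 zetac. Proof. by case: hc. Qed.
Let Wsc : Wnc j sigmac. Proof. by case: hc. Qed.
Let Htc : Hnc j.+1 thetac. Proof. by case: hc. Qed.
Let Wtc : Wnc j.+1 thetac. Proof. by case: Htc. Qed.
Let Lwc := P0h_L2 Vwc.
Let Lzc := Wstar0_L2 Wzc.
Let Lsc := Wnc_L2 Wsc.
Let Ltc := Wnc_L2 Wtc.
Let Ldsc := dh_L2 hm (Wnc_P1mh Wsc).
Let Ldzc := Wstar0_codiff_L2 Wzc.
Let LPzc := P0h_L2 (Ph_P0h hm j.+2 Lzc).
Let LPsc := P0h_L2 (Ph_P0h hm j Lsc).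

Let Pip k w v : L2 Omega w -> P0h k v -> ip (Ph k w) v = ip w v.
Proof. exact: Ph_ip. Qed.

Let P0hPh k w : L2 Omega w -> P0h k (Ph k w).
Proof. exact: Ph_P0h. Qed.

Lemma ip_feq0r k w eta : L2 Omega w -> Wstar0 k eta -> feq (delta k eta) (fun=> 0) ->
  ip w (delta k eta) = 0.
Proof.
move=> Lw We d0; have Ld := Wstar0_codiff_L2 We.
by rewrite (ip_feq mO Lw Lw Ld (L2_0 _) (feq_refl _ _) d0) ip0r.
Qed.

Lemma Hnc_P0h k theta : Hnc k theta -> exists2 t0, P0h k t0 & feq theta t0.
Proof. by case=> Wt d0 _; apply: (dh_eq0_P0h hm (Wnc_P1mh Wt)). Qed.

Lemma Hnc_orth_codiff k theta eta : Hnc k theta -> Wstar0 k.+1 eta -> ip theta (delta k.+1 eta) = 0.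
Proof.
case=> Wt d0 _ We; rewrite (Wnc_adjoint Wt We).
have [Le Ld] := (Wstar0_L2 We, dh_L2 hm (Wnc_P1mh Wt)).
by rewrite (ip_feq mO Ld (L2_0 _) Le Le d0 (feq_refl _ _)) ip0l.
Qed.

(** The last equation of (c) makes the residual orthogonal to [P0h]. With [thetac] and the
    codifferential of [zetac] in piecewise constant form, the residual is itself a test form, hence
    null. *)
Lemma solves_c_residual : exists2 g, P0h j.+1 g & feq g (delta j.+2 zetac) /\
  feq (fun x => Ph j.+1 f x - dh sigmac x - thetac x) g.
Proof.
have [g Vg zg] := Wstar0_codiff_P0h hm jn Wzc.
have [t Vt ht] := Hnc_P0h Htc.
have Vd := dh_P0h hm (Wnc_P1mh Wsc).
exists g => //; split; first exact: feq_sym.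
pose u : dform R n := fun x => Ph j.+1 f x - dh sigmac x - t x - g x.
have VP := P0hPh j.+1 L2f.
have Vu : P0h j.+1 u by apply: (P0hB hm) => //; apply: (P0hB hm) => //; exact: (P0hB hm).
have [[[Lu Lg] Lt] LP] := (P0h_L2 Vu, P0h_L2 Vg, P0h_L2 Vt, P0h_L2 VP).
have u0 : ip u u = 0.
  have [_ _ _ _ /(_ u _ _ _ Vu (Wstar00 hm j.+1) Wsc Htc)[_ _ _]] := hc.
  rewrite (ip_feq mO Ltc Lt Lu Lu ht (feq_refl _ _)) (ip_feq mO Ldzc Lg Lu Lu zg (feq_refl _ _)).
  rewrite -(Pip L2f Vu) => E; rewrite {1}/u.
  have L1 := L2B mO LP Ldsc; have L2' := L2B mO L1 Lt.
  rewrite ipBl// ipBl// ipBl// -E.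
  move: (ip t u) (ip g u) (ip (dh sigmac) u) => x y z; lra.
apply: (feq_trans (g := fun x => Ph j.+1 f x - dh sigmac x - t x)).
  exact: (feqB (feq_refl _ (fun x => Ph j.+1 f x - dh sigmac x)) ht).
by apply/feq_subr0; exact: (ip_eq0 mO Lu u0).
Qed.

(* Testing (c) with the piecewise average of a discrete form. *)
Lemma solves_c_average mu : L2 Omega mu ->
  ip thetac mu + ip (delta j.+2 zetac) mu + ip (dh sigmac) mu = ip f (Ph j.+1 mu).
Proof.
move=> Lmu; have VP := P0hPh j.+1 Lmu;
have [_ _ _ _ /(_ _ _ _ _ VP (Wstar00 hm j.+1) Wsc Htc)[_ _ _ <-]] := hc.
have [t Vt ht] := Hnc_P0h Htc; have [g Vg zg] := Wstar0_codiff_P0h hm jn Wzc.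
have Vd := dh_P0h hm (Wnc_P1mh Wsc).
rewrite !(ipC _ _ (Ph _ _)) (Ph_ip_feq hm Lmu Ltc Vt ht) (Ph_ip_feq hm Lmu Ldzc Vg zg) (Pip Lmu Vd).
by rewrite !(ipC _ mu).
Qed.

(** Applied to the difference between the projected [omega] of (p) or (d) and that of (c): being
    harmonic in both senses, it can be tested in the first equation of each scheme. *)
Lemma P0h_Hnc_Hs0 k e : (k.+1 < n)%N -> P0h k.+1 e ->
  (forall tau, Wnc k tau -> ip e (dh tau) = 0) ->
  (forall eta, Wstar0 k.+2 eta -> ip e (delta k.+2 eta) = 0) -> Hnc k.+1 e /\ Hs0 k.+1 e.
Proof.
move=> kn Ve et ed; have [We de] := P0h_orth_dh_Wstar0 hm (ltnW kn) Ve et.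
split; last by split.
split=> //; first exact: (P0h_orth_codiff_Wnc hm).
by rewrite (dh_P0h_eq0 hm Ve); exact: feq_refl.
Qed.

Let hc1 vs : Hnc j.+1 vs -> ip wc vs = 0.
Proof. by move=> Hv; case: hc => _ _ _ _ /(_ _ _ _ _ Vwc Wzc Wsc Hv)[]. Qed.

Let hc2 eta : Wstar0 j.+2 eta -> ip (Ph j.+2 zetac) (Ph j.+2 eta) = ip wc (delta j.+2 eta).
Proof.
move=> We; case: hc => _ _ _ _ /(_ _ _ _ _ Vwc We Wsc Htc)[_ /eqP + _ _].
by rewrite subr_eq0 => /eqP.
Qed.

Let hc3 tau : Wnc j tau -> ip (Ph j sigmac) (Ph j tau) = ip wc (dh tau).
Proof.
move=> Wt; case: hc => _ _ _ _ /(_ _ _ _ _ Vwc Wzc Wt Htc)[_ _ /eqP + _].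
by rewrite subr_eq0 => /eqP.
Qed.

Lemma solves_d_correct wd zetad thetad : solves_d Omega G j.+1 f wd zetad thetad ->
  [/\ feq thetad thetac, feq zetad zetac, feq (Ph j.+1 wd) wc &
      feq (delta j.+1 wd) (Ph j sigmac)].
Proof.
move=> [/= Wwd Wzd Htd hd].
have [Wtd dtd ztd] := Htd.
have [[Lwd Lzd] Ltd] := (Wstar0_L2 Wwd, Wstar0_L2 Wzd, Wstar0_L2 Wtd).
have [[Ldwd Ldzd] Ldtd] := (Wstar0_codiff_L2 Wwd, Wstar0_codiff_L2 Wzd, Wstar0_codiff_L2 Wtd).
have [gd Vgd wgd] := Wstar0_codiff_P0h hm jn' Wwd; have Lgd := P0h_L2 Vgd.
have VPs := P0hPh j Lsc.
(* (d) against (c) averaged over [mu]: the right-hand sides agree, and <dh sigma, mu> turns into <P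
   sigma, delta mu> since [sigmac] is in [Wnc] and [delta mu] is piecewise constant. *)
have E1 mu : Wstar0 j.+1 mu ->
    ip thetad mu + ip (delta j.+2 zetad) mu + ip (delta j.+1 wd) (delta j.+1 mu) =
    ip thetac mu + ip (delta j.+2 zetac) mu + ip (Ph j sigmac) (delta j.+1 mu).
  move=> Wmu; have [Lmu Ldmu] := (Wstar0_L2 Wmu, Wstar0_codiff_L2 Wmu).
  have [_ _ E] := hd _ _ _ Wmu Wzd Htd.
  have [g Vg mg] := Wstar0_codiff_P0h hm jn' Wmu.
  have E' := solves_c_average Lmu.
  have E'' := Ph_ip_feq hm Lsc Ldmu Vg mg.
  have E3 := Wnc_adjoint Wsc Wmu.
  apply: (etrans E).
  apply: (etrans (esym E')).
  congr (_ + _).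
  by rewrite E'' E3.
have hd2 eta : Wstar0 j.+2 eta -> ip (Ph j.+2 zetad) (Ph j.+2 eta) = ip wd (delta j.+2 eta).
  by move=> We; have [_ /eqP + _] := hd _ _ _ Wwd We Htd; rewrite subr_eq0 => /eqP.
have hd1 vs : Hs0 j.+1 vs -> ip wd vs = 0 by move=> Hv; have [] := hd _ _ _ Wwd Wzd Hv.
have [t Vt ht] := Hnc_P0h Htc; have Lt := P0h_L2 Vt.
have tE mu : L2 Omega mu -> ip thetac mu = ip t mu.
  by move=> Lmu; exact: (ip_feq mO Ltc Lt Lmu Lmu ht (feq_refl _ _)).
have tdh tau : Wnc j tau -> ip t (dh tau) = 0.
  move=> Wtau; have Ld := dh_L2 hm (Wnc_P1mh Wtau).
  by apply: (etrans (esym (tE _ Ld))); have [_ _] := Htc; exact.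
have [Wt dt] := P0h_orth_dh_Wstar0 hm jn' Vt tdh.
(* [thetad] and [thetac] belong to different harmonic spaces; the representative [t] of [thetac] is
   conforming, so the difference is admissible in E1. *)
pose td : dform R n := fun x => thetad x - t x.
have Wtdt : Wstar0 j.+1 td by exact: (Wstar0B hm).
have Ltdt := Wstar0_L2 Wtdt.
have dtdt : feq (delta j.+1 td) (fun=> 0).
  apply: (feq_trans (codiffB hm Wtd Wt)); apply: (feq_trans (feqB dtd dt)).
  by apply: aeW => x _; rewrite subr0.
have tc eta : Wstar0 j.+2 eta -> ip t (delta j.+2 eta) = 0.
  move=> We; have Lde := Wstar0_codiff_L2 We.
  exact: (etrans (esym (tE _ Lde)) (Hnc_orth_codiff Htc We)).
have tdd eta : Wstar0 j.+2 eta -> ip (delta j.+2 eta) td = 0.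
  move=> We; have Lde := Wstar0_codiff_L2 We.
  by rewrite ipC (ipBl mO Ltd Lt Lde) (ztd _ We) (tc _ We) subrr.
have Etd : feq thetad t.
  apply: (ip_sub_eq0 mO Ltd Lt).
  have E := cancel3_l (E1 _ Wtdt) (tdd _ Wzd) (tdd _ Wzc) (ip_feq0r Ldwd Wtdt dtdt) (ip_feq0r LPsc Wtdt dtdt).
  by apply: (etrans (ipBl mO Ltd Lt Ltdt)); apply/eqP; rewrite subr_eq0; apply/eqP; exact: (etrans E (tE _ Ltdt)).
have tdc mu : L2 Omega mu -> ip thetad mu = ip thetac mu.
  move=> Lmu; apply: (etrans (ip_feq mO Ltd Lt Lmu Lmu Etd (feq_refl _ _))).
  exact: (esym (tE _ Lmu)).
pose ze : dform R n := fun x => zetad x - zetac x.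
have Wze : Wstar0 j.+2 ze by exact: (Wstar0B hm).
have [Lze Ldze] := (Wstar0_L2 Wze, Wstar0_codiff_L2 Wze).
(* E1 is tested with the codifferential of [ze] itself, whose own codifferential vanishes. *)
have [g [Vg Wg dg zg]] := Wstar0_complex hm jn Wze.
have Lg := P0h_L2 Vg.
have dze0 : feq (delta j.+2 ze) (fun=> 0).
  apply: (feq_trans zg); apply: (ip_eq0 mO Lg).
  have E := cancel3 (E1 _ Wg) (tdc _ Lg) (ip_feq0r Ldwd Wg dg) (ip_feq0r LPsc Wg dg).
  have LB := L2B mO Ldzd Ldzc.
  apply: (etrans (esym (ip_feq mO Ldze Lg Lg Lg zg (feq_refl _ _)))).
  apply: (etrans (ip_feq mO Ldze LB Lg Lg (codiffB hm Wzd Wzc) (feq_refl _ _))).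
  by apply: (etrans (ipBl mO Ldzd Ldzc Lg)); apply/eqP; rewrite subr_eq0; apply/eqP.
(* [ze] is now piecewise constant, so its norm is visible through [Ph] in the second equations,
   whose right-hand sides vanish with [delta ze]. *)
have [z0 Vz0 ez0] := codiff_eq0_P0h hm jn Wze dze0;
have VPze := P0hPh j.+2 Lze; have LPze := P0h_L2 VPze.
have Ezeta : feq zetad zetac.
  apply: (ip_sub_eq0 mO Lzd Lzc); apply: (etrans (esym (Ph_ip_feq hm Lze Lze Vz0 ez0))).
  apply: (etrans (ipC _ _ _)); apply: (etrans (ipBl mO Lzd Lzc LPze)).
  have Ed : ip zetad (Ph j.+2 ze) = 0.
    apply: (etrans (esym (Pip Lzd VPze))); apply: (etrans (hd2 _ Wze)).
    exact: ip_feq0r Lwd Wze dze0.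
  have Ec : ip zetac (Ph j.+2 ze) = 0.
    apply: (etrans (esym (Pip Lzc VPze))); apply: (etrans (hc2 Wze)).
    exact: ip_feq0r Lwc Wze dze0.
  by rewrite Ed Ec subrr.
have E3 mu : Wstar0 j.+1 mu -> ip (delta j.+1 wd) (delta j.+1 mu) = ip (Ph j sigmac) (delta j.+1 mu).
  move=> Wmu; have Lmu := Wstar0_L2 Wmu.
  have cd := codiff_feq_congr hm Wzc Lzd (feq_sym Ezeta).
  exact: (cancel3_r (E1 _ Wmu) (tdc _ Lmu) (ip_feq mO Ldzd Ldzc Lmu Lmu cd (feq_refl _ _))).
have gdE w : L2 Omega w -> ip gd w = ip (delta j.+1 wd) w.
  by move=> Lw; exact: (esym (ip_feq mO Ldwd Lgd Lw Lw wgd (feq_refl _ _))).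
(* Orthogonality to all codifferentials puts [r] in [Wnc] with [dh r = 0]; adjointness and the third
   equation of (c) then make both terms of [r] orthogonal to it. *)
pose r : dform R n := fun x => gd x - Ph j sigmac x.
have Vr : P0h j r by exact: (P0hB hm).
have Lr := P0h_L2 Vr.
have Wr : Wnc j r.
  apply: (P0h_orth_codiff_Wnc hm Vr) => mu Wmu; have Ldmu := Wstar0_codiff_L2 Wmu.
  apply: (etrans (ipBl mO Lgd LPsc Ldmu)); apply/eqP; rewrite subr_eq0; apply/eqP.
  exact: (etrans (gdE _ Ldmu) (E3 _ Wmu)).
have dr0 := dh_P0h_eq0 hm Vr.
have Er : feq gd (Ph j sigmac).
  apply: (ip_sub_eq0 mO Lgd LPsc); apply: (etrans (ipBl mO Lgd LPsc Lr)).
  have R1 : ip gd r = 0.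
    apply: (etrans (gdE _ Lr)); apply: (etrans (ipC _ _ _)); apply: (etrans (Wnc_adjoint Wr Wwd)).
    by rewrite dr0; exact: ip0l.
  have R2 : ip (Ph j sigmac) r = 0.
    apply: (etrans (ipC _ _ _)); apply: (etrans (esym (Pip Lr VPs))).
    apply: (etrans (ipC _ _ _)); apply: (etrans (hc3 Wr)).
    by rewrite dr0; exact: ip0r.
  by rewrite R1 R2 subrr.
have Edw := feq_trans wgd Er.
have VPw := P0hPh j.+1 Lwd; have LPw := P0h_L2 VPw.
(* [e] turns out orthogonal to both ranges, so it is in [Hs0] and in [Hnc]; the first equations of
   (d) and (c) make it orthogonal to itself. *)
pose e : dform R n := fun x => Ph j.+1 wd x - wc x.
have Ve : P0h j.+1 e by exact: (P0hB hm).
have Le := P0h_L2 Ve.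
have [He Hs] : Hnc j.+1 e /\ Hs0 j.+1 e.
  apply: P0h_Hnc_Hs0 => // [tau Wtau|eta We].
    have Vd := dh_P0h hm (Wnc_P1mh Wtau); have Ld := P0h_L2 Vd; have Ltau := Wnc_L2 Wtau.
    apply: (etrans (ipBl mO LPw Lwc Ld)); apply/eqP; rewrite subr_eq0; apply/eqP.
    apply: (etrans (Pip Lwd Vd)); apply: (etrans (ipC _ _ _)).
    apply: (etrans (esym (Wnc_adjoint Wtau Wwd))).
    apply: (etrans (ip_feq mO Ltau Ltau Ldwd LPsc (feq_refl _ _) Edw)).
    apply: (etrans (esym (Pip Ltau VPs))); apply: (etrans (ipC _ _ _)).
    exact: hc3.
  have Lde := Wstar0_codiff_L2 We; have [g' Vg' eg'] := Wstar0_codiff_P0h hm jn We.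
  have Leta := Wstar0_L2 We; have VPe := P0hPh j.+2 Leta; have LPe := P0h_L2 VPe.
  apply: (etrans (ipBl mO LPw Lwc Lde)); apply/eqP; rewrite subr_eq0; apply/eqP.
  apply: (etrans (Ph_ip_feq hm Lwd Lde Vg' eg')); apply: (etrans (esym (hd2 _ We))).
  apply: (etrans (Pip Lzd VPe)).
  apply: (etrans (ip_feq mO Lzd Lzc LPe LPe Ezeta (feq_refl _ _))).
  exact: (etrans (esym (Pip Lzc VPe)) (hc2 We)).
have Ee : feq (Ph j.+1 wd) wc.
  apply: (ip_sub_eq0 mO LPw Lwc); apply: (etrans (ipBl mO LPw Lwc Le)).
  have F1 : ip (Ph j.+1 wd) e = 0 by exact: (etrans (Pip Lwd Ve) (hd1 _ Hs)).
  by rewrite F1 (hc1 He) subrr.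
by split=> //; exact: feq_trans Etd (feq_sym ht).
Qed.

(** Mirror image of the dual scheme with [dh] and [delta] exchanged; both harmonic parts lie in
    [Hnc] and can be subtracted directly. *)
Lemma solves_p_correct wp sigmap thetap : solves_p Omega G j.+1 f wp sigmap thetap ->
  [/\ feq thetap thetac, feq sigmap sigmac, feq (Ph j.+1 wp) wc,
      feq (dh wp) (Ph j.+2 zetac) & feq (dh sigmap) (dh sigmac)].
Proof.
move=> [/= Wwp Wsp Htp hp].
have [Wtp dtp ztp] := Htp; have [_ dtc ztc] := Htc.
have [[Lwp Lsp] Ltp] := (Wnc_L2 Wwp, Wnc_L2 Wsp, Wnc_L2 Wtp).
have [Vwp Vsp] := (Wnc_P1mh Wwp, Wnc_P1mh Wsp).
have [Ldwp Ldsp] := (dh_L2 hm Vwp, dh_L2 hm Vsp).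
have [VPz VPs] := (P0hPh j.+2 Lzc, P0hPh j Lsc).
have E1 mu : Wnc j.+1 mu -> ip thetap mu + ip (dh sigmap) mu + ip (dh wp) (dh mu) =
    ip thetac mu + ip (dh sigmac) mu + ip (Ph j.+2 zetac) (dh mu).
  move=> Wmu; have Lmu := Wnc_L2 Wmu; have Vd := dh_P0h hm (Wnc_P1mh Wmu).
  have [_ _ E] := hp _ _ _ Wmu Wsp Htp; apply: (etrans E).
  apply: (etrans (esym (solves_c_average Lmu))); apply: (etrans (addrAC _ _ _)); congr (_ + _).
  apply: (etrans (ipC _ _ _)); apply: (etrans (Wnc_adjoint Wmu Wzc)).
  by apply: (etrans (ipC _ _ _)); exact: (esym (Pip Lzc Vd)).
have hp1 vs : Hnc j.+1 vs -> ip wp vs = 0 by move=> Hv; have [] := hp _ _ _ Wwp Wsp Hv.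
have hp2 tau : Wnc j tau -> ip (Ph j sigmap) (Ph j tau) = ip wp (dh tau).
  by move=> Wt; have [_ /eqP + _] := hp _ _ _ Wwp Wt Htp; rewrite subr_eq0 => /eqP.
have dh0r w mu : L2 Omega w -> P1mh Omega G j.+1 mu -> feq (dh mu) (fun=> 0) -> ip w (dh mu) = 0.
  move=> Lw Vmu d0; apply: (etrans (ip_feq mO Lw Lw (dh_L2 hm Vmu) (L2_0 _) (feq_refl _ _) d0)).
  exact: ip0r.
pose t : dform R n := fun x => thetap x - thetac x.
have Wt : Wnc j.+1 t by exact: WncB.
have Lt := Wnc_L2 Wt.
have dt0 : feq (dh t) (fun=> 0).
  rewrite (dhB hm (Wnc_P1mh Wtp) (Wnc_P1mh Wtc)); apply: (feq_trans (feqB dtp dtc)).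
  by apply: aeW => x _; rewrite subr0.
have tdh tau : Wnc j tau -> ip (dh tau) t = 0.
  move=> Wtau; have Ld := dh_L2 hm (Wnc_P1mh Wtau).
  by rewrite ipC (ipBl mO Ltp Ltc Ld) (ztp _ Wtau) (ztc _ Wtau) subrr.
have Et : feq thetap thetac.
  apply: (ip_sub_eq0 mO Ltp Ltc); apply: (etrans (ipBl mO Ltp Ltc Lt)).
  apply/eqP; rewrite subr_eq0; apply/eqP.
  exact: (cancel3_l (E1 _ Wt) (tdh _ Wsp) (tdh _ Wsc) (dh0r _ _ Ldwp (Wnc_P1mh Wt) dt0)
    (dh0r _ _ LPzc (Wnc_P1mh Wt) dt0)).
have tE mu : L2 Omega mu -> ip thetap mu = ip thetac mu.
  by move=> Lmu; exact: (ip_feq mO Ltp Ltc Lmu Lmu Et (feq_refl _ _)).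
pose s : dform R n := fun x => sigmap x - sigmac x.
have Ws : Wnc j s by exact: WncB.
have [Ls Vs] := (Wnc_L2 Ws, Wnc_P1mh Ws).
have sE : dh s = fun x => dh sigmap x - dh sigmac x by exact: (dhB hm Vsp (Wnc_P1mh Wsc)).
(* The complex property makes [dh s] an admissible test form, and its own [dh] is zero. *)
have VD := dh_P0h hm Vs; have LD := P0h_L2 VD; have WD := Wnc_dh hm jn Ws.
have dD0 : feq (dh (dh s)) (fun=> 0) by rewrite (dh_P0h_eq0 hm VD); exact: feq_refl.
have ED : feq (dh sigmap) (dh sigmac).
  apply: (ip_sub_eq0 mO Ldsp Ldsc); rewrite -sE.
  have E := cancel3 (E1 _ WD) (tE _ LD) (dh0r _ _ Ldwp (Wnc_P1mh WD) dD0)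
    (dh0r _ _ LPzc (Wnc_P1mh WD) dD0).
  rewrite {1}sE; apply: (etrans (ipBl mO Ldsp Ldsc LD)).
  by apply/eqP; rewrite subr_eq0; apply/eqP.
have ds0 : feq (dh s) (fun=> 0) by rewrite sE; apply/feq_subr0.
have [s0 Vs0 ss0] := dh_eq0_P0h hm Vs ds0.
have VPs' := P0hPh j Ls; have LPs' := P0h_L2 VPs'.
have Es : feq sigmap sigmac.
  apply: (ip_sub_eq0 mO Lsp Lsc); apply: (etrans (esym (Ph_ip_feq hm Ls Ls Vs0 ss0))).
  apply: (etrans (ipC _ _ _)); apply: (etrans (ipBl mO Lsp Lsc LPs')).
  have ds0r w : L2 Omega w -> ip w (dh s) = 0.
    move=> Lw; apply: (etrans (ip_feq mO Lw Lw LD (L2_0 _) (feq_refl _ _) ds0)).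
    exact: ip0r.
  have Ep : ip sigmap (Ph j s) = 0.
    by apply: (etrans (esym (Pip Lsp VPs'))); apply: (etrans (hp2 _ Ws)); exact: ds0r.
  have Ec : ip sigmac (Ph j s) = 0.
    by apply: (etrans (esym (Pip Lsc VPs'))); apply: (etrans (hc3 Ws)); exact: ds0r.
  by rewrite Ep Ec subrr.
have Vdwp := dh_P0h hm Vwp.
pose r : dform R n := fun x => dh wp x - Ph j.+2 zetac x.
have Vr : P0h j.+2 r by exact: (P0hB hm).
have Lr := P0h_L2 Vr.
(* The double annihilator result makes [r] conforming with zero codifferential; adjointness and the
   second equation of (c) then both give 0 against it. *)
have [Wr dr0] : Wstar0 j.+2 r /\ feq (delta j.+2 r) (fun=> 0).
  apply: (P0h_orth_dh_Wstar0 hm jn Vr) => mu Wmu; have Ldmu := dh_L2 hm (Wnc_P1mh Wmu).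
  apply: (etrans (ipBl mO Ldwp LPzc Ldmu)); apply/eqP; rewrite subr_eq0; apply/eqP.
  have Lmu := Wnc_L2 Wmu.
  exact: (cancel3_r (E1 _ Wmu) (tE _ Lmu) (ip_feq mO Ldsp Ldsc Lmu Lmu ED (feq_refl _ _))).
have Er : feq (dh wp) (Ph j.+2 zetac).
  apply: (ip_sub_eq0 mO Ldwp LPzc); apply: (etrans (ipBl mO Ldwp LPzc Lr)).
  have R1 : ip (dh wp) r = 0.
    by apply: (etrans (esym (Wnc_adjoint Wwp Wr))); exact: ip_feq0r.
  have R2 : ip (Ph j.+2 zetac) r = 0.
    apply: (etrans (ipC _ _ _)); apply: (etrans (esym (Pip Lr VPz))).
    by apply: (etrans (ipC _ _ _)); apply: (etrans (hc2 Wr)); exact: ip_feq0r.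
  by rewrite R1 R2 subrr.
have VPw := P0hPh j.+1 Lwp; have LPw := P0h_L2 VPw.
pose e : dform R n := fun x => Ph j.+1 wp x - wc x.
have Ve : P0h j.+1 e by exact: (P0hB hm).
have Le := P0h_L2 Ve.
have [He _] : Hnc j.+1 e /\ Hs0 j.+1 e.
  apply: P0h_Hnc_Hs0 => // [tau Wtau|eta We].
    have Vd := dh_P0h hm (Wnc_P1mh Wtau); have Ld := P0h_L2 Vd; have Ltau := Wnc_L2 Wtau.
    have VPt := P0hPh j Ltau; have LPt := P0h_L2 VPt.
    apply: (etrans (ipBl mO LPw Lwc Ld)); apply/eqP; rewrite subr_eq0; apply/eqP.
    apply: (etrans (Pip Lwp Vd)); apply: (etrans (esym (hp2 _ Wtau))).
    apply: (etrans (Pip Lsp VPt)).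
    apply: (etrans (ip_feq mO Lsp Lsc LPt LPt Es (feq_refl _ _))).
    exact: (etrans (esym (Pip Lsc VPt)) (hc3 Wtau)).
  have Lde := Wstar0_codiff_L2 We; have [g' Vg' eg'] := Wstar0_codiff_P0h hm jn We.
  have Leta := Wstar0_L2 We.
  apply: (etrans (ipBl mO LPw Lwc Lde)); apply/eqP; rewrite subr_eq0; apply/eqP.
  apply: (etrans (Ph_ip_feq hm Lwp Lde Vg' eg')); apply: (etrans (Wnc_adjoint Wwp We)).
  apply: (etrans (ip_feq mO Ldwp LPzc Leta Leta Er (feq_refl _ _))).
  apply: (etrans (ipC _ _ _)); apply: (etrans (esym (Pip Leta VPz))).
  by apply: (etrans (ipC _ _ _)); exact: hc2.
have Ee : feq (Ph j.+1 wp) wc.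
  apply: (ip_sub_eq0 mO LPw Lwc); apply: (etrans (ipBl mO LPw Lwc Le)).
  have F1 : ip (Ph j.+1 wp) e = 0 by exact: (etrans (Pip Lwp Ve) (hp1 _ He)).
  by rewrite F1 (hc1 He) subrr.
by split.
Qed.

End schemes.

Theorem lemma4p4 (R : realType) (n : nat) (Omega : set 'rV[R]_n)
  (N : nat) (G : 'I_N -> 'I_n.+1 -> 'rV[R]_n) (k : nat) (f : dform R n)
  (wc zetac sigmac thetac : dform R n)
  (wp sigmap thetap : dform R n)
  (wd zetad thetad : dform R n) :
  (2 <= n)%N ->
  polyhedral_domain Omega ->
  simplicial_subdivision Omega G ->
  (1 <= k <= n - 1)%N ->
  L2form Omega k f ->
  solves_c Omega G k f wc zetac sigmac thetac ->
  solves_p Omega G k f wp sigmap thetap ->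
  solves_d Omega G k f wd zetad thetad ->
  let P := Ph Omega G in
  let delta := codiff Omega in
  [/\ feq Omega thetad thetac,
      feq Omega zetad zetac,
      feq Omega (P k wd) wc,
      feq Omega (delta k wd) (P k.-1 sigmac) &
      feq Omega (delta k.+1 zetad)
        (fun x => P k f x - dh G sigmac x - thetac x)] /\
  [/\ feq Omega thetap thetac,
      feq Omega sigmap sigmac,
      feq Omega (P k wp) wc,
      feq Omega (dh G wp) (P k.+1 zetac) &
      feq Omega (dh G sigmap)
        (fun x => P k f x - delta k.+1 zetac x - thetac x)] /\
  [/\ feq Omega thetad thetap,
      feq Omega (P k.+1 zetad) (dh G wp),
      feq Omega (P k wd) (P k wp),
      feq Omega (delta k wd) (P k.-1 sigmap) &
      feq Omega (fun x => delta k.+1 zetad x + dh G sigmap x)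
        (fun x => P k f x - thetac x)].
Proof.
move=> n2 pO sG k_bnd Lf hc hp hd P delta.
have hm : mesh Omega G by apply: mesh_of_subdivision => //; exact: ltnW.
case: k k_bnd Lf hc hp hd => [//|j] /andP[_ jn1] Lf hc hp hd.
have jn : (j.+1 < n)%N by lia.
have [td zd wdc dwd] := solves_d_correct hm jn hc hd.
have [tp sp wpc dwp dsp] := solves_p_correct hm jn hc hp.
(* The last identity of each group is this strong form of (c), rewritten with the identifications
   above. *)
have [g _ [gz res]] := solves_c_residual hm jn Lf hc.
have res' := feq_trans res gz.
have [_ Wzc Wsc _ _] := hc; have [_ Wsp _ _] := hp; have [_ Wzd _ _] := hd.
have Lzc := Wstar0_L2 Wzc; have Lzd := Wstar0_L2 Wzd.
have Lsc := Wnc_L2 Wsc; have Lsp := Wnc_L2 Wsp.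
have dz : feq Omega (delta j.+2 zetad) (delta j.+2 zetac).
  exact: (codiff_feq_congr hm Wzc Lzd (feq_sym zd)).
have d5 := feq_trans dz (feq_sym res').
have p5 : feq Omega (dh G sigmap) (fun x => P j.+1 f x - delta j.+2 zetac x - thetac x).
  apply: (feq_trans dsp); move: res'; apply: filterS => x h Ox; have /= E := h Ox; rewrite /delta -E.
  by apply/ffunP => A; rewrite !(ffunD, ffunN); ring.
split; first by split.
split; first by split.
split.
- exact: feq_trans td (feq_sym tp).
- exact: feq_trans (Ph_feq hm j.+2 Lzd Lzc zd) (feq_sym dwp).
- exact: feq_trans wdc (feq_sym wpc).
- exact: feq_trans dwd (Ph_feq hm j Lsc Lsp (feq_sym sp)).
apply: (feq_trans (feqD d5 dsp)); apply: aeW => x _.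
by rewrite addrAC subrK.
Qed.
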